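(* Fix $u\in[0,1]$ and $T>0$. Let $b(t,x,\mu)=\int_{\mathbb R}\widetilde b(t,x,y)\mu(\mathrm dy)$, where $\widetilde b:[0,\infty)\times\mathbb R\times\mathbb R\to\mathbb R$ is measurable and for every $T'>0$ there is a constant $C_{T'}>0$ with $|\widetilde b(t,x_1,y_1)-\widetilde b(t,x_2,y_2)|\le C_{T'}(|x_1-x_2|+|y_1-y_2|)$ for $0\le t\le T'$ and $\sup_{0\le s\le T'}|\widetilde b(s,x,y)|\le C_{T'}(1+|x|+|y|)$, for all $x,y,x_i,y_i\in\mathbb R$. Let $X^{(u)}$ and $\overline X$ be, respectively, the finite particle system and the limiting chain described in the context. Assume that the marginal distribution $\mathrm m_t(\mathrm dy)=\mathrm m_t^*(\mathrm dy)$ of the solution $(X^{(u)}_t,t\ge0)$ of the directed chain stochastic equation (see context) has a density $m_t(\cdot)$, i.e. $\mathrm m_t(\mathrm dy)=m_t(y)\,\mathrm dy$, that $\int_{\mathbb R}|y|^2\,\mathrm m_0(\mathrm dy)<\infty$, and that there exists a constant $C_T$ such that $$\Big|\widetilde b(t,x_1,y_1)\cdot\frac{m_t(x_1)}{m_t(y_1)}-\widetilde b(t,x_2,y_2)\cdot\frac{m_t(x_2)}{m_t(y_2)}\Big|\le C_T\big(|x_1-x_2|+|y_1-y_2|\big)$$ for every $(x_i,y_i)\in\mathbb R^2$, $i=1,2$, $0\le t\le T$, and $$\Big|\widetilde b(t,x,y)\cdot\frac{m_t(x)}{m_t(y)}\Big|\le C_T(1+|x|+|y|)$$ for every $(x,y)\in\mathbb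 R^2$, $0\le t\le T$. Then, for $0\le t\le T$, $$\sup_{n\ge1}\frac1{\sqrt n}\sum_{i=1}^n\mathbb E\Big[\sup_{0\le s\le t}\big|X^{(u)}_{s,i}-\overline X_{s,i}\big|\Big]<\infty.$$
   Context: Directed chain stochastic equation with parameter $u$, drift $b$, initial law $\mathrm m_0^{\otimes2}$ ($\mathrm m_0$ a probability measure on $\mathbb R$): on a filtered probability space, continuous adapted processes $X^{(u)}_\cdot,\widetilde X^{(u)}_\cdot$ and a standard Brownian motion $B_\cdot$ with $\mathrm dX^{(u)}_t=b(t,X^{(u)}_t,u\,\delta_{\widetilde X^{(u)}_t}+(1-u)\mathrm{Law}(X^{(u)}_t))\mathrm dt+\mathrm dB_t$, subject to: (i) $\mathrm{Law}(X^{(u)}_\cdot)=\mathrm{Law}(\widetilde X^{(u)}_\cdot)$ and $\widetilde X^{(u)}_\cdot$ is independent of $B_\cdot$; (ii) $B_\cdot$ is independent of $(X^{(u)}_0,\widetilde X^{(u)}_0)$; (iii) $\mathrm{Law}(X^{(u)}_0,\widetilde X^{(u)}_0)=\mathrm m_0\otimes\mathrm m_0$. Under the stated hypotheses on $b$ a weak solution is taken to exist and be unique in law; $\mathrm m^*$ denotes the law of $X^{(u)}_\cdot$ and $\mathrm m^*_t$ its marginal at time $t$. Let $W_{\cdot,i}$, $i\in\mathbb N$, be independent standard Brownian motions. Finite particle system, $n\ge1$: the initial values $X^{(u)}_{0,i}$, $i=1,\dots,n$, are i.i.d. with law $\mathrm m_0$, independent of the Brownian motions, and for $t\ge0$, $i=1,\dots,n$,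 with $X^{(u)}_{\cdot,n+1}\equiv X^{(u)}_{\cdot,1}$, $$\mathrm dX^{(u)}_{t,i}=b\Big(t,X^{(u)}_{t,i},\;u\cdot\delta_{X^{(u)}_{t,i+1}}+(1-u)\cdot\frac1n\sum_{j=1}^n\delta_{X^{(u)}_{t,j}}\Big)\mathrm dt+\mathrm dW_{t,i}.$$ Limiting chain, $n\ge1$: $(\overline X_{\cdot,n},\overline X_{\cdot,n+1})$ is the solution pair $(X^{(u)}_\cdot,\widetilde X^{(u)}_\cdot)$ of the directed chain stochastic equation driven by $B=W_{\cdot,n}$, and then recursively for $j=n-1,n-2,\dots,1$, given $\overline X_{\cdot,j+1}$, one solves $$\mathrm d\overline X_{t,j}=b\big(t,\overline X_{t,j},\;u\cdot\delta_{\overline X_{t,j+1}}+(1-u)\cdot\mathrm{Law}(\overline X_{t,j})\big)\mathrm dt+\mathrm dW_{t,j},\quad t\ge0,$$ with the restrictions for each pair that $\mathrm{Law}(\overline X_{\cdot,j})=\mathrm{Law}(\overline X_{\cdot,j+1})$ and $\overline X_{\cdot,j+1}$ is independent of $W_{\cdot,j}$. All $\overline X_{\cdot,i}$, $i=1,\dots,n+1$, have common law $\mathrm m^*$. The two systems are driven by the same Brownian motions $W_{\cdot,i}$ and have the same initial values: $X^{(u)}_{0,i}=\overline X_{0,i}$ a.s., $i=1,\dots,n$. *)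

(* Defs.v *)
From HB Require Import structures.
From mathcomp Require Import all_boot all_order all_algebra.
From mathcomp Require Import all_classical all_reals all_analysis.

Set Implicit Arguments.
Unset Strict Implicit.
Unset Printing Implicit Defensive.

Import Order.TTheory GRing.Theory Num.Theory.
Import numFieldNormedType.Exports.

Local Open Scope classical_set_scope.
Local Open Scope ring_scope.

(** * Stochastic processes *)

(* Times are nonnegative reals: a process is indexed by all of R, but its values
   at negative times are never used. *)
Definition process d (Omega : measurableType d) (R : realType) :=
  R -> {mfun Omega >-> R}.

Definition continuous_paths d (Omega : measurableType d) (R : realType)
    (X : process Omega R) : Prop :=
  forall w, {within `[0, +oo[, continuous (fun t => X t w)}.

(* The path space R^[0, oo), with the sigma-algebra generated by the coordinates
   at times t >= 0. *)
Definition path_cylinders (R : realType) : set (set (R -> R)) :=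
  [set C | exists (t : R) (A : set R),
     [/\ 0 <= t, measurable A & C = [set x | A (x t)]]].
Arguments path_cylinders R : clear implicits.

Definition path_space (R : realType) : measurableType (path_cylinders R).-sigma :=
  g_sigma_algebraType (path_cylinders R).

Definition sample_path d (Omega : measurableType d) (R : realType)
    (X : process Omega R) : Omega -> path_space R := fun w t => X t w.

Lemma measurable_sample_path d (Omega : measurableType d) (R : realType)
  (X : process Omega R) : measurable_fun [set: Omega] (sample_path X).
Proof.
apply: (@measurability _ _ Omega (path_space R) setT (sample_path X)
  (path_cylinders R)) => //.
move=> _ [_ [t [A [t0 mA ->]]] <-].
rewrite setTI; have -> : sample_path X @^-1` [set x | A (x t)] = X t @^-1` A by [].
exact: measurable_funPTI.
Qed.

HB.instance Definition _ d (Omega : measurableType d) (R : realType)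
  (X : process Omega R) := isMeasurableFun.Build _ _ _ _ (sample_path X)
    (measurable_sample_path X).

(* Law(X_.) *)
Definition path_law d (Omega : measurableType d) (R : realType)
    (P : probability Omega R) (X : process Omega R) :
    set (path_space R) -> \bar R :=
  distribution P (sample_path X).

Definition marginal (R : realType) (m : probability (path_space R) R) (t : R)
    (A : set R) : \bar R :=
  m [set x | A (x t)].

Definition same_law d (T : measurableType d) (R : realType)
    (mu nu : set T -> \bar R) : Prop :=
  forall A, measurable A -> mu A = nu A.

(** * Generated sigma-algebras and independence *)

Definition sigma_rv d (Omega : measurableType d) (R : realType)
    (Z : set {mfun Omega >-> R}) : set (set Omega) :=
  <<s [set E | exists Y (A : set R), [/\ Z Y, measurable A & E = Y @^-1` A]] >>.

Definition sigma_process d (Omega : measurableType d) (R : realType)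
    (X : process Omega R) : set (set Omega) :=
  sigma_rv [set X t | t in `[0, +oo[].

Definition independent d (Omega : measurableType d) (R : realType)
    (P : probability Omega R) (G H : set (set Omega)) : Prop :=
  forall A B, G A -> H B -> P (A `&` B) = (P A * P B)%E.

Definition mutually_independent d (Omega : measurableType d) (R : realType)
    (P : probability Omega R) (I : set nat) (G : nat -> set (set Omega)) : Prop :=
  forall (s : seq nat) (A : nat -> set Omega), uniq s ->
    (forall i, i \in s -> I i /\ G i (A i)) ->
    P (\bigcap_(i in [set` s]) A i) = (\prod_(i <- s) P (A i))%E.

(** * Filtrations and Brownian motion *)

Definition is_filtration d (Omega : measurableType d) (R : realType)
    (F : R -> set (set Omega)) : Prop :=
  (forall t : R, 0 <= t -> sigma_algebra [set: Omega] (F t) /\ F t `<=` measurable) /\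
  (forall s t : R, 0 <= s -> s <= t -> F s `<=` F t).

Definition adapted d (Omega : measurableType d) (R : realType)
    (F : R -> set (set Omega)) (X : process Omega R) : Prop :=
  forall (t : R) (A : set R), 0 <= t -> measurable A -> F t (X t @^-1` A).

Definition natural_filtration d (Omega : measurableType d) (R : realType)
    (X : process Omega R) (t : R) : set (set Omega) :=
  sigma_rv [set X s | s in `[0, t]].

Definition increment d (Omega : measurableType d) (R : realType)
    (X : process Omega R) (s t : R) : Omega -> R := fun w => X t w - X s w.

Lemma measurable_increment d (Omega : measurableType d) (R : realType)
  (X : process Omega R) (s t : R) :
  measurable_fun [set: Omega] (increment X s t).
Proof. exact: measurable_realfun.measurable_funB. Qed.

HB.instance Definition _ d (Omega : measurableType d) (R : realType)
  (X : process Omega R) (s t : R) := isMeasurableFun.Build _ _ _ _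
    (increment X s t) (measurable_increment X s t).

(* The second parameter of normal_prob is the standard deviation. *)
Definition brownian_motion_wrt d (Omega : measurableType d) (R : realType)
    (P : probability Omega R) (F : R -> set (set Omega)) (B : process Omega R) :
    Prop :=
  [/\ adapted F B,
      continuous_paths B,
      {ae P, forall w, B 0 w = 0} &
      forall s t : R, 0 <= s -> s < t ->
        same_law (distribution P (increment B s t)) (normal_prob 0 (Num.sqrt (t - s)))
        /\ independent P (F s) (sigma_rv [set increment B s t : {mfun Omega >-> R}])].

Definition brownian_motion d (Omega : measurableType d) (R : realType)
    (P : probability Omega R) (B : process Omega R) : Prop :=
  brownian_motion_wrt P (natural_filtration B) B.

(** * The stochastic differential equations *)

(* b(t, x, mu) *)
Definition drift (R : realType) (bt : R -> R -> R -> R) (t x : R)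
    (mu : {measure set R -> \bar R}) : R :=
  \int[mu]_y bt t x y.

(* u mu + (1 - u) nu *)
Definition mixture (R : realType) (u : {i01 R})
    (mu nu : {measure set R -> \bar R}) : {measure set R -> \bar R} :=
  measure_add (mscale u%:num%:nng mu) (mscale (1 - u%:num)%:nng nu).

(* 1/n * sum_(1 <= j <= n) \d_(x j) *)
Definition empirical_measure (R : realType) (n : nat) (x : nat -> R) :
    {measure set R -> \bar R} :=
  mscale (n%:R^-1)%:nng (msum (fun j => \d_(x j.+1)) n).

(* dX_t = b(t, X_t, mu_t) dt + dB_t with a possibly random measure mu_t: as the
   noise is additive, this is the pathwise integral equation below. The first two
   clauses say that the integrals defining b and the drift term exist. *)
Definition solves_sde d (Omega : measurableType d) (R : realType)
    (P : probability Omega R) (bt : R -> R -> R -> R) (X B : process Omega R)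
    (mu : R -> Omega -> {measure set R -> \bar R}) : Prop :=
  {ae P, forall w, forall t : R, 0 <= t ->
    [/\ (mu t w).-integrable [set: R] (fun y => (bt t (X t w) y)%:E),
        lebesgue_measure.-integrable `[0, t]
          (fun s => (drift bt s (X s w) (mu s w))%:E) &
        X t w = X 0 w
          + \int[lebesgue_measure]_(s in `[0, t]) drift bt s (X s w) (mu s w)
          + B t w]}.

(* The equation of the directed chain, Y being the neighbour of X. *)
Definition solves_chain_sde d (Omega : measurableType d) (R : realType)
    (P : probability Omega R) (bt : R -> R -> R -> R) (u : {i01 R})
    (X Y B : process Omega R) : Prop :=
  solves_sde P bt X B (fun t w => mixture u \d_(Y t w) (distribution P (X t))).

Definition directed_chain_solution d (Omega : measurableType d) (R : realType)
    (P : probability Omega R) (bt : R -> R -> R -> R) (u : {i01 R})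
    (m0 : probability R R) (X Y B : process Omega R) : Prop :=
  [/\ exists F : R -> set (set Omega),
        [/\ is_filtration F, adapted F X, adapted F Y & brownian_motion_wrt P F B],
      continuous_paths X /\ continuous_paths Y,
      solves_chain_sde P bt u X Y B,
      same_law (path_law P X) (path_law P Y)
        /\ independent P (sigma_process Y) (sigma_process B) &
      independent P (sigma_process B) (sigma_rv [set X 0; Y 0])
        /\ same_law (fun A : set (R * R) => P [set w | A (X 0 w, Y 0 w)])
                    (m0 \x m0)%E].

(* Both systems below are numbered from 1, as are the Brownian motions W. *)
Definition finite_particle_system d (Omega : measurableType d) (R : realType)
    (P : probability Omega R) (bt : R -> R -> R -> R) (u : {i01 R})
    (m0 : probability R R) (W : nat -> process Omega R) (n : nat)
    (X : nat -> process Omega R) : Prop :=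
  [/\ X n.+1 = X 1%N,
      forall i, (1 <= i <= n)%N -> continuous_paths (X i),
      [/\ mutually_independent P [set i | (1 <= i <= n)%N]
            (fun i => sigma_rv [set X i 0]),
          forall i, (1 <= i <= n)%N -> same_law (distribution P (X i 0)) m0 &
          independent P (sigma_rv [set X i 0 | i in [set i | (1 <= i <= n)%N]])
            (sigma_rv [set Y | exists i (t : R),
               [/\ (1 <= i)%N, 0 <= t & Y = W i t]])] &
      forall i, (1 <= i <= n)%N ->
        solves_sde P bt (X i) (W i) (fun t w =>
          mixture u \d_(X i.+1 t w) (empirical_measure n (fun j => X j t w)))].

Definition limiting_chain d (Omega : measurableType d) (R : realType)
    (P : probability Omega R) (bt : R -> R -> R -> R) (u : {i01 R})
    (m0 : probability R R) (W : nat -> process Omega R) (n : nat)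
    (X : nat -> process Omega R) : Prop :=
  directed_chain_solution P bt u m0 (X n) (X n.+1) (W n) /\
  forall j, (1 <= j < n)%N ->
    [/\ continuous_paths (X j),
        solves_chain_sde P bt u (X j) (X j.+1) (W j),
        same_law (path_law P (X j)) (path_law P (X j.+1)) &
        independent P (sigma_process (X j.+1)) (sigma_process (W j))].

(* Main.v *)
Require Import Defs.
From mathcomp Require Import all_boot all_order all_algebra.
From mathcomp Require Import all_classical all_reals all_analysis.
From mathcomp Require Import measurable_realfun lra ring zify.

(** Write x_i for the limiting chain and X_i for the particles. The noise is
    additive and shared, so X_i - x_i is a time integral of the difference of the
    two drifts. That difference is Lipschitz in the distances |X_j - x_j|, up to
      eps_i(s) = 1/n * sum_j phi(s, x_i(s), x_j(s)),
    where phi(s, x, y) = (1 - u) (b(s, x, y) - E b(s, x, x_1(s))) is the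
    fluctuation of the empirical drift ([drift_gap]). Summing over i and applying
    Gronwall's lemma path by path ([gronwall_integral]), the sum of the expected
    suprema is at most a constant times the time integral of sum_i E |eps_i(s)|,
    plus a constant due to the end of the chain, where the particle system is closed
    cyclically and the chain is not ([mean_sup_distance]).
    It remains to see that sum_i E |eps_i(s)| = O(sqrt n) ([fluctuation_means]).

    The function phi(s, x, .) is centred for the common law of the x_j(s), so the
    square of eps_i is controlled by the covariances of phi(x_i, x_j) and
    phi(x_i, x_k). The x_j are not independent, but their dependence decays along
    the chain. The chain is the solution of
      dx_i = g(t, x_i, x_(i+1)) dt + dW_i
    with a Lipschitz g, because the law in the drift is known and the same for all
    i. The K-th Picard iterate at i depends only on the initial values and Brownian
    motions of i, ..., i+K-1, and its mean square distance to x_i is of order 4^-K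
    ([picard_error]). These sources of randomness are independent between disjoint
    blocks ([independent_blocks]), so the covariance is of order 2^-K as soon as j
    is at distance K from i and k and K steps are available before the end of the
    chain ([covariance_bound]). The sum over all triples (i, j, k) is then of order
    n^2 instead of n^3, which is what the rate requires ([decorrelated_means]).

    All this rests on a bound for E x_i(t)^2. The equation bounds a weighted time
    integral of x_1^2 by half that of its neighbour x_2^2, plus a term of finite
    mean. As x_1 and x_2 have the same law, the expectation of this energy is
    finite and bounded ([contraction_same_law], [uniform_second_moment]). *)

Set Implicit Arguments.
Unset Strict Implicit.
Unset Printing Implicit Defensive.

Import Order.TTheory GRing.Theory Num.Theory.
Import numFieldNormedType.Exports.

Local Open Scope classical_set_scope.
Local Open Scope ring_scope.

(** * Monotonicity and finite sums of integrals *)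

(** The integral of a nonnegative function is the supremum of the integrals of the
    simple functions below it, so it is monotone without any measurability. This
    is how suprema of paths are integrated. *)
Lemma ge0_le_integral_lower d (U : measurableType d) (R : realType)
  (mu : {measure set U -> \bar R}) (f g : U -> \bar R) :
  (forall x, (0 <= f x)%E) -> (forall x, (f x <= g x)%E) ->
  (\int[mu]_x f x <= \int[mu]_x g x)%E.
Proof.
move=> f0 fg; rewrite !ge0_integralTE//; last by move=> x; exact: le_trans (fg x).
apply: le_ereal_sup => _ [h hf <-]; exists h => // x.
exact: le_trans (fg x).
Qed.

(** Raising g to +oo on the exceptional null set does not change its integral, and
    makes the inequality hold everywhere. *)
Lemma ae_ge0_le_integral_lower d (U : measurableType d) (R : realType)
  (mu : {measure set U -> \bar R}) (f g : U -> \bar R) :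
  (forall x, (0 <= f x)%E) -> (forall x, (0 <= g x)%E) ->
  measurable_fun [set: U] g -> {ae mu, forall x, (f x <= g x)%E} ->
  (\int[mu]_x f x <= \int[mu]_x g x)%E.
Proof.
move=> f0 g0 mg [N [mN N0 fgN]].
pose g' x := if x \in N then +oo%E else g x.
have mN' : measurable_fun [set: U] (fun x => x \in N).
  apply: (measurable_fun_bool true); rewrite setTI/=.
  by rewrite preimage_mem_true.
have mg' : measurable_fun [set: U] g'.
  by apply: measurable_fun_ifT.
have g'0 x : (0 <= g' x)%E by rewrite /g'; case: ifP.
apply: (@le_trans _ _ (\int[mu]_x g' x)%E).
  apply: ge0_le_integral_lower => // x; rewrite /g'; case: ifPn => [_|xN].
    by rewrite leey.
  have [//|nfg] := boolP (f x <= g x)%E.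
  by move: xN; rewrite notin_setE => /(_ (fgN _ _)); case; exact/negP.
rewrite le_eqVlt; apply/orP; left; apply/eqP.
apply: ge0_ae_eq_integral => //.
exists N; split => // x /= /not_implyP[_]; rewrite /g'.
by case: ifPn => // /set_mem.
Qed.

Section finite_range_sums.
Context d (S : measurableType d) (R : realType).

Lemma measurable_sum_range (F : nat -> S -> R) n :
  (forall i, (1 <= i <= n)%N -> measurable_fun [set: S] (F i)) ->
  measurable_fun [set: S] (fun z => \sum_(1 <= i < n.+1) F i z).
Proof.
move=> mF; rewrite (_ : (fun z => _) = (fun z =>
    \sum_(1 <= i < n.+1) (if (1 <= i <= n)%N then F i z else 0))); last first.
  by apply/funext => z; apply: eq_big_nat => i; rewrite ltnS => ->.
by apply: measurable_sum => i; case: (boolP (1 <= i <= n)%N) => iN; [exact: mF | exact: measurable_cst].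
Qed.

Lemma ge0_integral_sum_range (mu : {measure set S -> \bar R}) (D : set S)
    (F : nat -> S -> \bar R) n : measurable D ->
  (forall i, (1 <= i <= n)%N -> measurable_fun D (F i)) ->
  (forall i z, 0 <= F i z)%E ->
  (\int[mu]_(z in D) \sum_(1 <= i < n.+1) F i z = \sum_(1 <= i < n.+1) \int[mu]_(z in D) F i z)%E.
Proof.
move=> mD mF F0; pose G i z := if (1 <= i <= n)%N then F i z else 0%E.
transitivity (\int[mu]_(z in D) \sum_(1 <= i < n.+1) G i z)%E.
  apply: eq_integral => z _; apply: eq_big_nat => i; rewrite ltnS /G => -> //.
rewrite ge0_integral_sum//.
- by apply: eq_big_nat => i; rewrite ltnS /G => ->.
- by move=> i; rewrite /G; case: (boolP (1 <= i <= n)%N) => iN; [exact: mF | exact: measurable_cst].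
- by move=> i z _; rewrite /G; case: ifPn.
Qed.

End finite_range_sums.

(** * Joint measurability of continuous processes *)

Section joint_measurability.
Variable R : realType.

(** Discretised time: a process evaluated on the grid involves only countably many
    of its variables, and continuous paths are limits of their grid evaluations. *)
Definition grid (n : nat) (t : R) : R :=
  (Num.truncn (n.+1%:R * Num.max t 0))%:R / n.+1%:R.

Lemma grid_ge0 n t : 0 <= grid n t.
Proof. by rewrite /grid divr_ge0. Qed.

Lemma cvg_grid t : 0 <= t -> grid n t @[n --> \oo] --> t.
Proof.
move=> t0; rewrite /grid (max_idPl t0).
apply: (@squeeze_cvgr _ _ _ _ (fun n => t - n.+1%:R^-1) (fun n => t)).
+ near=> n; apply/andP; split.
    rewrite lerBlDr -[X in _ + X]mul1r -mulrDl ler_pdivlMr ?ltr0n// mulrC.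
    by apply/ltW; rewrite natr1; exact: truncnS_gt.
  by rewrite ler_pdivrMr ?ltr0n// mulrC truncn_le// mulr_ge0.
+ rewrite -[X in _ --> X]subr0; apply: cvgB; [exact: cvg_cst|exact: cvg_harmonic].
+ exact: cvg_cst.
Unshelve. all: by end_near. Qed.

Lemma measurable_grid_eval d (U : measurableType d) (x : R -> U -> R) n :
  (forall t, 0 <= t -> measurable_fun [set: U] (x t)) ->
  measurable_fun [set: R * U] (fun z : R * U => x (grid n z.1) z.2).
Proof.
move=> mx _ B mB; rewrite setTI.
set h := fun _ => _.
have -> : h @^-1` B = \bigcup_k
  ([set t : R | Num.truncn (n.+1%:R * Num.max t 0) = k] `*` (x (k%:R / n.+1%:R) @^-1` B)).
  apply/seteqP; split=> [[t w] /= Bx|[t w] [k _ /= [<-]]//].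
  by exists (Num.truncn (n.+1%:R * Num.max t 0)).
apply: bigcupT_measurable => k; apply: measurableX.
  have mtr : measurable_fun [set: R] (fun t : R => (Num.truncn (n.+1%:R * Num.max t 0))%:R : R).
    apply: nondecreasing_measurable => // s t st; rewrite ler_nat.
    apply: le_truncn; rewrite ler_pM2l ?ltr0n//.
    by rewrite ge_max !le_max st lexx/= orbT.
  have := mtr measurableT [set k%:R] (measurable_set1 _); rewrite setTI.
  congr (measurable _); apply/seteqP; split => t /= => [/eqP|->//].
  by rewrite eqr_nat => /eqP.
by rewrite -[X in measurable X]setTI; apply: mx => //; rewrite divr_ge0.
Qed.

Lemma cvg_grid_eval (f : R -> R) t :
  {within `[0, +oo[, continuous f} -> 0 <= t -> f (grid n t) @[n --> \oo] --> f t.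
Proof.
move=> /subspace_continuousP cf t0.
have ct : f y @[y --> within `[0, +oo[ (nbhs t)] --> f t by apply: cf; rewrite /= in_itv/= t0.
apply: (cvg_comp _ _ _ ct) => A /(cvg_grid t0).
by rewrite /nbhs/= /nbhs/=; apply: filterS => n; apply; rewrite in_itv/= grid_ge0.
Qed.

(** Negative times are cut off, so that the process is measurable on the whole
    product and Fubini applies without a restriction of the time domain. *)
Lemma measurable_continuous_process d (U : measurableType d) (x : R -> U -> R) :
  (forall t, 0 <= t -> measurable_fun [set: U] (x t)) ->
  (forall w, {within `[0, +oo[, continuous (fun t => x t w)}) ->
  measurable_fun [set: R * U] (fun z : R * U => x (Num.max z.1 0) z.2).
Proof.
move=> mx cx; apply: (@measurable_fun_cvg _ _ _ _ (fun n z => x (grid n z.1) z.2)).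
  by move=> n; exact: measurable_grid_eval.
move=> [t w] _ /=; have -> : (fun n => x (grid n t) w) = (fun n => x (grid n (Num.max t 0)) w).
  apply/funext => n; congr (x _ w); rewrite /grid; congr ((Num.truncn (_ * _))%:R / _).
  by rewrite -maxA maxxx.
by apply: (@cvg_grid_eval (fun t => x t w)) => //; rewrite le_max lexx orbT.
Qed.
End joint_measurability.

(** * Integrals over a time interval *)

Section time_integral.
Variable R : realType.
Local Notation leb := (@lebesgue_measure R).

Lemma integral_itv_indicator (a b : R) (g : R -> \bar R) :
  (\int[leb]_(s in `[a, b]) g s = \int[leb]_s (((a <= s <= b)%R)%:R%:E * g s))%E.
Proof.
rewrite integral_mkcond; apply: eq_integral => s _; rewrite /patch mem_setE in_itv/=.
by case: ifP => _; rewrite ?mul1e ?mul0e.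
Qed.

Lemma measurable_indicator_le d (U : measurableType d) (a b c : U -> R) :
  measurable_fun [set: U] a -> measurable_fun [set: U] b -> measurable_fun [set: U] c ->
  measurable_fun [set: U] (fun z => ((a z <= b z <= c z)%R)%:R%:E : \bar R).
Proof.
move=> ma mb mc.
have -> : (fun z => ((a z <= b z <= c z)%R)%:R%:E : \bar R) =
  (fun z => if a z <= b z <= c z then 1%E else 0%E).
  by apply/funext => z; case: (_ <= _ <= _).
apply: measurable_fun_ifT => //.
by apply: measurable_and; exact: measurable_fun_ler.
Qed.

Context d (U : measurableType d).

Lemma measurable_time_integral2 (f : R * U -> \bar R) :
  measurable_fun [set: R * U] f -> (forall z, 0 <= f z)%E ->
  measurable_fun [set: R * U] (fun z : R * U => \int[leb]_(s in `[0%R, z.1]) f (s, z.2))%E.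
Proof.
move=> mf f0.
pose g (z : R * (R * U)) : \bar R := (((0 <= z.1 <= z.2.1)%R)%:R%:E * f (z.1, z.2.2))%E.
have mg : measurable_fun [set: R * (R * U)] g.
  apply: emeasurable_funM.
    apply: measurable_indicator_le => //.
    exact: (measurableT_comp measurable_fst measurable_snd).
  apply: (measurableT_comp mf); apply: measurable_fun_pair => //.
  exact: (measurableT_comp measurable_snd measurable_snd).
have g0 z : (0 <= g z)%E by rewrite /g mule_ge0// lee_fin.
have mg' : measurable_fun [set: measurableTypeR R * (R * U)] g by exact: mg.
have := measurable_fun_fubini_tonelli_G (m1 := leb) g mg' g0.
congr (measurable_fun _ _); apply/funext => -[t w].
by rewrite /fubini_G/= integral_itv_indicator.
Qed.

Lemma measurable_time_integral (f : R * U -> \bar R) t :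
  measurable_fun [set: R * U] f -> (forall z, 0 <= f z)%E ->
  measurable_fun [set: U] (fun w => \int[leb]_(s in `[0%R, t]) f (s, w))%E.
Proof.
by move=> mf f0; apply: (measurable_fun_pair2 t (measurable_time_integral2 mf f0)).
Qed.

Lemma tonelli_time (P : probability U R) (f : R * U -> \bar R) t :
  measurable_fun [set: R * U] f -> (forall z, 0 <= f z)%E ->
  (\int[P]_w \int[leb]_(s in `[0%R, t]) f (s, w) =
   \int[leb]_(s in `[0%R, t]) \int[P]_w f (s, w))%E.
Proof.
move=> mf f0.
pose g (z : R * U) : \bar R := (((0 <= z.1 <= t)%R)%:R%:E * f z)%E.
have mg : measurable_fun [set: R * U] g.
  by apply: emeasurable_funM => //; apply: measurable_indicator_le.
have g0 z : (0 <= g z)%E by rewrite /g mule_ge0// lee_fin.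
have mg' : measurable_fun [set: measurableTypeR R * U] g by exact: mg.
have := fubini_tonelli (m1 := leb) (m2 := P) g mg' g0.
rewrite /g/= => /esym eq_g.
under eq_integral do rewrite integral_itv_indicator.
rewrite eq_g integral_itv_indicator; apply: eq_integral => s _.
rewrite ge0_integralZl_EFin//; exact: measurable_fun_pair2.
Qed.

Lemma measurable_time_Rintegral2 (f : R * U -> R) :
  measurable_fun [set: R * U] f ->
  measurable_fun [set: R * U] (fun z : R * U => \int[leb]_(s in `[0%R, z.1]) f (s, z.2)).
Proof.
move=> mf; apply: (measurableT_comp (f := fine)) => //.
have -> : (fun z : R * U => \int[leb]_(s in `[0%R, z.1]) (f (s, z.2))%:E)%E =
  (fun z : R * U => \int[leb]_(s in `[0%R, z.1]) (EFin \o f)^\+ (s, z.2) -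
                    \int[leb]_(s in `[0%R, z.1]) (EFin \o f)^\- (s, z.2))%E.
  by apply/funext => z; rewrite integralE; congr (_ - _)%E;
    apply: eq_integral => s _; rewrite /= ?funeposE ?funenegE.
apply: emeasurable_funB; apply: measurable_time_integral2.
- apply: measurable_funepos; exact/measurable_EFinP.
- by move=> z; rewrite funepos_ge0.
- apply: measurable_funeneg; exact/measurable_EFinP.
- by move=> z; rewrite funeneg_ge0.
Qed.

End time_integral.

(** Lebesgue measure lives on an alias of R that carries another instance of the
    Borel sigma-algebra. The lemmas prefixed by [leb] restate general facts with
    measurability hypotheses over R itself. *)
Section exponential_weights.
Variable R : realType.
Local Notation leb := (@lebesgue_measure R).

Lemma leb_integralZl (D : set R) (k : R) (f : R -> \bar R) : measurable D ->
  measurable_fun D f -> (forall x, D x -> 0 <= f x)%E -> 0 <= k ->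
  (\int[leb]_(x in D) (k%:E * f x) = k%:E * \int[leb]_(x in D) f x)%E.
Proof. move=> mD mf f0 k0; exact: (@ge0_integralZl_EFin _ (measurableTypeR R)). Qed.

Lemma leb_integralZr (D : set R) (k : \bar R) (f : R -> \bar R) : measurable D ->
  measurable_fun D f -> (forall x, D x -> 0 <= f x)%E -> (0 <= k)%E ->
  (\int[leb]_(x in D) (f x * k) = (\int[leb]_(x in D) f x) * k)%E.
Proof. move=> mD mf f0 k0; exact: (@ge0_integralZr _ (measurableTypeR R)). Qed.

Lemma leb_integralD (D : set R) (f g : R -> \bar R) : measurable D ->
  measurable_fun D f -> (forall x, D x -> 0 <= f x)%E ->
  measurable_fun D g -> (forall x, D x -> 0 <= g x)%E ->
  (\int[leb]_(x in D) (f x + g x) = \int[leb]_(x in D) f x + \int[leb]_(x in D) g x)%E.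
Proof. move=> mD mf f0 mg g0; exact: (@ge0_integralD _ (measurableTypeR R)). Qed.

Lemma leb_le_integral (D : set R) (f g : R -> \bar R) :
  (forall x, D x -> 0 <= f x)%E -> (forall x, D x -> f x <= g x)%E ->
  (\int[leb]_(x in D) f x <= \int[leb]_(x in D) g x)%E.
Proof.
move=> f0 fg; rewrite integral_mkcond [leRHS]integral_mkcond.
apply: ge0_le_integral_lower => x; rewrite /patch; case: ifPn => // /set_mem Dx.
  exact: f0.
exact: fg.
Qed.

Lemma measurable_exp_decay (l : R) :
  measurable_fun [set: R] (fun t : R => (expR (- (l * t)))%:E).
Proof.
apply/measurable_EFinP; apply: (@measurableT_comp _ _ _ _ _ _ expR _ (fun t => - (l * t))) => //.
by under eq_fun do rewrite -mulNr; exact: measurable_funM.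
Qed.

Lemma integral_expR (c a b : R) : c != 0 -> a < b ->
  (\int[leb]_(t in `[a, b]) (expR (c * t))%:E = (c^-1 * (expR (c * b) - expR (c * a)))%:E)%E.
Proof.
move=> c0 ab; pose F (t : R) := c^-1 * expR (c * t).
have dF (x : R) : is_derive x 1 F (expR (c * x)).
  rewrite /F; apply: is_derive_eq.
  rewrite /GRing.scale/= mulr1 mulrCA mulVf//; exact: mulr1.
have cF : continuous F.
  move=> x; apply: differentiable_continuous; apply/derivable1_diffP.
  by have [] := dF x.
rewrite (continuous_FTC2 (F := F)) ?EFinB ?mulrBr//.
- apply: continuous_subspaceT => x; apply: differentiable_continuous.
  by apply/derivable1_diffP; apply: ex_derive.
- split => /=.
  + by move=> x _; apply: ex_derive.
  + by apply: cvg_at_right_filter; exact: cF.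
  + by apply: cvg_at_left_filter; exact: cF.
- by move=> x _; rewrite derive1E; apply: derive_val.
Qed.

Lemma integral_expR_degenerate (c a b : R) : b <= a ->
  (\int[leb]_(t in `[a, b]) (expR (c * t))%:E = 0)%E.
Proof.
move=> ba; apply: (@integral_Sset1 _ _ _ a) => x; rewrite /= in_itv/= => /andP[ax xb].
by apply/eqP; rewrite eq_le ax (le_trans xb).
Qed.

Lemma integral_expR_le (l a b : R) : 0 < l ->
  (\int[leb]_(t in `[a, b]) (expR (- (l * t)))%:E <= (l^-1 * expR (- (l * a)))%:E)%E.
Proof.
move=> l0; under eq_integral do rewrite -mulNr; rewrite -mulNr.
have li0 : 0 <= l^-1 by rewrite invr_ge0 ltW.
have [ab|ba] := ltP a b; last by rewrite integral_expR_degenerate// lee_fin mulr_ge0 ?expR_ge0.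
rewrite integral_expR ?oppr_eq0 ?gt_eqF// lee_fin invrN.
have := mulr_ge0 li0 (expR_ge0 (- l * b)); lra.
Qed.

Lemma integral_expR_growing (l b : R) : 0 < l ->
  (\int[leb]_(t in `[0%R, b]) (expR (l * t))%:E <= (l^-1 * expR (l * b))%:E)%E.
Proof.
move=> l0; have li0 : 0 <= l^-1 by rewrite invr_ge0 ltW.
have [b0|b0] := ltP 0 b; last by rewrite integral_expR_degenerate// lee_fin mulr_ge0 ?expR_ge0.
by rewrite integral_expR ?gt_eqF// lee_fin ler_wpM2l// gerBl expR_ge0.
Qed.

(** After an exchange of the integrals, the weight of f s is the integral of
    exp(- l t) over t >= s. So, for a large weight l, integration over the past is
    a contraction: this is the integral form of Gronwall's argument. *)
Lemma weighted_time_integral (l T : R) (f : R -> \bar R) : 0 < l ->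
  measurable_fun [set: R] f -> (forall s, 0 <= f s)%E ->
  (\int[leb]_(t in `[0%R, T]) ((expR (- (l * t)))%:E * \int[leb]_(s in `[0%R, t]) f s)
   <= (l^-1)%:E * \int[leb]_(s in `[0%R, T]) ((expR (- (l * s)))%:E * f s))%E.
Proof.
move=> l0 mf f0.
have mexp := measurable_exp_decay l.
have mindR (t : R) : measurable_fun [set: R] (fun y : R => ((((0 <= y <= t)%R)%:R)%:E * f y)%E).
  by apply: emeasurable_funM => //; exact: measurable_indicator_le.
pose g (z : R * R) : \bar R := (((0 <= z.1 <= T)%R)%:R%:E * ((expR (- (l * z.1)))%:E *
  (((0 <= z.2 <= z.1)%R)%:R%:E * f z.2)))%E.
have mg : measurable_fun [set: R * R] g.
  apply: emeasurable_funM; first exact: measurable_indicator_le.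
  apply: emeasurable_funM; first exact: (measurableT_comp mexp).
  apply: emeasurable_funM; first exact: measurable_indicator_le.
  exact: (measurableT_comp mf).
have g0 z : (0 <= g z)%E by rewrite /g !mule_ge0// ?lee_fin// expR_ge0.
have mg' : measurable_fun [set: measurableTypeR R * measurableTypeR R] g by exact: mg.
have := fubini_tonelli (m1 := leb) (m2 := leb) g mg' g0; rewrite /g/= => eq_g.
have inner (t : R) : (((0 <= t <= T)%R)%:R%:E *
    ((expR (- (l * t)))%:E * \int[leb]_(s in `[0%R, t]) f s) =
  \int[leb]_y ((((0 <= t <= T)%R)%:R)%:E * ((expR (- (l * t)))%:E *
    ((((0 <= y <= t)%R)%:R)%:E * f y))))%E.
  have c0 : 0 <= expR (- (l * t)) by exact: expR_ge0.
  have h0 : forall y : R, [set: R] y -> (0 <= (((0 <= y <= t)%R)%:R)%:E * f y)%E.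
    by move=> y _; rewrite mule_ge0// lee_fin.
  have h1 := leb_integralZl measurableT (mindR t) h0 c0.
  have h2 : forall y : R, [set: R] y -> (0 <= (expR (- (l * t)))%:E * ((((0 <= y <= t)%R)%:R)%:E * f y))%E.
    by move=> y yT; rewrite mule_ge0 ?h0// lee_fin.
  have m2 : measurable_fun [set: R] (fun y : R => (expR (- (l * t)))%:E * ((((0 <= y <= t)%R)%:R)%:E * f y))%E.
    by apply: emeasurable_funM => //; exact: mindR.
  have h3 := leb_integralZl measurableT m2 h2 (ler0n R (0 <= t <= T)%R).
  by rewrite h3 h1 integral_itv_indicator.
rewrite integral_itv_indicator; under eq_integral => t _ do rewrite inner.
have m1R : measurable_fun [set: R] (fun s : R =>
    (((0 <= s <= T)%R)%:R%:E * ((expR (- (l * s)))%:E * f s))%E).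
  apply: emeasurable_funM; first exact: measurable_indicator_le.
  exact: emeasurable_funM.
rewrite [leLHS]eq_g [X in (_ * X)%E]integral_itv_indicator.
have n1 : forall s : R, [set: R] s -> (0 <= ((0 <= s <= T)%R)%:R%:E * ((expR (- (l * s)))%:E * f s))%E.
  by move=> s _; rewrite !mule_ge0// lee_fin// expR_ge0.
have li0 : 0 <= l^-1 by rewrite invr_ge0 ltW.
rewrite -(leb_integralZl measurableT m1R n1 li0).
apply: leb_le_integral => s _.
  by apply: integral_ge0 => t _; rewrite !mule_ge0// ?lee_fin// expR_ge0.
have [/andP[s0 sT]|sT] := boolP (0 <= s <= T); last first.
  rewrite mul0e mule0 integral0_eq; first exact: lexx.
  move=> t _.
  have [/andP[t0 tT]|] := boolP (0 <= t <= T); last by rewrite mul0e.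
  have [/andP[s0 st]|] := boolP (0 <= s <= t); last by rewrite mul0e !mule0.
  by move: sT; rewrite s0 (le_trans st).
rewrite mul1e muleA -EFinM.
apply: (@le_trans _ _ ((\int[leb]_(t in `[s, T]) (expR (- (l * t)))%:E) * f s)%E); last first.
  exact: (lee_wpmul2r (f0 s) (integral_expR_le _ _ l0)).
have m2R : measurable_fun [set: R] (fun t : R =>
    (((s <= t <= T)%R)%:R%:E * (expR (- (l * t)))%:E)%E).
  apply: emeasurable_funM; last exact: mexp.
  by apply: measurable_indicator_le; [exact: measurable_cst|exact: measurable_id|exact: measurable_cst].
have n2 : forall t : R, [set: R] t -> (0 <= ((s <= t <= T)%R)%:R%:E * (expR (- (l * t)))%:E)%E.
  by move=> t _; rewrite mule_ge0// lee_fin expR_ge0.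
rewrite integral_itv_indicator -(leb_integralZr measurableT m2R n2 (f0 s)).
apply: leb_le_integral => t _; first by rewrite !mule_ge0// ?lee_fin// expR_ge0.
have [/andP[t0 tT]|] := boolP (0 <= t <= T); last first.
  rewrite mul0e => _; rewrite mule_ge0 ?f0// mule_ge0 ?lee_fin ?expR_ge0//; exact: ler0n.
rewrite mul1e s0 tT andbT/=.
by rewrite muleCA muleA; exact: lexx.
Qed.

End exponential_weights.

Section integral_inequalities.
Context d (U : measurableType d) (R : realType) (mu : {measure set U -> \bar R}).

(** If f - h is integrable then so is h; otherwise the right-hand side is
    infinite. *)
Lemma dist_Rintegral_le (D : set U) (f h : U -> R) : measurable D ->
  mu.-integrable D (EFin \o f) -> measurable_fun D h ->
  (`|\int[mu]_(x in D) f x - \int[mu]_(x in D) h x|%:E <=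
   \int[mu]_(x in D) (`|f x - h x|)%:E)%E.
Proof.
move=> mD intf mh.
have mf : measurable_fun D f by apply/measurable_EFinP; case/integrableP: intf.
have mfh : measurable_fun D (fun x => f x - h x) by exact: measurable_funB.
have [->|fin] := eqVneq (\int[mu]_(x in D) (`|f x - h x|)%:E)%E +oo%E; first exact: leey.
have intfh : mu.-integrable D (EFin \o (fun x => f x - h x)).
  apply/integrableP; split; first exact/measurable_EFinP.
  by rewrite ltey; exact: fin.
have inth : mu.-integrable D (EFin \o h).
  apply: (eq_integrable mD (fun x => (f x)%:E - (f x - h x)%:E)%E).
    by move=> x _ /=; rewrite -EFinB opprB addrCA subrr addr0.
  exact: integrableB.
rewrite -RintegralB//.
have := le_normr_Rintegral mD intfh.
rewrite -lee_fin => /le_trans; apply.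
rewrite /Rintegral fineK//; apply: integrable_fin_num => //.
exact: (integrable_norm intfh).
Qed.

(** Cauchy-Schwarz on a set of measure at most t, obtained by integrating
    f <= t f^2 / (2 a) + a / (2 t), so that f may have an infinite integral. *)
Lemma sqr_le_integral (D : set U) (t a : R) (f : U -> R) : measurable D ->
  (mu D <= t%:E)%E -> measurable_fun D f -> (forall x, D x -> 0 <= f x) ->
  0 <= a -> (a%:E <= \int[mu]_(x in D) (f x)%:E)%E ->
  ((a ^+ 2)%:E <= t%:E * \int[mu]_(x in D) (f x ^+ 2)%:E)%E.
Proof.
move=> mD Dt mf f0 a0 af.
have t0 : 0 <= t by rewrite -lee_fin (le_trans _ Dt).
have J0 : (0 <= \int[mu]_(x in D) (f x ^+ 2)%:E)%E.
  by apply: integral_ge0 => x _; rewrite lee_fin sqr_ge0.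
move: a0; rewrite le_eqVlt => /orP[/eqP<-|a0].
  by rewrite expr0n/= mule_ge0// lee_fin.
have tp : 0 < t.
  rewrite lt_neqAle t0 andbT; apply/eqP => t00; move: Dt; rewrite -t00 => Dt.
  have D0 : mu D = 0%E by apply/eqP; rewrite eq_le Dt measure_ge0.
  move: af; rewrite null_set_integral//; last exact/measurable_EFinP.
  by rewrite lee_fin leNgt a0.
move: J0; case Jj : (\int[mu]_(x in D) (f x ^+ 2)%:E)%E => [j| |] // J0; last first.
  by rewrite gt0_muley ?leey// lte_fin.
have mf2 : measurable_fun D (fun x => f x ^+ 2) by exact: measurable_funX.
have : (a%:E <= (t / a / 2 * j + a / (2 * t) * t)%:E)%E.
  apply: (le_trans af).
  apply: (@le_trans _ _ (\int[mu]_(x in D) ((t / a / 2 * f x ^+ 2)%:E + (a / (2 * t))%:E))%E).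
    apply: ge0_le_integral => //.
    - exact/measurable_EFinP.
    - by apply/measurable_EFinP; apply: measurable_funD => //; apply: measurable_funM.
    - move=> x Dx; rewrite -EFinD lee_fin -subr_ge0.
      have -> : t / a / 2 * f x ^+ 2 + a / (2 * t) - f x = (t * f x - a) ^+ 2 / (2 * a * t).
        by field; rewrite !gt_eqF.
      by rewrite divr_ge0 ?sqr_ge0// !mulr_ge0// ltW.
  rewrite ge0_integralD//=.
  - rewrite EFinD; apply: leeD.
      under eq_integral do rewrite EFinM.
      rewrite ge0_integralZl_EFin//.
      + by rewrite Jj EFinM.
      + by move=> x _; rewrite lee_fin sqr_ge0.
      + exact/measurable_EFinP.
      + by rewrite !mulr_ge0// ?invr_ge0// ltW.
    rewrite integral_cst// [leRHS]EFinM; apply: lee_wpmul2l => //.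
    by rewrite lee_fin !mulr_ge0// ?invr_ge0 ?mulr_ge0// ltW.
  - by move=> x _; rewrite lee_fin mulr_ge0 ?sqr_ge0// !divr_ge0// ltW.
  - by apply/measurable_EFinP; apply: measurable_funM.
  - by move=> x _; rewrite lee_fin !mulr_ge0// ?invr_ge0 ?mulr_ge0// ltW.
rewrite -EFinM !lee_fin => H.
have : a * (2 * a) <= (t / a / 2 * j + a / (2 * t) * t) * (2 * a) by rewrite ler_pM2r// mulr_gt0.
have -> : (t / a / 2 * j + a / (2 * t) * t) * (2 * a) = t * j + a ^+ 2 by field; rewrite !gt_eqF.
nra.
Qed.

End integral_inequalities.

Section time_inequalities.
Variable R : realType.
Local Notation leb := (@lebesgue_measure R).

Lemma leb_dist_Rintegral_le (D : set R) (f h : R -> R) : measurable D ->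
  leb.-integrable D (EFin \o f) -> measurable_fun D h ->
  (`|\int[leb]_(x in D) f x - \int[leb]_(x in D) h x|%:E <=
   \int[leb]_(x in D) (`|f x - h x|)%:E)%E.
Proof. move=> mD intf mh; exact: (@dist_Rintegral_le _ (measurableTypeR R)). Qed.

Lemma lebesgue_measure_0t (t : R) : 0 <= t -> (leb `[0%R, t] <= t%:E)%E.
Proof. by move=> t0; rewrite lebesgue_measure_itv/= lte_fin; case: ifP => // _; rewrite -EFinD subr0. Qed.

Lemma leb_sqr_le_integral (t a : R) (f : R -> R) : 0 <= t ->
  measurable_fun [set: R] f -> (forall x, 0 <= f x) ->
  0 <= a -> (a%:E <= \int[leb]_(x in `[0%R, t]) (f x)%:E)%E ->
  ((a ^+ 2)%:E <= t%:E * \int[leb]_(x in `[0%R, t]) (f x ^+ 2)%:E)%E.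
Proof.
move=> t0 mf f0 a0 af; apply: (@sqr_le_integral _ (measurableTypeR R)) => //.
- exact: lebesgue_measure_0t.
- by have := measurable_funS measurableT (@subsetT _ `[0%R, t]) mf.
Qed.

End time_inequalities.

(** * Independence *)

Section independent_fubini.
Context d d1 d2 (U : measurableType d) (T1 : measurableType d1) (T2 : measurableType d2).
Context (R : realType) (P : probability U R).

(** The joint law is the product of the laws, so that V2 can be integrated first. *)
Lemma independent_abse_integral_le (V1 : U -> T1) (V2 : U -> T2) (h : T1 * T2 -> R) :
  measurable_fun [set: U] V1 -> measurable_fun [set: U] V2 ->
  (forall A B, measurable A -> measurable B ->
    P (V1 @^-1` A `&` V2 @^-1` B) = (P (V1 @^-1` A) * P (V2 @^-1` B))%E) ->
  measurable_fun [set: T1 * T2] h ->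
  P.-integrable [set: U] (fun w => (h (V1 w, V2 w))%:E) ->
  (forall x, P.-integrable [set: U] (fun w => (h (x, V2 w))%:E)) ->
  (`|\int[P]_w (h (V1 w, V2 w))%:E| <=
   \int[P]_w `|\int[P]_w' (h (V1 w, V2 w'))%:E|)%E.
Proof.
move=> mV1 mV2 indep mh intV intx.
pose X1 : {mfun U >-> T1} := mfun_Sub (mem_set mV1).
pose X2 : {mfun U >-> T2} := mfun_Sub (mem_set mV2).
have mV : measurable_fun [set: U] (fun w => (V1 w, V2 w)) by exact: measurable_fun_pair.
pose X : {mfun U >-> (T1 * T2)%type} := mfun_Sub (mem_set mV).
pose m1 := distribution P X1; pose m2 := distribution P X2; pose m := distribution P X.
have prodE A : measurable A -> (m1 \x m2)%E A = m A.
  apply: (@product_measure_unique _ _ _ _ _ m1 m2 m) => B C mB mC.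
  by rewrite -[RHS]indep.
have mhE : measurable_fun [set: T1 * T2] (EFin \o h) by exact/measurable_EFinP.
have intE : (\int[P]_w (h (V1 w, V2 w))%:E = \int[m1 \x m2]_z (h z)%:E)%E.
  rewrite (eq_measure_integral m); last by move=> A mA _; exact: prodE.
  by rewrite (integral_distribution (X := X) (f := EFin \o h)).
have int_prod : (m1 \x m2)%E.-integrable [set: T1 * T2] (EFin \o h).
  apply/integrableP; split => //.
  rewrite (eq_measure_integral m); last by move=> A mA _; exact: prodE.
  rewrite (ge0_integral_distribution (P := P) X (f := abse \o (EFin \o h)))//.
  - by case/integrableP: intV.
  - exact: measurableT_comp.
  - by move=> y; exact: abse_ge0.
rewrite intE -(integral12_prod_meas1 int_prod).
have intF := integrable_fubini_F int_prod.
apply: (le_trans (le_abse_integral _ _ _)) => //.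
  by case/integrableP: intF.
rewrite (ge0_integral_distribution (P := P) X1 (f := abse \o fubini_F m2 (EFin \o h)))//; last 2 first.
  - by apply: measurableT_comp => //; case/integrableP: intF.
  - by move=> y; exact: abse_ge0.
apply: ge0_le_integral_lower => w //=.
rewrite /fubini_F (integral_distribution (X := X2) (f := fun y => (EFin \o h) (V1 w, y)))//.
  exact: (measurable_fun_pair2 (V1 w) mhE).
exact: intx.
Qed.

End independent_fubini.

Section pi_lambda_independence.
Context d (U : measurableType d) (R : realType) (P : probability U R).

(** The pi-lambda theorem, applied to one family at a time. *)
Lemma independent_generated (G H : set (set U)) :
  G `<=` measurable -> H `<=` measurable ->
  setI_closed G -> setI_closed H -> G setT -> H setT ->
  independent P G H -> independent P <<s G >> <<s H >>.
Proof.
move=> mG mH cG cH GT HT indep.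
have half (G' : set (set U)) (B : set U) : G' `<=` measurable -> setI_closed G' -> G' setT ->
    measurable B -> (forall A, G' A -> P (A `&` B) = (P A * P B)%E) ->
    forall A, <<s G' >> A -> P (A `&` B) = (P A * P B)%E.
  move=> mG' cG' G'T mB GB A sA.
  have PB : (0 <= fine (P B))%R by rewrite fine_ge0.
  pose r : {nonneg R} := NngNum PB.
  have PBE : (r%:num%:E = P B)%E by rewrite /= fineK// fin_num_measure.
  have scE C : (mscale r P C = P B * P C)%E by rewrite -PBE.
  have : mrestr P mB A = mscale r P A.
    apply: (@g_sigma_algebra_measure_unique _ _ _ G' mG' (fun _ => setT)) => //.
    - by rewrite bigcup_const//; exists 0%N.
    - by move=> C GC; rewrite /= scE /mrestr GB// muleC.
    - move=> _; rewrite /= /mrestr (le_lt_trans (probability_le1 _ _))// ?ltey//; exact: measurableI.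
  by rewrite scE /mrestr muleC.
have smG : <<s G >> `<=` measurable by apply: smallest_sub => //; exact: sigma_algebra_measurable.
move=> A B sA sB.
have h1 : forall B, H B -> P (A `&` B) = (P A * P B)%E.
  move=> C HC; apply: (half G) => //; first exact: mH.
  by move=> D GD; exact: indep.
rewrite setIC muleC; apply: (half H) => //; first exact: smG.
by move=> C HC; rewrite setIC muleC; exact: h1.
Qed.

End pi_lambda_independence.

Section blocks.
Context d (U : measurableType d) (R : realType) (P : probability U R).
Context (n : nat) (xi : nat -> {mfun U >-> R}) (W : nat -> process U R).

Definition block_rv (A : set nat) : set {mfun U >-> R} :=
  [set Y | (exists2 l, A l & Y = xi l) \/
           (exists l (t : R), [/\ A l, 0 <= t & Y = W l t])].

Definition block_events (A : set nat) : set (set U) :=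
  [set E | exists Y (B : set R), [/\ block_rv A Y, measurable B & E = Y @^-1` B]].

Lemma sigma_rv_sub (Z Z' : set {mfun U >-> R}) : Z `<=` Z' -> sigma_rv Z `<=` sigma_rv Z'.
Proof.
move=> ZZ'; apply: sub_smallest2r => //.
by move=> _ [Y [B [ZY mB ->]]]; exists Y, B; split => //; exact: ZZ'.
Qed.

Lemma sigma_rv_measurable (Z : set {mfun U >-> R}) : sigma_rv Z `<=` measurable.
Proof.
apply: smallest_sub; first exact: sigma_algebra_measurable.
move=> _ [Y [B [_ mB ->]]]; rewrite -[X in measurable X]setTI.
exact: measurable_funPT.
Qed.

Lemma sigma_rvT (Z : set {mfun U >-> R}) : sigma_rv Z setT.
Proof. exact: (@measurableT _ (g_sigma_algebraType _)). Qed.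

Lemma sigma_rvI (Z : set {mfun U >-> R}) A B : sigma_rv Z A -> sigma_rv Z B -> sigma_rv Z (A `&` B).
Proof. exact: (@measurableI _ (g_sigma_algebraType _)). Qed.

Lemma sigma_rv_bigcap_seq (Z : set {mfun U >-> R}) (s : seq nat) (E : nat -> set U) :
  (forall l, l \in s -> sigma_rv Z (E l)) -> sigma_rv Z (\bigcap_(l in [set` s]) E l).
Proof.
by move=> sE; apply: (@fin_bigcap_measurable _ (g_sigma_algebraType _)).
Qed.

Let rect (A : set nat) (E1 E2 : nat -> set U) :=
  \bigcap_(l in A) (E1 l `&` E2 l).

(* The intersections of one initial event and one Brownian event per index form a
   pi-system that generates the events of a block. *)
Let rects (A : set nat) : set (set U) := [set E | exists E1 E2 : nat -> set U,
  [/\ forall l, A l -> sigma_rv [set xi l] (E1 l),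
      forall l, A l -> sigma_process (W l) (E2 l) &
      E = rect A E1 E2]].

Hypothesis xi_indep : mutually_independent P [set i | (1 <= i <= n)%N]
  (fun i => sigma_rv [set xi i]).
Hypothesis W_indep : mutually_independent P [set i | (1 <= i)%N]
  (fun i => sigma_process (W i)).
Hypothesis xi_W_indep : independent P (sigma_rv [set xi i | i in [set i | (1 <= i <= n)%N]])
  (sigma_rv [set Y | exists i (t : R), [/\ (1 <= i)%N, 0 <= t & Y = W i t]]).

(** Three independences are combined: of the initial values, of the Brownian
    motions, and of the two families from each other. *)
Lemma rect_prob (s : seq nat) (E1 E2 : nat -> set U) : uniq s ->
  (forall l, l \in s -> (1 <= l <= n)%N) ->
  (forall l, l \in s -> sigma_rv [set xi l] (E1 l)) ->
  (forall l, l \in s -> sigma_process (W l) (E2 l)) ->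
  P (rect [set` s] E1 E2) = (\prod_(l <- s) (P (E1 l) * P (E2 l)))%E.
Proof.
move=> us sn sE1 sE2.
rewrite /rect bigcapI xi_W_indep; last 2 first.
- apply: sigma_rv_bigcap_seq.
  move=> l ls; apply: (sigma_rv_sub _ (sE1 l ls)) => _ ->.
  by exists l => //; exact: sn.
- apply: sigma_rv_bigcap_seq.
  move=> l ls; apply: (sigma_rv_sub _ (sE2 l ls)) => _ [t t0 <-].
  exists l, t; split => //; first by have /andP[] := sn l ls.
  by move: t0; rewrite /= in_itv/= andbT.
rewrite xi_indep//; last by move=> l ls; split; [exact: sn|exact: sE1].
rewrite W_indep//; first by rewrite big_split.
by move=> l ls; split; [have /andP[] := sn l ls|exact: sE2].
Qed.

Lemma independent_blocks (A B : set nat) :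
  A `<=` [set i | (1 <= i <= n)%N] -> B `<=` [set i | (1 <= i <= n)%N] ->
  A `&` B = set0 ->
  independent P <<s block_events A >> <<s block_events B >>.
Proof.
move=> An Bn AB.
have Tsig := sigma_rvT.
have sub C : C `<=` [set i | (1 <= i <= n)%N] -> rects C `<=` measurable.
  move=> Cn _ [E1 [E2 [s1 s2 ->]]]; apply: fin_bigcap_measurable.
    by apply: sub_finite_set Cn _; apply: (sub_finite_set _ (finite_II n.+1)) => i /= /andP[].
  by move=> l Cl; apply: measurableI; apply: sigma_rv_measurable; [exact: s1|exact: s2].
have clI C : setI_closed (rects C).
  move=> _ _ [E1 [E2 [s1 s2 ->]]] [F1 [F2 [t1 t2 ->]]].
  exists (fun l => E1 l `&` F1 l), (fun l => E2 l `&` F2 l); split.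
  - move=> l Cl; apply: sigma_rvI; [exact: s1|exact: t1].
  - move=> l Cl; apply: sigma_rvI; [exact: s2|exact: t2].
  - by rewrite /rect -bigcapI; apply: eq_bigcapr => l _; rewrite setIACA.
have rT C : rects C setT.
  exists (fun=> setT), (fun=> setT); split => //; try by move=> l _; exact: Tsig.
  by rewrite /rect setIT; apply/esym/bigcapT.
have gen C : block_events C `<=` rects C.
  move=> _ [Y [D [[[l Cl ->]|[l [t [Cl t0 ->]]]] mD ->]]].
  - exists (fun i => if i == l then xi l @^-1` D else setT), (fun=> setT); split.
    + move=> i Ci; case: eqP => [->|_]; last exact: Tsig.
      by apply: sub_gen_smallest; exists (xi l), D.
    + by move=> i _; exact: Tsig.
    + apply/seteqP; split => [w Dw i Ci|w /(_ l Cl)[]]; rewrite ?eqxx//.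
      by split => //; case: eqP.
  - exists (fun=> setT), (fun i => if i == l then W l t @^-1` D else setT); split.
    + by move=> i _; exact: Tsig.
    + move=> i Ci; case: eqP => [->|_]; last exact: Tsig.
      apply: sub_gen_smallest; exists (W l t), D; split => //.
      by exists t => //=; rewrite in_itv/= t0.
    + apply/seteqP; split => [w Dw i Ci|w /(_ l Cl)[]]; rewrite ?eqxx//.
      by split => //; case: eqP.
have ind : independent P (rects A) (rects B).
  pose sq (C : set nat) := [seq l <- iota 1 n | l \in C].
  have sqE C : C `<=` [set i | (1 <= i <= n)%N] -> [set` sq C] = C.
    move=> Cn; apply/seteqP; split => [l|l Cl] /=; rewrite mem_filter.
      by move=> /andP[/set_mem].
    by rewrite mem_set//= mem_iota add1n ltnS; exact: Cn.
  have sq_in C l : l \in sq C -> C l by rewrite mem_filter => /andP[/set_mem].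
  have usq C : uniq (sq C) by rewrite filter_uniq// iota_uniq.
  move=> _ _ [E1 [E2 [s1 s2 ->]]] [F1 [F2 [t1 t2 ->]]].
  have PA : P (rect A E1 E2) = (\prod_(l <- sq A) (P (E1 l) * P (E2 l)))%E.
    rewrite -[in LHS](sqE A An); apply: rect_prob => // l /sq_in Al; [exact: An|exact: s1|exact: s2].
  have PB : P (rect B F1 F2) = (\prod_(l <- sq B) (P (F1 l) * P (F2 l)))%E.
    rewrite -[in LHS](sqE B Bn); apply: rect_prob => // l /sq_in Bl; [exact: Bn|exact: t1|exact: t2].
  pose G1 l := if l \in A then E1 l else F1 l.
  pose G2 l := if l \in A then E2 l else F2 l.
  have BnA l : B l -> (l \in A) = false.
    move=> Bl; apply/negbTE; rewrite notin_setE => Al.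
    by have : (A `&` B) l by []; rewrite AB.
  have -> : rect A E1 E2 `&` rect B F1 F2 = rect [set` sq A ++ sq B] G1 G2.
    have -> : [set` sq A ++ sq B] = A `|` B.
      rewrite -{2}(sqE A An) -{2}(sqE B Bn); apply/seteqP; split => l /=; rewrite mem_cat.
        by case/orP; [left|right].
      by case=> ->//; rewrite orbT.
    rewrite /rect bigcap_setU; congr (_ `&` _); apply: eq_bigcapr => l l_in.
      by rewrite /G1 /G2 mem_set.
    by rewrite /G1 /G2 BnA.
  rewrite rect_prob.
  - rewrite big_cat/= PA PB; congr (_ * _)%E; apply: eq_big_seq => l /sq_in l_in.
      by rewrite /G1 /G2 mem_set.
    by rewrite /G1 /G2 BnA.
  - rewrite cat_uniq !usq/= andbT; apply/hasPn => l /sq_in Bl; apply/negP => /sq_in Al.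
    by have : (A `&` B) l by []; rewrite AB.
  - by move=> l; rewrite mem_cat => /orP[]/sq_in => [/An|/Bn].
  - move=> l; rewrite mem_cat /G1 => /orP[]/sq_in l_in; first by rewrite mem_set//; exact: s1.
    by rewrite BnA//; exact: t1.
  - move=> l; rewrite mem_cat /G2 => /orP[]/sq_in l_in; first by rewrite mem_set//; exact: s2.
    by rewrite BnA//; exact: t2.
have ind' := independent_generated (sub A An) (sub B Bn) (clI A) (clI B) (rT A) (rT B) ind.
move=> E F sE sF; apply: ind'.
  by apply: (sub_smallest2r _ _ sE) => //; exact: smallest_sigma_algebra.
by apply: (sub_smallest2r _ _ sF) => //; exact: smallest_sigma_algebra.
Qed.

End blocks.

(** * Sums of weakly dependent terms *)

Lemma ler_norm_sqr (R : realType) (a : R) : `|a| <= 1 + a ^+ 2.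
Proof.
rewrite -[a ^+ 2]real_normK ?num_real//; set b := `|a|.
by have := sqr_ge0 (b - 1); have := sqr_ge0 b; nra.
Qed.

Section squares.
Context d (U : measurableType d) (R : realType) (P : probability U R).

(** Moments are computed by dominating f by a combination of squares of at most
    four variables with known second moments, with a coefficient 0 where fewer
    variables are involved. *)
Lemma expectation_le_squares (f g1 g2 g3 g4 : U -> R) (c0 c1 c2 c3 c4 m1 m2 m3 m4 : R) :
  measurable_fun [set: U] g1 -> measurable_fun [set: U] g2 ->
  measurable_fun [set: U] g3 -> measurable_fun [set: U] g4 ->
  0 <= c0 -> 0 <= c1 -> 0 <= c2 -> 0 <= c3 -> 0 <= c4 ->
  (\int[P]_w (g1 w ^+ 2)%:E <= m1%:E)%E -> (\int[P]_w (g2 w ^+ 2)%:E <= m2%:E)%E ->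
  (\int[P]_w (g3 w ^+ 2)%:E <= m3%:E)%E -> (\int[P]_w (g4 w ^+ 2)%:E <= m4%:E)%E ->
  (forall w, 0 <= f w <= c0 + c1 * g1 w ^+ 2 + c2 * g2 w ^+ 2 + c3 * g3 w ^+ 2 + c4 * g4 w ^+ 2) ->
  (\int[P]_w (f w)%:E <= (c0 + c1 * m1 + c2 * m2 + c3 * m3 + c4 * m4)%:E)%E.
Proof.
move=> mg1 mg2 mg3 mg4 c00 c10 c20 c30 c40 b1 b2 b3 b4 fle.
have step (h g : U -> R) (c a m : R) : measurable_fun [set: U] h -> (forall w, 0 <= h w) ->
    measurable_fun [set: U] g -> 0 <= c ->
    (\int[P]_w (h w)%:E <= a%:E)%E -> (\int[P]_w (g w ^+ 2)%:E <= m%:E)%E ->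
    [/\ measurable_fun [set: U] (fun w => h w + c * g w ^+ 2), forall w, 0 <= h w + c * g w ^+ 2 &
        (\int[P]_w (h w + c * g w ^+ 2)%:E <= (a + c * m)%:E)%E].
  move=> mh h0 mg c_ge0 ha gm; have mgg := measurable_funX 2 mg.
  split; [by apply: measurable_funD => //; exact: measurable_funM | |].
    by move=> w; rewrite addr_ge0// mulr_ge0// sqr_ge0.
  under eq_integral do rewrite EFinD EFinM.
  rewrite ge0_integralD//; last 4 first.
  - by move=> w _; rewrite lee_fin.
  - exact/measurable_EFinP.
  - by move=> w _; rewrite mule_ge0 ?lee_fin// sqr_ge0.
  - by apply: measurable_funeM; exact/measurable_EFinP.
  rewrite EFinD EFinM leeD// ge0_integralZl_EFin//; last 2 first.
  - by move=> w _; rewrite lee_fin sqr_ge0.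
  - exact/measurable_EFinP.
  by rewrite lee_wpmul2l// lee_fin.
have b0 : (\int[P]_w (cst c0 w)%:E <= c0%:E)%E.
  by have := integral_cst P measurableT c0%:E => ->; rewrite [X in (_ * X)%E]probability_setT mule1.
have [ma a0 ba] := step _ _ _ _ _ (measurable_cst c0) (fun=> c00) mg1 c10 b0 b1.
have [mb b0' bb] := step _ _ _ _ _ ma a0 mg2 c20 ba b2.
have [mc c0' bc] := step _ _ _ _ _ mb b0' mg3 c30 bb b3.
have [_ _ bd] := step _ _ _ _ _ mc c0' mg4 c40 bc b4.
apply: le_trans bd; apply: ge0_le_integral_lower => w; rewrite lee_fin; by case/andP: (fle w).
Qed.

Lemma integrable_le_real (f : U -> R) (c : R) : measurable_fun [set: U] f ->
  (\int[P]_w (`|f w|)%:E <= c%:E)%E -> P.-integrable [set: U] (EFin \o f).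
Proof.
move=> mf fc; apply/integrableP; split; first exact/measurable_EFinP.
exact: (le_lt_trans fc (ltry _)).
Qed.

Section covariance.
Variables (C M rho : R) (phi : R -> R -> R).
Hypotheses (C1 : 1 <= C) (M0 : 0 <= M) (rho0 : 0 < rho) (rho1 : rho <= 1).
Hypothesis mphi : measurable_fun [set: R * R] (fun z : R * R => phi z.1 z.2).
Hypothesis phi_lip : forall x y x' y',
  `|phi x y - phi x' y'| <= C * (`|x - x'| + `|y - y'|).
Hypothesis phi_growth : forall x y, `|phi x y| <= C * (1 + `|x| + `|y|).

Let sq_lip x y x' y' : (phi x y - phi x' y') ^+ 2 <=
  2 * C ^+ 2 * (x - x') ^+ 2 + 2 * C ^+ 2 * (y - y') ^+ 2.
Proof.
have h := phi_lip x y x' y'.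
have : `|phi x y - phi x' y'| ^+ 2 <= (C * (`|x - x'| + `|y - y'|)) ^+ 2.
  by rewrite ler_pXn2r// ?nnegrE// mulr_ge0// ?addr_ge0// (le_trans _ C1).
rewrite real_normK ?num_real// => /le_trans; apply.
rewrite exprMn -(real_normK (num_real (x - x'))) -(real_normK (num_real (y - y'))).
have -> : 2 * C ^+ 2 * `|x - x'| ^+ 2 + 2 * C ^+ 2 * `|y - y'| ^+ 2 =
  C ^+ 2 * (2 * (`|x - x'| ^+ 2 + `|y - y'| ^+ 2)) by ring.
rewrite ler_wpM2l ?sqr_ge0//.
have := sqr_ge0 (`|x - x'| - `|y - y'|); nra.
Qed.

Let sq_growth x y : phi x y ^+ 2 <= 3 * C ^+ 2 + 3 * C ^+ 2 * x ^+ 2 + 3 * C ^+ 2 * y ^+ 2.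
Proof.
have h := phi_growth x y.
have : `|phi x y| ^+ 2 <= (C * (1 + `|x| + `|y|)) ^+ 2.
  by rewrite ler_pXn2r// ?nnegrE// mulr_ge0// ?addr_ge0// (le_trans _ C1).
rewrite real_normK ?num_real// => /le_trans; apply.
rewrite exprMn -(real_normK (num_real x)) -(real_normK (num_real y)).
have -> : 3 * C ^+ 2 + 3 * C ^+ 2 * `|x| ^+ 2 + 3 * C ^+ 2 * `|y| ^+ 2 =
  C ^+ 2 * (3 * (1 + `|x| ^+ 2 + `|y| ^+ 2)) by ring.
rewrite ler_wpM2l ?sqr_ge0//.
have := sqr_ge0 (`|x| - `|y|); have := sqr_ge0 (`|x| - 1); have := sqr_ge0 (`|y| - 1); nra.
Qed.

Let mphi2 (f g : U -> R) : measurable_fun [set: U] f -> measurable_fun [set: U] g ->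
  measurable_fun [set: U] (fun w => phi (f w) (g w)).
Proof.
move=> mf mg; apply: (@measurableT_comp _ _ _ _ _ _ (fun z : R * R => phi z.1 z.2) _ (fun w => (f w, g w))) => //.
exact: measurable_fun_pair.
Qed.

Lemma growth_moment (f g : U -> R) :
  measurable_fun [set: U] f -> measurable_fun [set: U] g ->
  (\int[P]_w (f w ^+ 2)%:E <= M%:E)%E -> (\int[P]_w (g w ^+ 2)%:E <= M%:E)%E ->
  (\int[P]_w (phi (f w) (g w) ^+ 2)%:E <= (6 * C ^+ 2 * (1 + M))%:E)%E.
Proof.
move=> mf mg ef eg.
have C2 : 0 <= C ^+ 2 by rewrite sqr_ge0.
have c3 : 0 <= 3 * C ^+ 2 by rewrite mulr_ge0.
apply: (@le_trans _ _ (3 * C ^+ 2 + 3 * C ^+ 2 * M + 3 * C ^+ 2 * M + 0 * M + 0 * M)%:E).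
  apply: (expectation_le_squares mf mg mf mf c3 c3 c3 (lexx 0) (lexx 0) ef eg ef ef).
  by move=> w; rewrite sqr_ge0/= !mul0r !addr0.
by rewrite lee_fin; nra.
Qed.

Lemma lipschitz_moment (f g f' g' : U -> R) :
  measurable_fun [set: U] f -> measurable_fun [set: U] g ->
  measurable_fun [set: U] f' -> measurable_fun [set: U] g' ->
  (\int[P]_w ((f w - f' w) ^+ 2)%:E <= (M * rho ^+ 2)%:E)%E ->
  (\int[P]_w ((g w - g' w) ^+ 2)%:E <= (M * rho ^+ 2)%:E)%E ->
  (\int[P]_w ((phi (f w) (g w) - phi (f' w) (g' w)) ^+ 2)%:E <= (4 * C ^+ 2 * M * rho ^+ 2)%:E)%E.
Proof.
move=> mf mg mf' mg' ef eg.
have c2 : 0 <= 2 * C ^+ 2 by rewrite mulr_ge0// sqr_ge0.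
have md1 : measurable_fun [set: U] (fun w => f w - f' w) by exact: measurable_funB.
have md2 : measurable_fun [set: U] (fun w => g w - g' w) by exact: measurable_funB.
apply: (@le_trans _ _ (0 + 2 * C ^+ 2 * (M * rho ^+ 2) + 2 * C ^+ 2 * (M * rho ^+ 2) + 0 * (M * rho ^+ 2) + 0 * (M * rho ^+ 2))%:E).
  apply: (expectation_le_squares md1 md2 md1 md1 (lexx 0) c2 c2 (lexx 0) (lexx 0) ef eg ef ef).
  by move=> w; rewrite sqr_ge0/= !mul0r !addr0 add0r.
by rewrite lee_fin le_eqVlt; apply/orP; left; apply/eqP; ring.
Qed.

Variables (Xi Xj Xk Zi Zj Zk : U -> R).
Hypotheses (mXi : measurable_fun [set: U] Xi) (mXj : measurable_fun [set: U] Xj)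
  (mXk : measurable_fun [set: U] Xk) (mZi : measurable_fun [set: U] Zi)
  (mZj : measurable_fun [set: U] Zj) (mZk : measurable_fun [set: U] Zk).
Hypothesis centred : forall x, (\int[P]_w (phi x (Xj w))%:E = 0)%E.
Hypotheses (eXi : (\int[P]_w (Xi w ^+ 2)%:E <= M%:E)%E)
  (eXj : (\int[P]_w (Xj w ^+ 2)%:E <= M%:E)%E)
  (eXk : (\int[P]_w (Xk w ^+ 2)%:E <= M%:E)%E)
  (di : (\int[P]_w ((Xi w - Zi w) ^+ 2)%:E <= (M * rho ^+ 2)%:E)%E)
  (dj : (\int[P]_w ((Xj w - Zj w) ^+ 2)%:E <= (M * rho ^+ 2)%:E)%E)
  (dk : (\int[P]_w ((Xk w - Zk w) ^+ 2)%:E <= (M * rho ^+ 2)%:E)%E).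
Hypothesis indep : forall (A : set (R * R)) (B : set R), measurable A -> measurable B ->
  P ((fun w => (Zi w, Zk w)) @^-1` A `&` Zj @^-1` B) =
  (P ((fun w => (Zi w, Zk w)) @^-1` A) * P (Zj @^-1` B))%E.

Let CM := 6 * C ^+ 2 * (1 + M).
Let DM := 4 * C ^+ 2 * M * rho ^+ 2.

Let A w := phi (Xi w) (Xj w).
Let B w := phi (Xi w) (Xk w).
Let A' w := phi (Zi w) (Zj w).
Let B' w := phi (Zi w) (Zk w).

Let mA : measurable_fun [set: U] A. Proof. exact: mphi2. Qed.
Let mB : measurable_fun [set: U] B. Proof. exact: mphi2. Qed.
Let mA' : measurable_fun [set: U] A'. Proof. exact: mphi2. Qed.
Let mB' : measurable_fun [set: U] B'. Proof. exact: mphi2. Qed.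
Let mdA : measurable_fun [set: U] (fun w => A w - A' w).
Proof. exact: measurable_funB. Qed.
Let mdB : measurable_fun [set: U] (fun w => B w - B' w).
Proof. exact: measurable_funB. Qed.
Let eA := growth_moment mXi mXj eXi eXj.
Let eB := growth_moment mXi mXk eXi eXk.
Let eAA' := lipschitz_moment mXi mXj mZi mZj di dj.
Let eBB' := lipschitz_moment mXi mXk mZi mZk di dk.

Let c1 := (2 * rho)^-1 + 2^-1.
Let c2 := rho / 2.

Let c10 : 0 <= c1. Proof. by rewrite addr_ge0// invr_ge0 mulr_ge0// ltW. Qed.
Let c20 : 0 <= c2. Proof. by rewrite divr_ge0// ltW. Qed.

(** A B - A' B' = (A - A') B + (B - B') A - (A - A') (B - B'). In the first two
    products one factor has a mean square of order rho^2 and the other one of order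
    1; the inequality 2 a b <= a^2 / rho + rho b^2 balances them. *)
Lemma product_diff_moment :
  (\int[P]_w (`|A w * B w - A' w * B' w|)%:E <= (14 * C ^+ 2 * (1 + M) * rho)%:E)%E.
Proof.
apply: (@le_trans _ _ (0 + c1 * DM + c1 * DM + c2 * CM + c2 * CM)%:E).
  apply: (expectation_le_squares mdA mdB mA mB (lexx 0) c10 c10 c20 c20 eAA' eBB' eA eB).
  move=> w; rewrite normr_ge0/= add0r.
  have am (a b : R) : `|a * b| <= (2 * rho)^-1 * a ^+ 2 + c2 * b ^+ 2.
    rewrite -subr_ge0 normrM.
    have -> : (2 * rho)^-1 * a ^+ 2 + c2 * b ^+ 2 - `|a| * `|b| = (`|a| - rho * `|b|) ^+ 2 / (2 * rho).
      rewrite -(real_normK (num_real a)) -(real_normK (num_real b)) /c2; field.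
      by rewrite gt_eqF.
    by rewrite divr_ge0 ?sqr_ge0// mulr_ge0// ltW.
  have am1 (a b : R) : `|a * b| <= 2^-1 * a ^+ 2 + 2^-1 * b ^+ 2.
    rewrite normrM -(real_normK (num_real a)) -(real_normK (num_real b)).
    have := sqr_ge0 (`|a| - `|b|); nra.
  have -> : A w * B w - A' w * B' w = (A w - A' w) * B w + (B w - B' w) * A w - (A w - A' w) * (B w - B' w) by ring.
  apply: (le_trans (ler_normB _ _)); apply: (le_trans (lerD (ler_normD _ _) (lexx _))).
  have h1 := am (A w - A' w) (B w); have h2 := am (B w - B' w) (A w).
  have h3 := am1 (A w - A' w) (B w - B' w).
  apply: (le_trans (lerD (lerD h1 h2) h3)); rewrite /c1 !mulrDl.
  by rewrite le_eqVlt; apply/orP; left; apply/eqP; ring.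
rewrite lee_fin /c1 /c2 /DM /CM.
have -> : 0 + ((2 * rho)^-1 + 2^-1) * (4 * C ^+ 2 * M * rho ^+ 2) + ((2 * rho)^-1 + 2^-1) * (4 * C ^+ 2 * M * rho ^+ 2)
  + rho / 2 * (6 * C ^+ 2 * (1 + M)) + rho / 2 * (6 * C ^+ 2 * (1 + M)) =
  C ^+ 2 * rho * (4 * M + 4 * M * rho + 6 * (1 + M)) by field; rewrite gt_eqF.
have -> : 14 * C ^+ 2 * (1 + M) * rho = C ^+ 2 * rho * (14 * (1 + M)) by ring.
rewrite ler_wpM2l//; first by rewrite mulr_ge0 ?sqr_ge0// ltW.
by have : M * rho <= M; [rewrite ler_piMr|nra].
Qed.

Lemma approx_second_moment :
  (\int[P]_w (B' w ^+ 2)%:E <= (20 * C ^+ 2 * (1 + M))%:E)%E.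
Proof.
apply: (@le_trans _ _ (0 + 2 * CM + 2 * DM + 0 * CM + 0 * CM)%:E).
  have t0 : 0 <= 2 :> R by [].
  apply: (expectation_le_squares mB mdB mB mB (lexx 0) t0 t0 (lexx 0) (lexx 0) eB eBB' eB eB).
  move=> w; rewrite sqr_ge0/= add0r !mul0r !addr0.
  by have := sqr_ge0 (2 * B w - B' w); nra.
rewrite lee_fin /CM /DM.
have r2 : rho ^+ 2 <= 1 by rewrite expr_le1// ltW.
have -> : 0 + 2 * (6 * C ^+ 2 * (1 + M)) + 2 * (4 * C ^+ 2 * M * rho ^+ 2) + 0 * (6 * C ^+ 2 * (1 + M)) + 0 * (6 * C ^+ 2 * (1 + M)) =
  C ^+ 2 * (12 * (1 + M) + 8 * M * rho ^+ 2) by ring.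
have -> : 20 * C ^+ 2 * (1 + M) = C ^+ 2 * (20 * (1 + M)) by ring.
rewrite ler_wpM2l ?sqr_ge0//.
have : M * rho ^+ 2 <= M by rewrite ler_piMr.
nra.
Qed.

(** phi x is centred for the law of Xj, and Zj is at distance of order rho. *)
Lemma almost_centred x :
  (`|\int[P]_w (phi x (Zj w))%:E| <= (C * (1 + M) * rho)%:E)%E.
Proof.
have C0 : 0 <= C by rewrite (le_trans _ C1).
have intX : P.-integrable [set: U] (EFin \o (fun w => phi x (Xj w))).
  have mp : measurable_fun [set: U] (fun w => phi x (Xj w)) by apply: mphi2.
  have k0 : 0 <= C * (2 + `|x|) by rewrite mulr_ge0// addr_ge0.
  apply: (integrable_le_real mp (c := C * (2 + `|x|) + C * M + 0 * M + 0 * M + 0 * M)).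
  apply: (expectation_le_squares mXj mXj mXj mXj k0 C0 (lexx 0) (lexx 0) (lexx 0) eXj eXj eXj eXj).
  move=> w; rewrite normr_ge0/= !mul0r !addr0 (le_trans (phi_growth _ _))// -mulrDr ler_wpM2l//.
  rewrite -(real_normK (num_real (Xj w))).
  have := sqr_ge0 (`|Xj w| - 1); have := normr_ge0 (Xj w); nra.
have mD : measurable_fun [set: U] (fun w => phi x (Zj w) - phi x (Xj w)).
  by apply: measurable_funB; apply: mphi2.
have mdj : measurable_fun [set: U] (fun w => Xj w - Zj w) by exact: measurable_funB.
have bD : (\int[P]_w (`|phi x (Zj w) - phi x (Xj w)|)%:E <= (C * (1 + M) * rho)%:E)%E.
  have k0 : 0 <= C * rho / 2 by rewrite divr_ge0// mulr_ge0// ltW.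
  have k1 : 0 <= C / (2 * rho) by rewrite divr_ge0// mulr_ge0// ltW.
  apply: (@le_trans _ _ (C * rho / 2 + C / (2 * rho) * (M * rho ^+ 2) + 0 * (M * rho ^+ 2) + 0 * (M * rho ^+ 2) + 0 * (M * rho ^+ 2))%:E).
    apply: (expectation_le_squares mdj mdj mdj mdj k0 k1 (lexx 0) (lexx 0) (lexx 0) dj dj dj dj).
    move=> w; rewrite normr_ge0/= !mul0r !addr0 (le_trans (phi_lip _ _ _ _))// subrr normr0 add0r distrC.
    rewrite -(real_normK (num_real (Xj w - Zj w))) -subr_ge0.
    have -> : C * rho / 2 + C / (2 * rho) * `|Xj w - Zj w| ^+ 2 - C * `|Xj w - Zj w| =
       C * ((`|Xj w - Zj w| - rho) ^+ 2 / (2 * rho)) by field; rewrite gt_eqF.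
    by rewrite mulr_ge0// divr_ge0 ?sqr_ge0// mulr_ge0// ltW.
  rewrite lee_fin.
  have -> : C * rho / 2 + C / (2 * rho) * (M * rho ^+ 2) + 0 * (M * rho ^+ 2) + 0 * (M * rho ^+ 2) + 0 * (M * rho ^+ 2) =
    C * rho * ((1 + M) / 2) by field; rewrite gt_eqF.
  have -> : C * (1 + M) * rho = C * rho * (1 + M) by ring.
  apply: ler_wpM2l; first by rewrite mulr_ge0// ltW.
  rewrite ler_pdivrMr//; move: M0; lra.
have intD := integrable_le_real mD bD.
have -> : (\int[P]_w (phi x (Zj w))%:E = \int[P]_w (phi x (Zj w) - phi x (Xj w))%:E)%E.
  have := integralD_EFin measurableT intD intX.
  rewrite centred adde0 => <-; apply: eq_integral => w _ /=.
  by rewrite -EFinD subrK.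
apply: le_trans bD; apply: le_abse_integral => //.
exact/measurable_EFinP.
Qed.

(** Replacing the X by the Z costs an error of order rho. Then Zj is independent of
    (Zi, Zk) and can be integrated first, and [almost_centred] makes the factor
    phi(Zi, Zj) of order rho. *)
Lemma covariance_bound :
  P.-integrable [set: U] (EFin \o (fun w => A w * B w)) /\
  (`|\int[P]_w (A w * B w)%:E| <= (40 * C ^+ 3 * (1 + M) ^+ 2 * rho)%:E)%E.
Proof.
have C0 : 0 <= C by rewrite (le_trans _ C1).
have M1 : 1 <= 1 + M by rewrite lerDl.
have mAB : measurable_fun [set: U] (fun w => A w * B w) by exact: measurable_funM.
have mAB' : measurable_fun [set: U] (fun w => A' w * B' w) by exact: measurable_funM.
have h0 : 0 <= 2^-1 :> R by [].
have intAB : P.-integrable [set: U] (EFin \o (fun w => A w * B w)).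
  apply: (integrable_le_real mAB (c := 0 + 2^-1 * CM + 2^-1 * CM + 0 * CM + 0 * CM)).
  apply: (expectation_le_squares mA mB mA mA (lexx 0) h0 h0 (lexx 0) (lexx 0) eA eB eA eA).
  move=> w; rewrite normr_ge0/= !mul0r !addr0 add0r.
  rewrite normrM -(real_normK (num_real (A w))) -(real_normK (num_real (B w))).
  have := sqr_ge0 (`|A w| - `|B w|); nra.
split => //.
have mD : measurable_fun [set: U] (fun w => A w * B w - A' w * B' w) by exact: measurable_funB.
have intD := integrable_le_real mD product_diff_moment.
have intAB' : P.-integrable [set: U] (EFin \o (fun w => A' w * B' w)).
  apply: (eq_integrable measurableT (fun w => (A w * B w)%:E - (A w * B w - A' w * B' w)%:E)%E).
    by move=> w _ /=; rewrite -EFinB opprB addrCA subrr addr0.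
  exact: integrableB.
have -> : (\int[P]_w (A w * B w)%:E = \int[P]_w (A w * B w - A' w * B' w)%:E + \int[P]_w (A' w * B' w)%:E)%E.
  rewrite -(integralD_EFin measurableT intD intAB'); apply: eq_integral => w _ /=.
  by rewrite -EFinD subrK.
apply: (le_trans (lee_abs_add _ _)).
have b1 : (`|\int[P]_w (A w * B w - A' w * B' w)%:E| <= (14 * C ^+ 2 * (1 + M) * rho)%:E)%E.
  apply: le_trans product_diff_moment; apply: le_abse_integral => //.
  exact/measurable_EFinP.
have b2 : (`|\int[P]_w (A' w * B' w)%:E| <= (20 * C ^+ 3 * (1 + M) ^+ 2 * rho)%:E)%E.
  have mV1 : measurable_fun [set: U] (fun w => (Zi w, Zk w)) by exact: measurable_fun_pair.
  have mh : measurable_fun [set: (R * R) * R] (fun z : (R * R) * R => phi z.1.1 z.2 * phi z.1.1 z.1.2).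
    apply: measurable_funM.
      apply: (@measurableT_comp _ _ _ _ _ _ (fun z : R * R => phi z.1 z.2) _ (fun z : (R * R) * R => (z.1.1, z.2))) => //.
      by apply: measurable_fun_pair => //; exact: measurableT_comp.
    apply: (@measurableT_comp _ _ _ _ _ _ (fun z : R * R => phi z.1 z.2) _ (fun z : (R * R) * R => (z.1.1, z.1.2))) => //.
    by apply: measurable_fun_pair; exact: measurableT_comp.
  have intp x : P.-integrable [set: U] (EFin \o (fun w => phi x (Zj w))).
    have mp : measurable_fun [set: U] (fun w => phi x (Zj w)) by apply: mphi2.
    have mdj : measurable_fun [set: U] (fun w => Xj w - Zj w) by exact: measurable_funB.
    have k0 : 0 <= C * (3 + `|x|) by rewrite mulr_ge0// addr_ge0.
    apply: (integrable_le_real mp (c := C * (3 + `|x|) + C * M + C * (M * rho ^+ 2) + 0 * M + 0 * M)).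
    apply: (expectation_le_squares mXj mdj mXj mXj k0 C0 C0 (lexx 0) (lexx 0) eXj dj eXj eXj).
    move=> w; rewrite normr_ge0/= !mul0r !addr0 (le_trans (phi_growth _ _))// -!mulrDr ler_wpM2l//.
    have : `|Zj w| <= `|Xj w| + `|Xj w - Zj w|.
      by rewrite -[X in `|X| <= _](subKr (Xj w)); exact: ler_normB.
    rewrite -(real_normK (num_real (Xj w))) -(real_normK (num_real (Xj w - Zj w))).
    have := sqr_ge0 (`|Xj w| - 1); have := sqr_ge0 (`|Xj w - Zj w| - 1).
    have := normr_ge0 (Xj w); have := normr_ge0 (Xj w - Zj w); nra.
  have := @independent_abse_integral_le _ _ _ U _ _ R P (fun w => (Zi w, Zk w)) Zj
    (fun z : (R * R) * R => phi z.1.1 z.2 * phi z.1.1 z.1.2) mV1 mZj indep mh intAB'.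
  have intx (x : R * R) : P.-integrable [set: U] (fun w => (phi x.1 (Zj w) * phi x.1 x.2)%:E).
    have := integrableZr measurableT (phi x.1 x.2) (intp x.1).
    by apply: eq_integrable => // w _; rewrite /= EFinM.
  move=> /(_ intx) /=.
  move=> /le_trans; apply.
  have k1 : 0 <= C * (1 + M) * rho by rewrite !mulr_ge0// ?addr_ge0// ltW.
  have k2 : 0 <= C * (1 + M) * rho / 2 by rewrite divr_ge0.
  apply: (@le_trans _ _ (\int[P]_w (C * (1 + M) * rho * `|B' w|)%:E)%E).
    apply: ge0_le_integral_lower => w; first exact: abse_ge0.
    under eq_integral do rewrite EFinM.
    rewrite (integralZr measurableT (intp (Zi w))) abseM EFinM.
    by apply: lee_wpmul2r => //; exact: almost_centred.
  have e2 := approx_second_moment.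
  set K := 20 * C ^+ 2 * (1 + M) in e2.
  apply: (@le_trans _ _ (C * (1 + M) * rho / 2 + C * (1 + M) * rho / 2 * K + 0 * K + 0 * K + 0 * K)%:E).
    apply: (expectation_le_squares mB' mB' mB' mB' k2 k2 (lexx 0) (lexx 0) (lexx 0) e2 e2 e2 e2).
    move=> w; rewrite mulr_ge0//= !mul0r !addr0.
    have -> : C * (1 + M) * rho / 2 + C * (1 + M) * rho / 2 * B' w ^+ 2 = C * (1 + M) * rho * ((1 + B' w ^+ 2) / 2) by field.
    rewrite ler_wpM2l// -(real_normK (num_real (B' w))).
    have := sqr_ge0 (`|B' w| - 1); nra.
  rewrite lee_fin /K.
  have -> : C * (1 + M) * rho / 2 + C * (1 + M) * rho / 2 * (20 * C ^+ 2 * (1 + M)) + 0 * (20 * C ^+ 2 * (1 + M)) + 0 * (20 * C ^+ 2 * (1 + M)) + 0 * (20 * C ^+ 2 * (1 + M)) =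
    C * (1 + M) * rho * (2^-1 + 10 * (C ^+ 2 * (1 + M))) by field.
  have -> : 20 * C ^+ 3 * (1 + M) ^+ 2 * rho = C * (1 + M) * rho * (20 * (C ^+ 2 * (1 + M))) by ring.
  rewrite ler_wpM2l//.
  have : 1 <= C ^+ 2 * (1 + M) by rewrite -[leLHS]mulr1 ler_pM// expr_ge1.
  lra.
apply: (le_trans (leeD b1 b2)); rewrite -EFinD lee_fin.
have -> : 14 * C ^+ 2 * (1 + M) * rho + 20 * C ^+ 3 * (1 + M) ^+ 2 * rho =
  C ^+ 2 * (1 + M) * rho * (14 + 20 * (C * (1 + M))) by ring.
have -> : 40 * C ^+ 3 * (1 + M) ^+ 2 * rho = C ^+ 2 * (1 + M) * rho * (40 * (C * (1 + M))) by ring.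
rewrite ler_wpM2l//; first by rewrite !mulr_ge0// ?sqr_ge0// ?addr_ge0// ltW.
have : 1 <= C * (1 + M) by rewrite -[leLHS]mulr1 ler_pM.
lra.
Qed.

End covariance.
End squares.

Section geometric_sums.
Variable R : realType.
Notation half := (2^-1 : R).

Definition index_dist (i j : nat) := ((i - j) + (j - i))%N.

Lemma sum_half_expr n : \sum_(0 <= j < n) half ^+ j <= 2.
Proof.
suff -> : \sum_(0 <= j < n) half ^+ j = 2 - 2 * half ^+ n.
  by rewrite gerBl mulr_ge0// exprn_ge0.
elim: n => [|n IH]; first by rewrite big_nil expr0; lra.
by rewrite big_nat_recr//= IH exprS; lra.
Qed.

Lemma sum_half_to n : \sum_(1 <= j < n.+1) half ^+ (n - j) <= 2.
Proof.
elim: n => [|n IH]; first by rewrite big_geq.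
rewrite big_nat_recr//= subnn expr0.
have -> : \sum_(1 <= j < n.+1) half ^+ (n.+1 - j) = half * \sum_(1 <= j < n.+1) half ^+ (n - j).
  rewrite mulr_sumr; apply: eq_big_nat => j /andP[_]; rewrite ltnS => jn.
  by rewrite -exprS subSn.
lra.
Qed.

Lemma sum_half_dist i n : (1 <= i <= n)%N -> \sum_(1 <= j < n.+1) half ^+ (index_dist i j) <= 4.
Proof.
move=> /andP[i1 in_].
rewrite (@big_cat_nat _ _ _ i.+1)//=.
have h1 : \sum_(1 <= j < i.+1) half ^+ index_dist i j <= 2.
  apply: le_trans (sum_half_to i); rewrite le_eqVlt; apply/orP; left; apply/eqP.
  apply: eq_big_nat => j /andP[_]; rewrite ltnS => ji.
  by rewrite /index_dist (_ : (j - i = 0)%N) ?addn0//; apply/eqP; rewrite subn_eq0.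
have h2 : \sum_(i.+1 <= j < n.+1) half ^+ index_dist i j <= 2.
  rewrite -[in X in X <= _](add0n i.+1) big_addn.
  apply: le_trans (sum_half_expr (n.+1 - i.+1)).
  apply: ler_sum_nat => j _.
  have -> : index_dist i (j + i.+1) = j.+1 by rewrite /index_dist; lia.
  by rewrite exprS ler_piMl ?exprn_ge0//; lra.
lra.
Qed.

(** Each geometric series is bounded whatever its centre, so one of the three sums
    brings no factor n. The powers of n - i, n - j, n - k account for the indices
    that are too close to the end of the chain. *)
Lemma triple_half_sum n :
  \sum_(1 <= i < n.+1) \sum_(1 <= j < n.+1) \sum_(1 <= k < n.+1)
   (half ^+ index_dist i j + half ^+ index_dist j k + half ^+ (n - i) + half ^+ (n - j) + half ^+ (n - k))
  <= 14 * n%:R ^+ 2.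
Proof.
have cst (c : R) : \sum_(1 <= i < n.+1) c = n%:R * c.
  by rewrite big_const_nat subn1/= iter_addr addr0 mulr_natl.
have inner i j : (1 <= i <= n)%N -> (1 <= j <= n)%N ->
  \sum_(1 <= k < n.+1) (half ^+ index_dist i j + half ^+ index_dist j k + half ^+ (n - i) + half ^+ (n - j) + half ^+ (n - k))
   <= n%:R * half ^+ index_dist i j + 4 + n%:R * half ^+ (n - i) + n%:R * half ^+ (n - j) + 2.
  move=> i_in j_in; rewrite !big_split/= !cst.
  have := sum_half_to n; have := sum_half_dist j_in; lra.
have mid i : (1 <= i <= n)%N ->
  \sum_(1 <= j < n.+1) (n%:R * half ^+ index_dist i j + 4 + n%:R * half ^+ (n - i) + n%:R * half ^+ (n - j) + 2)
   <= n%:R * 4 + n%:R * 4 + n%:R * (n%:R * half ^+ (n - i)) + n%:R * 2 + n%:R * 2.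
  move=> i_in; rewrite !big_split/= !cst -!mulr_sumr.
  have h1 := ler_wpM2l (ler0n R n) (sum_half_to n).
  have h2 := ler_wpM2l (ler0n R n) (sum_half_dist i_in); lra.
apply: (@le_trans _ _ (\sum_(1 <= i < n.+1) (n%:R * 4 + n%:R * 4 + n%:R * (n%:R * half ^+ (n - i)) + n%:R * 2 + n%:R * 2))).
  apply: ler_sum_nat => i; rewrite ltnS => i_in.
  apply: (le_trans _ (mid i i_in)).
  by apply: ler_sum_nat => j; rewrite ltnS => j_in; exact: inner.
rewrite !big_split/= !cst -!mulr_sumr.
have h1 := ler_wpM2l (sqr_ge0 (n%:R : R)) (sum_half_to n).
have -> : n%:R * (n%:R * \sum_(1 <= i < n.+1) half ^+ (n - i)) = n%:R ^+ 2 * \sum_(1 <= i < n.+1) half ^+ (n - i) by ring.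
lra.
Qed.

End geometric_sums.

Section decorrelated_means.
Context d (U : measurableType d) (R : realType) (P : probability U R).
Variables (C M : R) (phi : R -> R -> R) (n : nat) (X : nat -> U -> R) (Z : nat -> nat -> U -> R).
Hypotheses (C1 : 1 <= C) (M0 : 0 <= M).
Hypothesis mphi : measurable_fun [set: R * R] (fun z : R * R => phi z.1 z.2).
Hypothesis phi_lip : forall x y x' y',
  `|phi x y - phi x' y'| <= C * (`|x - x'| + `|y - y'|).
Hypothesis phi_growth : forall x y, `|phi x y| <= C * (1 + `|x| + `|y|).
Hypothesis mX : forall i, (1 <= i <= n)%N -> measurable_fun [set: U] (X i).
Hypothesis mZ : forall K i, measurable_fun [set: U] (Z K i).
Hypothesis centred : forall i x, (1 <= i <= n)%N -> (\int[P]_w (phi x (X i w))%:E = 0)%E.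
Hypothesis eX : forall i, (1 <= i <= n)%N -> (\int[P]_w (X i w ^+ 2)%:E <= M%:E)%E.
Hypothesis approx : forall K i, (1 <= i <= n)%N -> (i + K <= n.+1)%N ->
  (\int[P]_w ((X i w - Z K i w) ^+ 2)%:E <= (M * (2^-1 ^+ K) ^+ 2)%:E)%E.
Hypothesis indep : forall K i j k,
  (1 <= i)%N -> (1 <= j)%N -> (1 <= k)%N ->
  (i + K <= n.+1)%N -> (j + K <= n.+1)%N -> (k + K <= n.+1)%N ->
  (K <= index_dist i j)%N -> (K <= index_dist j k)%N ->
  forall (A : set (R * R)) (B : set R), measurable A -> measurable B ->
  P ((fun w => (Z K i w, Z K k w)) @^-1` A `&` Z K j @^-1` B) =
  (P ((fun w => (Z K i w, Z K k w)) @^-1` A) * P (Z K j @^-1` B))%E.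

Let kappa := 40 * C ^+ 3 * (1 + M) ^+ 2.
Let kappa0 : 0 <= kappa.
Proof. by rewrite /kappa mulr_ge0 ?sqr_ge0// mulr_ge0// exprn_ge0// (le_trans _ C1). Qed.

Let decay i j k : R := 2^-1 ^+ index_dist i j + 2^-1 ^+ index_dist j k +
   2^-1 ^+ (n - i) + 2^-1 ^+ (n - j) + 2^-1 ^+ (n - k).

Let cov i j k : (1 <= i <= n)%N -> (1 <= j <= n)%N -> (1 <= k <= n)%N ->
  P.-integrable [set: U] (EFin \o (fun w => phi (X i w) (X j w) * phi (X i w) (X k w))) /\
  (\int[P]_w (phi (X i w) (X j w) * phi (X i w) (X k w))%:E <= (kappa * decay i j k)%:E)%E.
Proof.
move=> i_in j_in k_in.
pose K := minn (minn (minn (index_dist i j) (index_dist j k)) (minn (n - i) (n - j))) (n - k).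
have [Ki Kj Kk] : [/\ (i + K <= n.+1)%N, (j + K <= n.+1)%N & (k + K <= n.+1)%N].
  by rewrite /K; split; lia.
have [Kij Kjk] : (K <= index_dist i j)%N /\ (K <= index_dist j k)%N by rewrite /K; split; lia.
have h0 : 0 < 2^-1 ^+ K :> R by rewrite exprn_gt0.
have h1 : 2^-1 ^+ K <= 1 :> R by rewrite exprn_ile1// invf_le1// ler1n.
have [i1 in_] := andP i_in; have [j1 jn] := andP j_in; have [k1 kn] := andP k_in.
have [intP bd] := covariance_bound C1 M0 h0 h1 mphi phi_lip phi_growth
  (mX i_in) (mX j_in) (mX k_in) (mZ K i) (mZ K j) (mZ K k)
  (fun x => centred x j_in) (eX i_in) (eX j_in) (eX k_in)
  (approx i_in Ki) (approx j_in Kj) (approx k_in Kk)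
  (indep i1 j1 k1 Ki Kj Kk Kij Kjk).
split => //; apply: (le_trans (lee_abs _)); apply: (le_trans bd).
rewrite lee_fin -/kappa ler_wpM2l// /decay.
have p (m : nat) : 0 <= 2^-1 ^+ m :> R by rewrite exprn_ge0.
have : K \in [:: index_dist i j; index_dist j k; (n - i)%N; (n - j)%N; (n - k)%N].
  by rewrite !inE /K; lia.
have := (p (index_dist i j), p (index_dist j k), p (n - i)%N, p (n - j)%N, p (n - k)%N).
move=> [[[[p1 p2] p3] p4] p5].
clearbody K.
by rewrite !inE => /or4P[/eqP->|/eqP->|/eqP->|/orP[/eqP->|/eqP->]]; lra.
Qed.

(** For fixed i, j, k, [covariance_bound] is used with the largest K for which the
    approximations of depth K exist at i, j, k and the block of j avoids the two
    others. Expanding the squares, the sum over i of the mean squares of the inner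
    sums is then of order n^2, by [triple_half_sum]. With s = sqrt n, the inequality
    2 |S| / n <= 1 / s + s S^2 / n^2 turns this into a bound of order sqrt n. *)
Lemma decorrelated_means :
  (\sum_(1 <= i < n.+1) \int[P]_w (`|n%:R^-1 * \sum_(1 <= j < n.+1) phi (X i w) (X j w)|)%:E
   <= ((7 * kappa + 1) * Num.sqrt n%:R)%:E)%E.
Proof.
have [->|n0] := posnP n; first by rewrite big_geq// sqrtr0 mulr0.
have s0 : 0 < Num.sqrt n%:R :> R by rewrite sqrtr_gt0 ltr0n.
have s2 : Num.sqrt n%:R ^+ 2 = n%:R :> R by rewrite sqr_sqrtr.
have n0R : 0 < n%:R :> R by rewrite ltr0n.
set s := Num.sqrt n%:R in s0 s2 *.
pose S i w := \sum_(1 <= j < n.+1) phi (X i w) (X j w).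
have mphi2 i j : (1 <= i <= n)%N -> (1 <= j <= n)%N ->
    measurable_fun [set: U] (fun w => phi (X i w) (X j w)).
  move=> i_in j_in.
  apply: (@measurableT_comp _ _ _ _ _ _ (fun z : R * R => phi z.1 z.2) _ (fun w => (X i w, X j w))) => //.
  by apply: measurable_fun_pair; exact: mX.
have mS i : (1 <= i <= n)%N -> measurable_fun [set: U] (S i).
  by move=> i_in; apply: measurable_sum_range => j; exact: mphi2.
have eS i : (1 <= i <= n)%N -> (\int[P]_w (S i w ^+ 2)%:E <=
    (\sum_(1 <= j < n.+1) \sum_(1 <= k < n.+1) kappa * decay i j k)%:E)%E.
  move=> i_in.
  pose F j k w := if (1 <= j <= n)%N && (1 <= k <= n)%N then (phi (X i w) (X j w) * phi (X i w) (X k w))%:E else 0%E.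
  have -> : (\int[P]_w (S i w ^+ 2)%:E = \int[P]_w (\sum_(j <- index_iota 1 n.+1) \sum_(k <- index_iota 1 n.+1) F j k w))%E.
    apply: eq_integral => w _; rewrite expr2 /S big_distrlr/= -sumEFin.
    apply: eq_big_nat => j; rewrite ltnS => j_in; rewrite -sumEFin.
    by apply: eq_big_nat => k; rewrite ltnS => k_in; rewrite /F j_in k_in.
  have intF j k : P.-integrable [set: U] (F j k).
    rewrite /F; case: (boolP (1 <= j <= n)%N) => j_in; last exact: integrable0.
    case: (boolP (1 <= k <= n)%N) => k_in; last exact: integrable0.
    by have [] := cov i_in j_in k_in.
  rewrite integral_sum//; last by move=> j; apply: integrable_sum => // k _; exact: intF.
  rewrite -sumEFin big_nat [leRHS]big_nat; apply: lee_sum => j; rewrite ltnS => j_in.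
  rewrite integral_sum// -sumEFin big_nat [leRHS]big_nat; apply: lee_sum => k; rewrite ltnS => k_in.
  have [_] := cov i_in j_in k_in; apply: le_trans.
  by rewrite le_eqVlt; apply/orP; left; apply/eqP; apply: eq_integral => w _; rewrite /F j_in k_in.
apply: (@le_trans _ _ (\sum_(1 <= i < n.+1) ((2 * s)^-1 + s / 2 / n%:R ^+ 2 *
    (\sum_(1 <= j < n.+1) \sum_(1 <= k < n.+1) kappa * decay i j k))%:E)%E).
  rewrite big_nat [leRHS]big_nat; apply: lee_sum => i; rewrite ltnS => i_in.
  set Vi := \sum_(1 <= j < n.+1) \sum_(1 <= k < n.+1) kappa * decay i j k.
  have k0 : 0 <= (2 * s)^-1 by rewrite invr_ge0 mulr_ge0// ltW.
  have k1 : 0 <= s / 2 / n%:R ^+ 2 by rewrite !divr_ge0// ?sqr_ge0// ltW.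
  apply: (@le_trans _ _ ((2 * s)^-1 + s / 2 / n%:R ^+ 2 * Vi + 0 * Vi + 0 * Vi + 0 * Vi)%:E); last first.
    by rewrite !mul0r !addr0.
  have mSi := mS _ i_in; have eSi := eS _ i_in.
  apply: (expectation_le_squares mSi mSi mSi mSi k0 k1 (lexx 0) (lexx 0) (lexx 0) eSi eSi eSi eSi).
  move=> w; rewrite normr_ge0/= !mul0r !addr0 -/(S i w).
  rewrite normrM (ger0_norm (x := n%:R^-1)) ?invr_ge0 ?ler0n// -(real_normK (num_real (S i w))) -subr_ge0.
  have -> : (2 * s)^-1 + s / 2 / n%:R ^+ 2 * `|S i w| ^+ 2 - n%:R^-1 * `|S i w| =
    (1 - s / n%:R * `|S i w|) ^+ 2 / (2 * s) by field; rewrite !gt_eqF.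
  by rewrite divr_ge0 ?sqr_ge0// mulr_ge0// ltW.
rewrite sumEFin lee_fin big_split/= -mulr_sumr.
rewrite big_const_nat subn1/= iter_addr addr0.
have tri : \sum_(1 <= i < n.+1) \sum_(1 <= j < n.+1) \sum_(1 <= k < n.+1) kappa * decay i j k <= kappa * (14 * n%:R ^+ 2).
  have -> : \sum_(1 <= i < n.+1) \sum_(1 <= j < n.+1) \sum_(1 <= k < n.+1) kappa * decay i j k =
     kappa * \sum_(1 <= i < n.+1) \sum_(1 <= j < n.+1) \sum_(1 <= k < n.+1) decay i j k.
    rewrite mulr_sumr; apply: eq_bigr => i _; rewrite mulr_sumr; apply: eq_bigr => j _.
    by rewrite mulr_sumr.
  by rewrite ler_wpM2l//; exact: triple_half_sum.
have k1 : 0 <= s / 2 / n%:R ^+ 2 by rewrite !divr_ge0// ?sqr_ge0// ltW.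
apply: (le_trans (lerD (lexx _) (ler_wpM2l k1 tri))).
rewrite -[X in X + _]mulr_natr -s2.
have -> : (2 * s)^-1 * s ^+ 2 + s / 2 / (s ^+ 2) ^+ 2 * (kappa * (14 * (s ^+ 2) ^+ 2)) = (7 * kappa + 2^-1) * s.
  by field; rewrite gt_eqF.
by rewrite ler_wpM2r// ?ltW//; lra.
Qed.

End decorrelated_means.

(** * Picard iterates of a chain of equations *)

Section picard.
Context d (U : measurableType d) (R : realType).
Local Notation leb := (@lebesgue_measure R).
Variables (g : R -> R -> R -> R).

(** The iterate of depth K at i uses the drivers of i, ..., i+K-1 only. *)
Fixpoint picard (xi : nat -> U -> R) (W : nat -> R -> U -> R) (K i : nat) : R -> U -> R :=
  if K is K'.+1 then fun t w =>
    xi i w + \int[leb]_(s in `[0, t]) g s (picard xi W K' i s w) (picard xi W K' i.+1 s w) + W i t w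
  else fun _ _ => 0.

End picard.

Section picard_measurable.
Context d (U : measurableType d) (R : realType).
Variables (g : R -> R -> R -> R) (xi : nat -> U -> R) (W : nat -> R -> U -> R).
Hypothesis mg : measurable_fun [set: R * R * R] (fun z : R * R * R => g z.1.1 z.1.2 z.2).

Lemma measurable_drift_comp (x y : R -> U -> R) :
  measurable_fun [set: R * U] (fun z : R * U => x z.1 z.2) ->
  measurable_fun [set: R * U] (fun z : R * U => y z.1 z.2) ->
  measurable_fun [set: R * U] (fun z : R * U => g z.1 (x z.1 z.2) (y z.1 z.2)).
Proof.
move=> mx my.
apply: (@measurableT_comp _ _ _ _ _ _ (fun z : R * R * R => g z.1.1 z.1.2 z.2) _
  (fun z : R * U => (z.1, x z.1 z.2, y z.1 z.2))) => //.
by apply: measurable_fun_pair => //; exact: measurable_fun_pair.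
Qed.

Lemma measurable_picard K i :
  (forall l, (i <= l < i + K)%N -> measurable_fun [set: U] (xi l)) ->
  (forall l, (i <= l < i + K)%N -> measurable_fun [set: R * U] (fun z : R * U => W l z.1 z.2)) ->
  measurable_fun [set: R * U] (fun z : R * U => picard g xi W K i z.1 z.2).
Proof.
elim: K i => [|K IH] i mxi mW /=; first exact: measurable_cst.
have i_in : (i <= i < i + K.+1)%N by lia.
have mZ0 := IH i (fun l l_in => mxi l ltac:(lia)) (fun l l_in => mW l ltac:(lia)).
have mZ1 := IH i.+1 (fun l l_in => mxi l ltac:(lia)) (fun l l_in => mW l ltac:(lia)).
apply: measurable_funD; last exact: mW.
apply: measurable_funD; first by apply: (measurableT_comp (mxi i i_in)).
exact: (measurable_time_Rintegral2 (measurable_drift_comp mZ0 mZ1)).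
Qed.

End picard_measurable.

Section picard_error.
Context d (U : measurableType d) (R : realType) (P : probability U R).
Local Notation leb := (@lebesgue_measure R).
Variables (g : R -> R -> R -> R) (C T M : R) (n : nat).
Variables (xi : nat -> U -> R) (W : nat -> R -> U -> R) (x : nat -> R -> U -> R).
Hypothesis mg : measurable_fun [set: R * R * R] (fun z : R * R * R => g z.1.1 z.1.2 z.2).
Hypotheses (C0 : 0 <= C) (T0 : 0 < T) (M0 : 0 <= M).
Hypothesis g_lip : forall t x1 x2 y1 y2, 0 <= t <= T ->
  `|g t x1 y1 - g t x2 y2| <= C * (`|x1 - x2| + `|y1 - y2|).
Hypothesis mxi : forall l, measurable_fun [set: U] (xi l).
Hypothesis mW : forall l, measurable_fun [set: R * U] (fun z : R * U => W l z.1 z.2).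
Hypothesis mx : forall i, (1 <= i <= n.+1)%N -> measurable_fun [set: R * U] (fun z : R * U => x i z.1 z.2).
Hypothesis moment : forall i t, (1 <= i <= n.+1)%N -> 0 <= t <= T ->
  (\int[P]_w (x i t w ^+ 2)%:E <= M%:E)%E.
Hypothesis sde : forall i, (1 <= i <= n)%N -> {ae P, forall w, forall t, 0 <= t <= T ->
  leb.-integrable `[0, t] (EFin \o (fun s => g s (x i s w) (x i.+1 s w))) /\
  x i t w = xi i w + \int[leb]_(s in `[0, t]) g s (x i s w) (x i.+1 s w) + W i t w}.

Let Z := picard g xi W.
Let l := 16 * T * C ^+ 2 + 1.

Let l0 : 0 < l.
Proof. by rewrite ltr_wpDl// !mulr_ge0// ?sqr_ge0// ltW. Qed.

Let mZ K i : measurable_fun [set: R * U] (fun z : R * U => Z K i z.1 z.2).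
Proof. by apply: measurable_picard. Qed.

Let picard_sqr_step K i t w : (1 <= i <= n)%N -> 0 <= t <= T ->
  leb.-integrable `[0, t] (EFin \o (fun s => g s (x i s w) (x i.+1 s w))) ->
  x i t w = xi i w + \int[leb]_(s in `[0, t]) g s (x i s w) (x i.+1 s w) + W i t w ->
  (((x i t w - Z K.+1 i t w) ^+ 2)%:E <= \int[leb]_(s in `[0%R, t])
    ((2 * T * C ^+ 2)%:E * (((x i s w - Z K i s w) ^+ 2)%:E + ((x i.+1 s w - Z K i.+1 s w) ^+ 2)%:E)))%E.
Proof.
move=> i_in t_in intg eqx; have [t0 tT] := andP t_in.
have i1_in : (1 <= i.+1 <= n.+1)%N by lia.
have i2_in : (1 <= i <= n.+1)%N by lia.
have mxw j : (1 <= j <= n.+1)%N -> measurable_fun [set: R] (fun s => x j s w).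
  by move=> j_in; exact: (measurable_fun_pair1 w (mx j_in)).
have mZw j : measurable_fun [set: R] (fun s => Z K j s w).
  exact: (measurable_fun_pair1 w (mZ K j)).
have mgZ : measurable_fun [set: R] (fun s => g s (Z K i s w) (Z K i.+1 s w)).
  exact: (measurable_fun_pair1 w (measurable_drift_comp mg (mZ K i) (mZ K i.+1))).
have mf : measurable_fun [set: R] (fun s => C * (`|x i s w - Z K i s w| + `|x i.+1 s w - Z K i.+1 s w|)).
  apply: measurable_funM => //; apply: measurable_funD.
    by apply: measurableT_comp => //; apply: measurable_funB; [exact: mxw|exact: mZw].
  by apply: measurableT_comp => //; apply: measurable_funB; [exact: mxw|exact: mZw].
have f0 s : 0 <= C * (`|x i s w - Z K i s w| + `|x i.+1 s w - Z K i.+1 s w|).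
  by rewrite mulr_ge0// addr_ge0.
have le1 : ((`|x i t w - Z K.+1 i t w|)%:E <= \int[leb]_(s in `[0%R, t])
    (C * (`|x i s w - Z K i s w| + `|x i.+1 s w - Z K i.+1 s w|))%:E)%E.
  have -> : x i t w - Z K.+1 i t w = \int[leb]_(s in `[0, t]) g s (x i s w) (x i.+1 s w) -
     \int[leb]_(s in `[0, t]) g s (Z K i s w) (Z K i.+1 s w).
    by rewrite eqx /Z/=; ring.
  have mD : measurable (`[0, t]%classic : set R) by exact: measurable_itv.
  apply: (le_trans (leb_dist_Rintegral_le mD intg (measurable_funS measurableT (@subsetT _ _) mgZ))).
  apply: leb_le_integral => s; first by rewrite lee_fin.
  rewrite /= in_itv/= => /andP[s0 st]; rewrite lee_fin; apply: g_lip.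
  by rewrite s0 (le_trans st).
have := leb_sqr_le_integral t0 mf f0 (normr_ge0 _) le1.
rewrite real_normK ?num_real// => /le_trans; apply.
have m2 : measurable_fun [set: R] (fun s => ((C * (`|x i s w - Z K i s w| + `|x i.+1 s w - Z K i.+1 s w|)) ^+ 2)%:E).
  by apply/measurable_EFinP; exact: measurable_funX.
have mD : measurable (`[0, t]%classic : set R) by exact: measurable_itv.
rewrite -(leb_integralZl mD (measurable_funS measurableT (@subsetT _ _) m2) _ t0); last first.
  by move=> s _; rewrite lee_fin sqr_ge0.
apply: leb_le_integral => s _.
  by rewrite mule_ge0 ?lee_fin ?sqr_ge0.
rewrite -EFinD -!EFinM lee_fin exprMn.
have -> : 2 * T * C ^+ 2 * ((x i s w - Z K i s w) ^+ 2 + (x i.+1 s w - Z K i.+1 s w) ^+ 2) =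
  T * (C ^+ 2 * (2 * ((x i s w - Z K i s w) ^+ 2 + (x i.+1 s w - Z K i.+1 s w) ^+ 2))) by ring.
apply: ler_pM => //; first by rewrite mulr_ge0 ?sqr_ge0.
rewrite ler_wpM2l ?sqr_ge0//.
rewrite -(real_normK (num_real (x i s w - Z K i s w))) -(real_normK (num_real (x i.+1 s w - Z K i.+1 s w))).
by have := sqr_ge0 (`|x i s w - Z K i s w| - `|x i.+1 s w - Z K i.+1 s w|); nra.
Qed.

(* Measured against exp(l t), the error is divided by 4 in mean square by each
   iteration. The induction is on K for all i at once, as the iterate of depth K+1
   at i refers to those of depth K at i and i+1. *)
Let picard_error_weighted K i t : (1 <= i)%N -> (i + K <= n.+1)%N -> 0 <= t <= T ->
  (\int[P]_w ((x i t w - Z K i t w) ^+ 2)%:E <= (M * (2^-1 ^+ K) ^+ 2 * expR (l * t))%:E)%E.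
Proof.
elim: K i t => [|K IH] i t i1 iK t_in.
  rewrite /Z/=; under eq_integral do rewrite subr0.
  rewrite expr0 expr1n mulr1; apply: (le_trans (moment _ t_in)); first lia.
  rewrite lee_fin ler_peMr// -expR0 ler_expR mulr_ge0 ?(ltW l0)//.
  by have [] := andP t_in.
have i_in : (1 <= i <= n)%N by lia.
have i1_in : (1 <= i.+1 <= n.+1)%N by lia.
have i2_in : (1 <= i <= n.+1)%N by lia.
have [t0 tT] := andP t_in.
pose f (z : R * U) := ((2 * T * C ^+ 2)%:E * (((x i z.1 z.2 - Z K i z.1 z.2) ^+ 2)%:E +
  ((x i.+1 z.1 z.2 - Z K i.+1 z.1 z.2) ^+ 2)%:E))%E.
have mdx j : (1 <= j <= n.+1)%N -> measurable_fun [set: R * U] (fun z : R * U => ((x j z.1 z.2 - Z K j z.1 z.2) ^+ 2)%:E).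
  move=> j_in; apply/measurable_EFinP; apply: measurable_funX.
  by apply: measurable_funB; [exact: mx|exact: mZ].
have mf : measurable_fun [set: R * U] f.
  apply: emeasurable_funM; first exact: measurable_cst.
  by apply: emeasurable_funD; exact: mdx.
have k0 : 0 <= 2 * T * C ^+ 2 by rewrite !mulr_ge0 ?sqr_ge0// ltW.
have s0 (j : nat) s w : (0 <= ((x j s w - Z K j s w) ^+ 2)%:E)%E by rewrite lee_fin sqr_ge0.
have f0 z : (0 <= f z)%E by apply: mule_ge0; [rewrite lee_fin|exact: adde_ge0].
apply: (@le_trans _ _ (\int[P]_w \int[leb]_(s in `[0%R, t]) f (s, w))%E).
  apply: ae_ge0_le_integral_lower.
  - by move=> w; rewrite lee_fin sqr_ge0.
  - by move=> w; apply: integral_ge0 => s _; exact: f0.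
  - exact: (measurable_time_integral t mf f0).
  - apply: filterS (sde i_in) => w /(_ t t_in) [intg eqx].
    exact: picard_sqr_step.
rewrite (tonelli_time P t mf f0).
have K1 : (i + K <= n.+1)%N by lia.
have K2 : (i.+1 + K <= n.+1)%N by lia.
set A := M * (2^-1 ^+ K) ^+ 2.
have A0 : 0 <= A by rewrite mulr_ge0// sqr_ge0.
apply: (@le_trans _ _ (\int[leb]_(s in `[0%R, t]) ((2 * T * C ^+ 2 * (2 * A))%:E * (expR (l * s))%:E))%E).
  apply: leb_le_integral => s.
    by move=> _; apply: integral_ge0 => w _; exact: f0.
  rewrite /= in_itv/= => /andP[ss0 st].
  have s_in : 0 <= s <= T by rewrite ss0 (le_trans st).
  rewrite /f/=.
  have mdxw j : (1 <= j <= n.+1)%N -> measurable_fun [set: U] (fun w => ((x j s w - Z K j s w) ^+ 2)%:E).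
    by move=> j_in; exact: (measurable_fun_pair2 s (mdx _ j_in)).
  rewrite (ge0_integralZl_EFin P measurableT _ _ k0); last 2 first.
  - by move=> w _; rewrite adde_ge0.
  - by apply: emeasurable_funD; exact: mdxw.
  rewrite (ge0_integralD P measurableT (fun w _ => s0 _ _ _) (mdxw _ i2_in) (fun w _ => s0 _ _ _) (mdxw _ i1_in)).
  have -> : ((2 * T * C ^+ 2 * (2 * A))%:E * (expR (l * s))%:E =
      (2 * T * C ^+ 2)%:E * (2 * A * expR (l * s))%:E)%E by rewrite -!EFinM; congr EFin; ring.
  apply: lee_wpmul2l; first by rewrite lee_fin.
  apply: (le_trans (leeD (IH i s i1 K1 s_in) (IH i.+1 s isT K2 s_in))).
  by rewrite -EFinD lee_fin -/A le_eqVlt; apply/orP; left; apply/eqP; ring.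
have mD : measurable (`[0, t]%classic : set R) by exact: measurable_itv.
have mexp : measurable_fun [set: R] (fun s : R => (expR (l * s))%:E).
  apply/measurable_EFinP; apply: (@measurableT_comp _ _ _ _ _ _ expR _ (fun s => l * s)) => //.
  by apply: measurable_funM; [exact: measurable_cst|exact: measurable_id].
have k1 : 0 <= 2 * T * C ^+ 2 * (2 * A) by rewrite mulr_ge0// mulr_ge0.
rewrite (leb_integralZl mD (measurable_funS measurableT (@subsetT _ _) mexp) _ k1); last first.
  by move=> s _; rewrite lee_fin expR_ge0.
apply: (le_trans (lee_wpmul2l _ (integral_expR_growing t l0))); first by rewrite lee_fin.
rewrite -EFinM lee_fin /A.
have -> : 2 * T * C ^+ 2 * (2 * (M * (2^-1 ^+ K) ^+ 2)) * (l^-1 * expR (l * t)) =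
  M * (2^-1 ^+ K) ^+ 2 * expR (l * t) * (4 * T * C ^+ 2 / l) by ring.
have -> : M * (2^-1 ^+ K.+1) ^+ 2 * expR (l * t) = M * (2^-1 ^+ K) ^+ 2 * expR (l * t) * 4^-1.
  by rewrite [2^-1 ^+ K.+1]exprS; move: (2^-1 ^+ K) => q; field.
apply: ler_wpM2l; first by rewrite !mulr_ge0 ?expR_ge0// sqr_ge0.
rewrite ler_pdivrMr// /l; lra.
Qed.

Lemma picard_error K i t : (1 <= i)%N -> (i + K <= n.+1)%N -> 0 <= t <= T ->
  (\int[P]_w ((x i t w - picard g xi W K i t w) ^+ 2)%:E <=
   (M * expR ((16 * T * C ^+ 2 + 1) * T) * (2^-1 ^+ K) ^+ 2)%:E)%E.
Proof.
move=> i1 iK t_in; have [t0 tT] := andP t_in.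
apply: (le_trans (picard_error_weighted i1 iK t_in)).
rewrite lee_fin mulrAC ler_wpM2r ?sqr_ge0// ler_wpM2l// ler_expR.
by rewrite ler_wpM2l// ltW.
Qed.

End picard_error.

(** * Second moments *)

Section contraction.
Context d (U : measurableType d) (R : realType) (P : probability U R).
Local Open Scope ereal_scope.

(** If E y1 is finite, the bound follows from E y2 = E y1. In general, put
    F k = E min(2^-k y2, L). As y1 can be exchanged with y2 in the expectation, the
    inequality gives F k <= 2^-k A + F (k+1). Hence F 0 <= 2 A + lim F, and the
    limit is 0 by dominated convergence. Finally L tends to infinity. *)
Lemma contraction_same_law (y1 y2 a : U -> \bar R) (A : R) :
  measurable_fun [set: U] y1 -> measurable_fun [set: U] y2 -> measurable_fun [set: U] a ->
  (forall w, 0 <= y1 w) -> (forall w, 0 <= y2 w < +oo) -> (forall w, 0 <= a w) ->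
  (forall psi : \bar R -> \bar R, measurable_fun [set: \bar R] psi -> (forall x, 0 <= psi x) ->
    \int[P]_w psi (y1 w) = \int[P]_w psi (y2 w)) ->
  {ae P, forall w, y1 w <= a w + 2^-1%:E * y2 w} ->
  \int[P]_w a w <= A%:E ->
  \int[P]_w y1 w <= (2 * A)%:E.
Proof.
move=> my1 my2 ma y10 y20 a0 law le_y intA.
have A0 : (0 <= A)%R by rewrite -lee_fin; apply: le_trans intA; exact: integral_ge0.
pose cut (L : R) k (x : \bar R) := mine ((2^-1 ^+ k)%R%:E * x) L%:E.
have mcut L k : measurable_fun [set: \bar R] (cut L k).
  apply: measurable_mine => //; apply: emeasurable_funM => //.
have cut0 L k x : (0 <= L)%R -> 0 <= x -> 0 <= cut L k x.
  by move=> L0 x0; rewrite /cut le_min lee_fin L0 mule_ge0// lee_fin exprn_ge0.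
have law_cut L k : (0 <= L)%R -> \int[P]_w cut L k (y1 w) = \int[P]_w cut L k (y2 w).
  move=> L0.
  have := law (fun x => maxe (cut L k x) 0).
  have e y : (forall w, 0 <= y w) -> \int[P]_w maxe (cut L k (y w)) 0 = \int[P]_w cut L k (y w).
    by move=> y0; apply: eq_integral => w _; apply/max_idPl; exact: cut0.
  rewrite !e//; last by move=> w; case/andP: (y20 w).
  apply; first by apply: measurable_maxe => //.
  by move=> x; rewrite le_max lexx orbT.
have step L k : (0 <= L)%R ->
    \int[P]_w cut L k (y2 w) <= (2^-1 ^+ k * A)%R%:E + \int[P]_w cut L k.+1 (y2 w).
  move=> L0; rewrite -law_cut//.
  have mc2 : measurable_fun [set: U] (fun w => cut L k.+1 (y2 w)) by exact: (measurableT_comp (mcut _ _)).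
  have c20 w : 0 <= cut L k.+1 (y2 w) by apply: cut0 => //; case/andP: (y20 w).
  have mca : measurable_fun [set: U] (fun w => (2^-1 ^+ k)%R%:E * a w).
    by apply: emeasurable_funM.
  have ca0 w : 0 <= (2^-1 ^+ k)%R%:E * a w by rewrite mule_ge0// lee_fin exprn_ge0.
  apply: (@le_trans _ _ (\int[P]_w ((2^-1 ^+ k)%R%:E * a w + cut L k.+1 (y2 w)))).
    apply: ae_ge0_le_integral => //.
    - by move=> w _; exact: cut0.
    - exact: (measurableT_comp (mcut _ _)).
    - by move=> w _; rewrite adde_ge0.
    - exact: emeasurable_funD.
    - apply: filterS le_y => w yw _; rewrite /cut.
      have [_|_] := leP ((2^-1 ^+ k.+1)%R%:E * y2 w) L%:E; last first.
        by rewrite ge_min; apply/orP; right; rewrite leeDr.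
      rewrite ge_min; apply/orP; left.
      rewrite exprSr EFinM -muleA -ge0_muleDr//; last first.
        by rewrite mule_ge0// ?lee_fin ?invr_ge0//; case/andP: (y20 w).
      by apply: lee_wpmul2l => //; rewrite lee_fin exprn_ge0.
  rewrite ge0_integralD//; apply: leeD => //.
  by rewrite ge0_integralZl_EFin// ?exprn_ge0// EFinM; apply: lee_wpmul2l => //.
have iter L k : (0 <= L)%R -> \int[P]_w cut L 0%N (y2 w) <=
    ((2 - 2 * 2^-1 ^+ k) * A)%R%:E + \int[P]_w cut L k (y2 w).
  move=> L0; elim: k => [|k IH]; first by rewrite expr0 mulr1 subrr mul0r add0e.
  apply: (le_trans IH).
  apply: (@le_trans _ _ (((2 - 2 * 2^-1 ^+ k) * A)%R%:E + ((2^-1 ^+ k * A)%R%:E + \int[P]_w cut L k.+1 (y2 w)))).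
    by rewrite leeD2l// step.
  rewrite addeA -EFinD leeD2r// lee_fin -mulrDl ler_wpM2r// exprS mulrA divff// mul1r.
  by rewrite le_eqVlt; apply/orP; left; apply/eqP; ring.
have lim0 L : (0 <= L)%R -> \int[P]_w cut L k (y2 w) @[k --> \oo] --> 0.
  move=> L0.
  have -> : 0 = \int[P]_(w in [set: U]) cst 0 w by rewrite integral0.
  apply: (@dominated_cvg _ _ _ P setT measurableT (fun k w => cut L k (y2 w)) (cst 0) (cst L%:E)) => //.
  - by move=> k; exact: (measurableT_comp (mcut _ _)).
  - move=> w _ /=.
    have /andP[yw0 ywoo] := y20 w.
    have [r yr] : exists r, y2 w = r%:E by exists (fine (y2 w)); rewrite fineK// ge0_fin_numE.
    have r0 : (0 <= r)%R by rewrite -lee_fin -yr.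
    have h : (2^-1 ^+ k * r)%R%:E @[k --> \oo] --> 0.
      apply/cvg_EFin; first by near=> k.
      rewrite -[X in _ --> X](mul0r r); apply: cvgMl.
      apply: cvg_expr; rewrite ger0_norm// invf_lt1//; exact: ltr1n.
    apply: (squeeze_cvge _ (cvg_cst _) h).
    by near=> k; rewrite cut0// /cut yr -EFinM ge_min lexx.
  - exact: finite_measure_integrable_cst.
  - by move=> k w _; rewrite gee0_abs ?cut0 ?(andP (y20 w)).1// /cut ge_min lexx orbT.
have bound L : (0 <= L)%R -> \int[P]_w cut L 0%N (y2 w) <= (2 * A)%:E.
  move=> L0; rewrite -[leRHS]adde0.
  have h : (2 * A)%:E + \int[P]_w cut L k (y2 w) @[k --> \oo] --> (2 * A)%:E + 0.
    by apply: cvgeD => //; [exact: cvg_cst|exact: lim0].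
  rewrite -(cvg_lim _ h)//; apply: lime_ge; first by apply/cvg_ex; eexists; exact: h.
  near=> k; apply: (le_trans (iter L k L0)).
  by rewrite leeD2r// lee_fin ler_wpM2r// gerBl mulr_ge0// exprn_ge0.
have y1E : \int[P]_w y1 w = \int[P]_w limn (fun n : nat => mine (y1 w) n%:R%:E).
  apply: eq_integral => w _; apply/esym/cvg_lim => //.
  have := y10 w; case: (y1 w) => [r _| _|//].
    apply: cvg_near_cst.
    near=> n; apply/min_idPl; rewrite lee_fin.
    near: n; exact: nbhs_infty_ger.
  have -> : (fun n : nat => mine (+oo : \bar R) n%:R%:E) = (fun n : nat => n%:R%:E).
    by apply/funext => n; rewrite minye.
  exact/cvgenyP.
rewrite y1E monotone_convergence//.
- apply: lime_le.
    apply: ereal_nondecreasing_is_cvgn => m n mn; apply: ge0_le_integral => //.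
    + by move=> w _; rewrite le_min y10 lee_fin ler0n.
    + exact: measurable_mine.
    + exact: measurable_mine.
    + by move=> w _; rewrite le_min !ge_min lexx/= lee_fin ler_nat mn orbT.
  near=> n; have := bound n%:R (ler0n _ _); rewrite -law_cut//.
  apply: le_trans; rewrite le_eqVlt; apply/orP; left; apply/eqP.
  by apply: eq_integral => w _; rewrite /cut expr0 mul1e.
- by move=> n; exact: measurable_mine.
- by move=> n w _; rewrite le_min y10 lee_fin ler0n.
- move=> w _ m n mn.
  by rewrite le_min !ge_min lexx/= lee_fin ler_nat mn orbT.
Unshelve. all: by end_near. Qed.

End contraction.

(** The density agrees almost everywhere with the Radon-Nikodym derivative. *)
Lemma integral_normal_prob (R : realType) (m s : R) (f : measurableTypeR R -> \bar R) :
  measurable_fun setT f -> (forall x, 0 <= f x)%E ->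
  (\int[normal_prob m s]_x f x =
   \int[@lebesgue_measure R]_x (f x * (normal_pdf m s x)%:E))%E.
Proof.
move=> mf f0; have dom := @normal_prob_dominates R m s.
rewrite -(Radon_Nikodym_SigmaFinite.change_of_variables dom f0 measurableT mf).
set g := Radon_Nikodym_SigmaFinite.f _ _.
have gi := Radon_Nikodym_SigmaFinite.f_integrable dom.
have mg : measurable_fun setT g by exact: measurable_int gi.
have mp : measurable_fun [set: measurableTypeR R] (fun x => (normal_pdf m s x)%:E).
  by apply/measurable_EFinP; exact: measurable_normal_pdf.
have gE : ae_eq lebesgue_measure setT g (fun x => (normal_pdf m s x)%:E).
  apply: integral_ae_eq => // E _ mE.
  by rewrite -(Radon_Nikodym_SigmaFinite.f_integral dom).
apply: ae_eq_integral => //; [exact: emeasurable_funM|exact: emeasurable_funM|].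
by apply: filterS gE => x H xT; rewrite H.
Qed.

Section brownian_moment.
Context d (U : measurableType d) (R : realType) (P : probability U R).
Local Notation leb := (@lebesgue_measure R).

(** Half of the Gaussian exponent absorbs the factor x^2 and the other half is a
    Gaussian with twice the variance. So the second moment of a normal law is
    bounded by a constant times a total mass. *)
Lemma normal_pdf_sqr_le (s x : R) : 0 < s ->
  x ^+ 2 * normal_pdf 0 s x <= 8 * s ^+ 2 * normal_pdf 0 (s * Num.sqrt 2) x.
Proof.
move=> s0; have r0 : 0 < Num.sqrt 2 :> R by rewrite sqrtr_gt0.
have r2 : Num.sqrt 2 ^+ 2 = 2 :> R by rewrite sqr_sqrtr.
have sr0 : 0 < s * Num.sqrt 2 by rewrite mulr_gt0.
rewrite !normal_pdfE ?gt_eqF//= /normal_fun !subr0.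
set y := x ^+ 2 / (4 * s ^+ 2).
have y0 : 0 <= y by rewrite divr_ge0 ?sqr_ge0// mulr_ge0// sqr_ge0.
have -> : - x ^+ 2 / (s ^+ 2 *+ 2) = - y + - y.
  by rewrite /y -mulr_natr; field; rewrite gt_eqF.
have -> : - x ^+ 2 / ((s * Num.sqrt 2) ^+ 2 *+ 2) = - y.
  by rewrite exprMn r2 /y -mulr_natr; field; rewrite gt_eqF.
rewrite expRD.
have xE : x ^+ 2 = 4 * s ^+ 2 * y by rewrite /y; field; rewrite gt_eqF.
have ye : y * expR (- y) <= 1.
  rewrite expRN ler_pdivrMr ?expR_gt0// mul1r.
  by apply: le_trans (expR_ge1Dx y); rewrite lerDr.
have peakE : normal_peak s = Num.sqrt 2 * normal_peak (s * Num.sqrt 2).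
  rewrite /normal_peak exprMn r2.
  have e (p q : R) : p * 2 * q *+ 2 = 2 * (p * q *+ 2) by rewrite !mulr2n; ring.
  rewrite e.
  by rewrite sqrtrM// invfM mulrA mulfV ?gt_eqF// mul1r.
have sq2 : Num.sqrt 2 <= 2 :> R.
  have := ltW r0; move: r2; nra.
have n0 := normal_peak_ge0 (s * Num.sqrt 2).
have e0 := expR_ge0 (- y).
rewrite peakE xE.
have -> : 4 * s ^+ 2 * y * (Num.sqrt 2 * normal_peak (s * Num.sqrt 2) * (expR (- y) * expR (- y))) =
  4 * s ^+ 2 * (normal_peak (s * Num.sqrt 2) * expR (- y)) * (Num.sqrt 2 * (y * expR (- y))) by ring.
have -> : 8 * s ^+ 2 * (normal_peak (s * Num.sqrt 2) * expR (- y)) =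
  4 * s ^+ 2 * (normal_peak (s * Num.sqrt 2) * expR (- y)) * 2 by ring.
apply: ler_wpM2l.
  by apply: mulr_ge0; [rewrite mulr_ge0 ?sqr_ge0|exact: mulr_ge0].
rewrite -[leRHS]mulr1; apply: ler_pM => //; exact: mulr_ge0.
Qed.

Lemma brownian_second_moment (B : process U R) t : brownian_motion P B -> 0 <= t ->
  (\int[P]_w (B t w ^+ 2)%:E <= (8 * t)%:E)%E.
Proof.
move=> [_ _ B0 Binc]; rewrite le_eqVlt => /orP[/eqP<-|t0].
  have -> : ((8 * 0)%:E = \int[P]_(w in setT) (cst 0 w))%E by rewrite integral0 mulr0.
  apply: ae_ge0_le_integral_lower.
  - by move=> w; rewrite lee_fin sqr_ge0.
  - by move=> w.
  - exact: measurable_cst.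
  - by apply: filterS B0 => w ->; rewrite expr0n.
have [law _] := Binc 0 t (lexx _) t0; rewrite subr0 in law.
set s := Num.sqrt t in law.
have s0 : 0 < s by rewrite sqrtr_gt0.
have s2 : s ^+ 2 = t by rewrite sqr_sqrtr// ltW.
have mX : @measurable_fun _ _ U (measurableTypeR R) [set: U] (increment B 0 t).
  exact: measurable_increment.
pose X : {mfun U >-> measurableTypeR R} := @mfun_Sub _ _ U (measurableTypeR R) _ (mem_set mX).
have mincr : measurable_fun [set: U] (fun w => (increment B 0 t w ^+ 2)%:E).
  by apply/measurable_EFinP/measurable_funX; exact: measurable_increment.
apply: (@le_trans _ _ (\int[P]_w (increment B 0 t w ^+ 2)%:E)%E).
  apply: ae_ge0_le_integral_lower => //.
  - by move=> w; rewrite lee_fin sqr_ge0.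
  - by move=> w; rewrite lee_fin sqr_ge0.
  - by apply: filterS B0 => w B0w; rewrite /increment B0w subr0.
have msq : measurable_fun [set: R] (fun x : R => (x ^+ 2)%:E).
  by apply/measurable_EFinP; exact: measurable_funX.
have mpdf q : measurable_fun [set: R] (fun x : R => (normal_pdf 0 q x)%:E).
  by apply/measurable_EFinP; exact: measurable_normal_pdf.
have -> : (\int[P]_w (increment B 0 t w ^+ 2)%:E = \int[normal_prob 0 s]_x (x ^+ 2)%:E)%E.
  transitivity (\int[distribution P X]_x (x ^+ 2)%:E)%E.
    rewrite (ge0_integral_distribution (P := P) X (f := fun x : measurableTypeR R => (x ^+ 2)%:E))//.
    by move=> x; rewrite lee_fin sqr_ge0.
  by apply: eq_measure_integral => A mA _; exact: law.
rewrite integral_normal_prob//; last by move=> x; rewrite lee_fin sqr_ge0.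
apply: (@le_trans _ _ (\int[leb]_x ((8 * t)%:E * (normal_pdf 0 (s * Num.sqrt 2) x)%:E))%E).
  apply: leb_le_integral => x _; first by rewrite mule_ge0// lee_fin ?sqr_ge0// normal_pdf_ge0.
  by rewrite -!EFinM lee_fin -s2; exact: normal_pdf_sqr_le.
have t80 : 0 <= 8 * t by rewrite mulr_ge0// ltW.
rewrite (leb_integralZl measurableT (mpdf _) _ t80).
  by rewrite integral_normal_pdf mule1.
by move=> x _; rewrite lee_fin normal_pdf_ge0.
Qed.

End brownian_moment.

Section path_functionals.
Context d (U : measurableType d) (R : realType) (P : probability U R).
Local Notation leb := (@lebesgue_measure R).

Lemma measurable_coordinate (t : R) : 0 <= t ->
  measurable_fun [set: path_space R] (fun p : path_space R => p t : R).
Proof.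
move=> t0 _ B mB; rewrite setTI; apply: sub_gen_smallest.
by exists t, B; split.
Qed.

Lemma same_law_integral d' (T : measurableType d') (X Y : {mfun U >-> T}) (f : T -> \bar R) :
  same_law (distribution P X) (distribution P Y) ->
  measurable_fun [set: T] f -> (forall x, 0 <= f x)%E ->
  (\int[P]_w f (X w) = \int[P]_w f (Y w))%E.
Proof.
move=> XY mf f0.
rewrite -(ge0_integral_distribution (P := P) X mf f0) -(ge0_integral_distribution (P := P) Y mf f0).
by apply: eq_measure_integral => A mA _; exact: XY.
Qed.

(** The integral of exp(- l s) p(s)^2, in a form that is measurable on all paths:
    only the values of p on the grid are used, and the limit superior, which is
    p(s)^2 for a continuous path, is made nonnegative by the absolute value. *)
Definition weighted_energy (l T : R) (p : path_space R) : \bar R :=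
  (\int[leb]_(s in `[0%R, T]) ((expR (- (l * s)))%:E *
     `| limn_esup (fun n => ((p (grid n s) : R) ^+ 2)%:E) |))%E.

Lemma measurable_weighted_energy l T : measurable_fun [set: path_space R] (weighted_energy l T).
Proof.
pose f (z : R * path_space R) : \bar R := ((expR (- (l * z.1)))%:E *
     `| limn_esup (fun n => ((z.2 (grid n z.1) : R) ^+ 2)%:E) |)%E.
have mf : measurable_fun [set: R * path_space R] f.
  apply: emeasurable_funM.
    exact: (measurableT_comp (measurable_exp_decay l) measurable_fst).
  apply: measurableT_comp => //.
  apply: (@measurable_fun_limn_esup _ _ _ _ (fun n (z : R * path_space R) => ((z.2 (grid n z.1) : R) ^+ 2)%:E)) => n.
  apply/measurable_EFinP; apply: measurable_funX.
  exact: (@measurable_grid_eval _ _ (path_space R) (fun t p => p t) n measurable_coordinate).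
have f0 z : (0 <= f z)%E by rewrite mule_ge0// ?lee_fin ?expR_ge0.
exact: (measurable_time_integral T mf f0).
Qed.

Lemma weighted_energyE l T (X : process U R) w : continuous_paths X ->
  weighted_energy l T (sample_path X w) =
  (\int[leb]_(s in `[0%R, T]) ((expR (- (l * s)))%:E * (X s w ^+ 2)%:E))%E.
Proof.
move=> cX; apply: eq_integral => s; rewrite inE /= in_itv/= => /andP[s0 _].
congr (_ * _)%E.
have h : (X (grid n s) w ^+ 2)%:E @[n --> \oo] --> (X s w ^+ 2)%:E.
  apply: cvg_EFin; first by near=> n.
  by apply: (@cvg_comp _ _ _ (fun n => X (grid n s) w) (fun x => x ^+ 2) _ (nbhs (X s w)));
    [exact: (@cvg_grid_eval R (fun t => X t w))|exact: exprn_continuous].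
rewrite /sample_path (cvg_limn_einf_sup h).2 gee0_abs// lee_fin sqr_ge0.
Unshelve. all: by end_near. Qed.

Lemma same_path_law_moment (X Y : process U R) t : 0 <= t ->
  same_law (path_law P X) (path_law P Y) ->
  (\int[P]_w (X t w ^+ 2)%:E = \int[P]_w (Y t w ^+ 2)%:E)%E.
Proof.
move=> t0 XY.
apply: (same_law_integral (X := sample_path X) (Y := sample_path Y)
  (f := fun p : path_space R => ((p t : R) ^+ 2)%:E) XY).
  by apply/measurable_EFinP; apply: measurable_funX; exact: measurable_coordinate.
by move=> p; rewrite lee_fin sqr_ge0.
Qed.

End path_functionals.

Section second_moment.
Context d (U : measurableType d) (R : realType) (P : probability U R).
Local Notation leb := (@lebesgue_measure R).
Variables (x y : process U R) (B : R -> U -> R) (xi : U -> R) (C T c0 A : R).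
Hypotheses (cx : continuous_paths x) (cy : continuous_paths y).
Hypothesis (xy : same_law (path_law P x) (path_law P y)).
Hypothesis mB : measurable_fun [set: R * U] (fun z : R * U => B z.1 z.2).
Hypothesis mxi : measurable_fun [set: U] xi.
Hypotheses (C0 : 0 <= C) (T0 : 0 < T).
Hypothesis e_xi : (\int[P]_w (xi w ^+ 2)%:E <= A%:E)%E.
Hypothesis e_B : forall t, 0 <= t <= T -> (\int[P]_w (B t w ^+ 2)%:E <= A%:E)%E.
Hypothesis bound : {ae P, forall w, forall t, 0 <= t <= T ->
  (`|x t w|%:E <= (`|xi w| + `|B t w| + `|c0|)%:E +
     \int[leb]_(s in `[0%R, t]) (C * (`|x s w| + `|y s w|))%:E)%E}.

Let xp (z : process U R) t w := z (Num.max t 0) w.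
Let mxp (z : process U R) : continuous_paths z -> measurable_fun [set: R * U] (fun u : R * U => xp z u.1 u.2).
Proof. by move=> cz; apply: (@measurable_continuous_process R _ U (fun t => z t)). Qed.
Let xpE (z : process U R) t w : 0 <= t -> xp z t w = z t w.
Proof. by move=> t0; rewrite /xp (max_idPl t0). Qed.

Let k := 8 * C ^+ 2 * T.
Let l := 4 * k + 1.
Let k0 : 0 <= k. Proof. by rewrite /k !mulr_ge0 ?sqr_ge0// ltW. Qed.
Let l0 : 0 < l. Proof. by rewrite /l ltr_wpDl// mulr_ge0. Qed.

Let f (t : R) (w : U) : R := 4 * (xi w ^+ 2 + B t w ^+ 2 + c0 ^+ 2).
Let q (z : process U R) (u : R * U) : \bar R := (xp z u.1 u.2 ^+ 2)%:E.

Let mf : measurable_fun [set: R * U] (fun u : R * U => (f u.1 u.2)%:E).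
Proof.
apply/measurable_EFinP; apply: measurable_funM => //; apply: measurable_funD => //.
apply: measurable_funD; apply: measurable_funX => //.
exact: (measurableT_comp mxi).
Qed.
Let f0 u : (0 <= (f u.1 u.2)%:E)%E.
Proof. by rewrite lee_fin mulr_ge0// !addr_ge0 ?sqr_ge0. Qed.
Let mq z : continuous_paths z -> measurable_fun [set: R * U] (q z).
Proof. by move=> cz; apply/measurable_EFinP; apply: measurable_funX; exact: mxp. Qed.
Let q0 z u : (0 <= q z u)%E. Proof. by rewrite lee_fin sqr_ge0. Qed.

Let sqr_bound : {ae P, forall w, forall t, 0 <= t <= T ->
  ((x t w ^+ 2)%:E <= (f t w)%:E +
     k%:E * \int[leb]_(s in `[0%R, t]) (q x (s, w) + q y (s, w)))%E}.
Proof.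
apply: filterS bound => w bw t t_in; have [t0 tT] := andP t_in.
have mxw z : continuous_paths z -> measurable_fun [set: R] (fun s => xp z s w).
  by move=> cz; exact: (measurable_fun_pair1 w (mxp cz)).
pose h s := C * (`|xp x s w| + `|xp y s w|).
have mh : measurable_fun [set: R] h.
  by apply: measurable_funM => //; apply: measurable_funD; apply: measurableT_comp => //; exact: mxw.
have h0 s : 0 <= h s by rewrite mulr_ge0// addr_ge0.
have I0 : (0 <= \int[leb]_(s in `[0%R, t]) (h s)%:E)%E by apply: integral_ge0 => s _; rewrite lee_fin.
have hE : (\int[leb]_(s in `[0%R, t]) (C * (`|x s w| + `|y s w|))%:E = \int[leb]_(s in `[0%R, t]) (h s)%:E)%E.
  by apply: eq_integral => s; rewrite inE/= in_itv/= => /andP[s0 _]; rewrite /h !xpE.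
have := bw t t_in; rewrite hE.
have mD : measurable (`[0, t]%classic : set R) by exact: measurable_itv.
have mh2 : measurable_fun `[0, t] (fun s => (h s ^+ 2)%:E).
  by apply: measurable_funS measurableT (@subsetT _ _) _; apply/measurable_EFinP; exact: measurable_funX.
have Ih2 : (\int[leb]_(s in `[0%R, t]) (h s ^+ 2)%:E <=
    (2 * C ^+ 2)%:E * \int[leb]_(s in `[0%R, t]) (q x (s, w) + q y (s, w)))%E.
  have c2 : 0 <= 2 * C ^+ 2 by rewrite mulr_ge0// sqr_ge0.
  have mqq : measurable_fun `[0, t] (fun s => q x (s, w) + q y (s, w))%E.
    apply: measurable_funS measurableT (@subsetT _ _) _; apply: emeasurable_funD.
      exact: (measurable_fun_pair1 w (mq cx)).
    exact: (measurable_fun_pair1 w (mq cy)).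
  rewrite -(leb_integralZl mD mqq _ c2); last by move=> s _; rewrite adde_ge0.
  apply: leb_le_integral => s _; first by rewrite lee_fin sqr_ge0.
  rewrite /q/= -EFinD -EFinM lee_fin /h exprMn.
  have -> : 2 * C ^+ 2 * (xp x s w ^+ 2 + xp y s w ^+ 2) = C ^+ 2 * (2 * (xp x s w ^+ 2 + xp y s w ^+ 2)) by ring.
  rewrite ler_wpM2l ?sqr_ge0//.
  rewrite -(real_normK (num_real (xp x s w))) -(real_normK (num_real (xp y s w))).
  by have := sqr_ge0 (`|xp x s w| - `|xp y s w|); nra.
move: I0; case Ih : (\int[leb]_(s in `[0%R, t]) (h s)%:E)%E => [a| |] // I0 bxw; last first.
  have infty : (\int[leb]_(s in `[0%R, t]) (q x (s, w) + q y (s, w)) = +oo)%E.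
    apply/eqP; rewrite -leye_eq leNgt; apply/negP => ltoo.
    have I20 : (0 <= \int[leb]_(s in `[0%R, t]) (q x (s, w) + q y (s, w)))%E.
      by apply: integral_ge0 => s _; rewrite adde_ge0.
    have : (\int[leb]_(s in `[0%R, t]) (h s)%:E < +oo)%E.
      apply: (@le_lt_trans _ _ (\int[leb]_(s in `[0%R, t]) (1%:E + (h s ^+ 2)%:E))%E).
        apply: leb_le_integral => s _; first by rewrite lee_fin.
        rewrite -EFinD lee_fin; have := sqr_ge0 (h s - 1); have := h0 s; nra.
      rewrite (leb_integralD mD (measurable_cst _) _ mh2); last 2 first.
      - by move=> s _; rewrite lee_fin.
      - by move=> s _; rewrite lee_fin sqr_ge0.
      apply: lte_add_pinfty.
        have := integral_cst leb mD 1%:E => ->.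
        rewrite mul1e; exact: le_lt_trans (lebesgue_measure_0t t0) (ltry _).
      apply: (le_lt_trans Ih2); apply: lte_mul_pinfty => //.
      by rewrite lee_fin mulr_ge0// sqr_ge0.
    by rewrite Ih.
  have [kk|kk] := eqVneq k 0.
    exfalso; move: kk; rewrite /k => /eqP.
    rewrite mulf_eq0 (gt_eqF T0) orbF mulf_eq0 pnatr_eq0/= sqrf_eq0 => /eqP Cz; move: Ih; rewrite /h Cz.
    under eq_integral do rewrite mul0r.
    by rewrite integral0.
  by rewrite infty gt0_muley ?addey// ?leey// lte_fin lt_neqAle eq_sym kk.
have a0 : 0 <= a by rewrite -lee_fin.
have a2 := leb_sqr_le_integral t0 mh h0 a0 (eq_ind _ (fun z => (z <= _)%E) (lexx _) _ Ih).
move: bxw; rewrite -EFinD lee_fin => bxw.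
have x2 : x t w ^+ 2 <= f t w + 4 * a ^+ 2.
  rewrite -(real_normK (num_real (x t w))) /f -(real_normK (num_real (xi w))) -(real_normK (num_real (B t w))) -(real_normK (num_real c0)).
  apply: (@le_trans _ _ ((`|xi w| + `|B t w| + `|c0| + a) ^+ 2)).
    by rewrite ler_pXn2r// nnegrE// !addr_ge0.
  move: (`|xi w|) (`|B t w|) (`|c0|) => p1 p2 p3.
  have := sqr_ge0 (p1 - p2); have := sqr_ge0 (p1 - p3); have := sqr_ge0 (p1 - a).
  have := sqr_ge0 (p2 - p3); have := sqr_ge0 (p2 - a); have := sqr_ge0 (p3 - a).
  rewrite !expr2; lra.
apply: (@le_trans _ _ ((f t w)%:E + 4%:E * (a ^+ 2)%:E)%E); first by rewrite -EFinM -EFinD lee_fin.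
rewrite leeD2l//.
have e4 : (4%:E * (a ^+ 2)%:E <= 4%:E * (t%:E * ((2 * C ^+ 2)%:E * \int[leb]_(s in `[0%R, t]) (q x (s, w) + q y (s, w)))))%E.
  apply: lee_wpmul2l; first by rewrite lee_fin.
  apply: (le_trans a2); apply: lee_wpmul2l; first by rewrite lee_fin.
  exact: Ih2.
apply: (le_trans e4); rewrite !muleA -!EFinM; apply: lee_wpmul2r.
  by apply: integral_ge0 => s _; rewrite adde_ge0.
rewrite lee_fin /k.
have -> : 4 * t * (2 * C ^+ 2) = 8 * C ^+ 2 * t by ring.
by rewrite ler_wpM2l// mulr_ge0// sqr_ge0.
Qed.

Let J (z : process U R) w := weighted_energy l T (sample_path z w).
Let JE z w : continuous_paths z ->
  J z w = (\int[leb]_(s in `[0%R, T]) ((expR (- (l * s)))%:E * q z (s, w)))%E.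
Proof.
move=> cz; rewrite /J weighted_energyE//; apply: eq_integral => s.
by rewrite inE/= in_itv/= => /andP[s0 _]; rewrite /q/= xpE.
Qed.
Let J0 z w : (0 <= J z w)%E.
Proof. by apply: integral_ge0 => s _; rewrite mule_ge0// lee_fin expR_ge0. Qed.
Let mJ z : measurable_fun [set: U] (J z).
Proof. exact: (measurableT_comp (measurable_weighted_energy l T)). Qed.

Let J_fin z w : continuous_paths z -> (J z w < +oo)%E.
Proof.
move=> cz.
have c : {within `[0, T], continuous (fun s => z s w ^+ 2)}.
  have c1 : {within `[0, T], continuous (fun s => z s w)}.
    apply: continuous_subspaceW (cz w) => s; rewrite /= !in_itv/= => /andP[-> _//].
  move=> s; apply: (@cvg_comp _ _ _ (fun s => z s w) (fun v => v ^+ 2) _ (nbhs (z s w))); first exact: c1.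
  exact: exprn_continuous.
have := continuous_compact_integrable (@segment_compact _ 0 T) c.
case/integrableP => _; apply: le_lt_trans.
rewrite /J weighted_energyE//; apply: leb_le_integral => s.
  by rewrite mule_ge0// lee_fin ?expR_ge0// sqr_ge0.
rewrite /= in_itv/= => /andP[s0 _].
rewrite ger0_norm ?sqr_ge0// -EFinM lee_fin ler_piMl ?sqr_ge0//.
by rewrite -expR0 ler_expR oppr_le0 mulr_ge0// ltW.
Qed.

Let a w : \bar R := (\int[leb]_(s in `[0%R, T]) (f s w)%:E)%E.
Let ma : measurable_fun [set: U] a.
Proof. exact: (measurable_time_integral T mf f0). Qed.
Let a0 w : (0 <= a w)%E.
Proof. by apply: integral_ge0 => s _; exact: (f0 (s, w)). Qed.

Let J_bound : {ae P, forall w, (J x w <= 2%:E * a w + 2^-1%:E * J y w)%E}.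
Proof.
apply: filterS sqr_bound => w bw.
have mD : measurable (`[0, T]%classic : set R) by exact: measurable_itv.
have mexp := measurable_exp_decay l.
have mfw : measurable_fun [set: R] (fun s => (f s w)%:E) by exact: (measurable_fun_pair1 w mf).
have mqw z : continuous_paths z -> measurable_fun [set: R] (fun s => q z (s, w)).
  by move=> cz; exact: (measurable_fun_pair1 w (mq cz)).
have mqq : measurable_fun [set: R] (fun s => q x (s, w) + q y (s, w))%E.
  by apply: emeasurable_funD; exact: mqw.
have qq0 s : (0 <= q x (s, w) + q y (s, w))%E by rewrite adde_ge0.
have e0 s : (0 <= (expR (- (l * s)))%:E)%E by rewrite lee_fin expR_ge0.
pose V t := (\int[leb]_(s in `[0%R, t]) (q x (s, w) + q y (s, w)))%E.
have V0 t : (0 <= V t)%E by apply: integral_ge0 => s _.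
have mV : measurable_fun [set: R] V.
  pose qq (u : R * U) := (q x u + q y u)%E.
  have mqq' : measurable_fun [set: R * U] qq by apply: emeasurable_funD; exact: mq.
  have qq'0 u : (0 <= qq u)%E by rewrite adde_ge0.
  exact: (measurable_fun_pair1 w (measurable_time_integral2 mqq' qq'0)).
have S (g : R -> \bar R) : measurable_fun [set: R] g -> measurable_fun `[0, T] g.
  by move=> mg; exact: measurable_funS measurableT (@subsetT _ _) mg.
have J1 : (J x w <= a w + k%:E * ((l^-1)%:E * (J x w + J y w)))%E.
  apply: (@le_trans _ _ (\int[leb]_(t in `[0%R, T]) ((f t w)%:E + k%:E * ((expR (- (l * t)))%:E * V t)))%E).
    rewrite JE//; apply: leb_le_integral => t; first by rewrite mule_ge0.
    rewrite /= in_itv/= => t_in; have [t0 _] := andP t_in.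
    have := bw t t_in; rewrite -/(V t) /q/= xpE// => h.
    apply: (le_trans (lee_wpmul2l (e0 t) h)).
    rewrite ge0_muleDr ?mule_ge0// ?lee_fin//; last by rewrite -lee_fin; exact: (f0 (t, w)).
    rewrite muleCA; apply: leeD => //.
    rewrite -EFinM lee_fin ler_piMl//; first by rewrite -lee_fin; exact: (f0 (t, w)).
    by rewrite -expR0 ler_expR oppr_le0 mulr_ge0// ltW.
  have meV : measurable_fun [set: R] (fun t => (expR (- (l * t)))%:E * V t)%E by exact: emeasurable_funM.
  have mkeV : measurable_fun [set: R] (fun t => k%:E * ((expR (- (l * t)))%:E * V t))%E.
    by apply: emeasurable_funM; [exact: measurable_cst|exact: meV].
  have eV0 t : (0 <= (expR (- (l * t)))%:E * V t)%E by rewrite mule_ge0.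
  rewrite (leb_integralD mD (S _ mfw) _ (S _ mkeV)); last 2 first.
  - by move=> s _; exact: (f0 (s, w)).
  - by move=> s _; apply: mule_ge0; [rewrite lee_fin|exact: eV0].
  apply: leeD => //.
  rewrite (leb_integralZl mD (S _ meV) _ k0); last by move=> s _; exact: eV0.
  apply: lee_wpmul2l; first by rewrite lee_fin.
  apply: (le_trans (weighted_time_integral T l0 mqq qq0)).
  apply: lee_wpmul2l; first by rewrite lee_fin invr_ge0 ltW.
  rewrite JE// JE//.
  have meq z : continuous_paths z -> measurable_fun [set: R] (fun s => (expR (- (l * s)))%:E * q z (s, w))%E.
    by move=> cz; apply: emeasurable_funM; [exact: mexp|exact: mqw].
  rewrite -(leb_integralD mD (S _ (meq x cx)) _ (S _ (meq y cy))); last 2 first.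
  - by move=> s _; rewrite mule_ge0.
  - by move=> s _; rewrite mule_ge0.
  apply: leb_le_integral => s _; first by rewrite mule_ge0.
  by rewrite ge0_muleDr// lexx.
have Jx := J_fin w cx; have Jy := J_fin w cy.
have [jx Jxr] : exists r, J x w = r%:E
  by exists (fine (J x w)); apply/esym/fineK; rewrite ge0_fin_numE; [exact: Jx|exact: J0].
have [jy Jyr] : exists r, J y w = r%:E
  by exists (fine (J y w)); apply/esym/fineK; rewrite ge0_fin_numE; [exact: Jy|exact: J0].
have jx0 : 0 <= jx by rewrite -lee_fin -Jxr.
have jy0 : 0 <= jy by rewrite -lee_fin -Jyr.
move: J1; rewrite Jxr Jyr; have := a0 w; case: (a w) => [r| |] // r0; last first.
  by rewrite gt0_muley ?lte_fin// addye// leey.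
rewrite -EFinD -!EFinM -!EFinD !lee_fin => J1.
have kl : k * l^-1 <= 4^-1 by rewrite ler_pdivrMr// /l; lra.
have : k * (l^-1 * (jx + jy)) <= 4^-1 * (jx + jy).
  by rewrite mulrA ler_wpM2r// addr_ge0.
have : 0 <= r by rewrite -lee_fin.
lra.
Qed.

Let mean_f t : 0 <= t <= T -> (\int[P]_w (f t w)%:E <= (4 * (A + A + c0 ^+ 2))%:E)%E.
Proof.
move=> t_in; have mBt : measurable_fun [set: U] (fun w => B t w) by exact: (measurable_fun_pair2 t mB).
have -> : 4 * (A + A + c0 ^+ 2) = 4 * c0 ^+ 2 + 4 * A + 4 * A + 0 * A + 0 * A by ring.
have c40 : 0 <= 4 * c0 ^+ 2 by rewrite mulr_ge0// sqr_ge0.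
have p4 : 0 <= 4 :> R by [].
apply: (expectation_le_squares mxi mBt mxi mxi c40 p4 p4 (lexx 0) (lexx 0) e_xi (e_B t_in) e_xi e_xi).
move=> w; rewrite -lee_fin (f0 (t, w))/= /f !mul0r !addr0.
by rewrite le_eqVlt; apply/orP; left; apply/eqP; ring.
Qed.

Let energy : (\int[P]_w J x w <= (2 * (2 * (T * (4 * (A + A + c0 ^+ 2)))))%:E)%E.
Proof.
have m2a : measurable_fun [set: U] (fun w => 2%:E * a w)%E by apply: emeasurable_funM.
apply: (contraction_same_law (P := P) (mJ x) (mJ y) m2a).
- exact: J0.
- by move=> w; rewrite J0 J_fin.
- by move=> w; rewrite mule_ge0.
- move=> psi mpsi psi0.
  apply: (same_law_integral (X := sample_path x) (Y := sample_path y)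
    (f := psi \o weighted_energy l T) xy).
    exact: (measurableT_comp mpsi (measurable_weighted_energy l T)).
  by move=> p; exact: psi0.
- exact: J_bound.
have t20 : 0 <= 2 :> R by [].
rewrite (ge0_integralZl_EFin P measurableT (fun w _ => a0 w) ma t20) [leRHS]EFinM.
apply: lee_wpmul2l; first by rewrite lee_fin.
rewrite /a (tonelli_time P T mf f0).
apply: (@le_trans _ _ (\int[leb]_(s in `[0%R, T]) (cst (4 * (A + A + c0 ^+ 2))%:E s))%E).
  apply: leb_le_integral => s; first by move=> _; apply: integral_ge0 => w _; exact: (f0 (s, w)).
  rewrite /= in_itv/= => s_in.
  exact: mean_f.
have mD : measurable (`[0, T]%classic : set R) by exact: measurable_itv.
have := integral_cst leb mD (4 * (A + A + c0 ^+ 2))%:E => ->.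
rewrite [leLHS]muleC [leRHS]EFinM; apply: lee_wpmul2r; last exact: (lebesgue_measure_0t (ltW T0)).
have A0 : 0 <= A by rewrite -lee_fin; apply: le_trans e_xi; apply: integral_ge0 => w _; rewrite lee_fin sqr_ge0.
by rewrite lee_fin mulr_ge0// !addr_ge0// sqr_ge0.
Qed.

(** The square of the equation, integrated against exp(- l s), bounds the energy of
    x by a term of finite mean plus half the energy of y. The energies of x and y
    have the same law, since they are the same functional of the paths, and are
    finite since the paths are continuous; [contraction_same_law] bounds their
    mean. Back in the equation, this bounds the second moment at each time. *)
Lemma uniform_second_moment : exists M, 0 <= M /\
  forall t, 0 <= t <= T -> (\int[P]_w (x t w ^+ 2)%:E <= M%:E)%E.
Proof.
have en := energy; set Q := 2 * (2 * (T * (4 * (A + A + c0 ^+ 2)))) in en.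
have A0 : 0 <= A by rewrite -lee_fin; apply: le_trans e_xi; apply: integral_ge0 => w _; rewrite lee_fin sqr_ge0.
have Q0 : 0 <= Q by rewrite /Q !mulr_ge0// ?(ltW T0)// !addr_ge0// sqr_ge0.
exists (4 * (A + A + c0 ^+ 2) + k * (expR (l * T) * (Q + Q))); split.
  have AAc : 0 <= A + A + c0 ^+ 2 by rewrite !addr_ge0// sqr_ge0.
  have QQ : 0 <= expR (l * T) * (Q + Q) by rewrite mulr_ge0 ?expR_ge0// addr_ge0.
  by rewrite addr_ge0// mulr_ge0.
move=> t t_in; have [t0 tT] := andP t_in.
pose qq (u : R * U) := (q x u + q y u)%E.
have mqq : measurable_fun [set: R * U] qq by apply: emeasurable_funD; exact: mq.
have qq0 u : (0 <= qq u)%E by rewrite adde_ge0.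
pose V w := (\int[leb]_(s in `[0%R, t]) qq (s, w))%E.
have mV : measurable_fun [set: U] V by exact: (measurable_time_integral t mqq qq0).
have V0 w : (0 <= V w)%E by apply: integral_ge0 => s _.
have mft : measurable_fun [set: U] (fun w => (f t w)%:E) by exact: (measurable_fun_pair2 t mf).
apply: (@le_trans _ _ (\int[P]_w ((f t w)%:E + k%:E * V w))%E).
  apply: ae_ge0_le_integral_lower.
  - by move=> w; rewrite lee_fin sqr_ge0.
  - by move=> w; apply: adde_ge0; [exact: (f0 (t, w))|apply: mule_ge0; [rewrite lee_fin|exact: V0]].
  - by apply: emeasurable_funD; [exact: mft|apply: emeasurable_funM; [exact: measurable_cst|exact: mV]].
  - by apply: filterS sqr_bound => w; apply.
have kV0 w : [set: U] w -> (0 <= k%:E * V w)%E.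
  by move=> _; apply: mule_ge0; [rewrite lee_fin|exact: V0].
have mkV : measurable_fun [set: U] (fun w => k%:E * V w)%E.
  by apply: emeasurable_funM; [exact: measurable_cst|exact: mV].
rewrite (ge0_integralD P measurableT (fun w _ => f0 (t, w)) mft kV0 mkV) EFinD; apply: leeD.
  exact: mean_f.
rewrite (ge0_integralZl_EFin P measurableT (fun w _ => V0 w) mV k0) [leRHS]EFinM.
apply: lee_wpmul2l; first by rewrite lee_fin.
have Jxy : (\int[P]_w J y w = \int[P]_w J x w)%E.
  apply/esym/(same_law_integral (X := sample_path x) (Y := sample_path y) (f := weighted_energy l T) xy).
    exact: measurable_weighted_energy.
  by move=> p; apply: integral_ge0 => s _; rewrite mule_ge0// lee_fin expR_ge0.
have ex0 : 0 <= expR (l * T) by exact: expR_ge0.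
have mJJ : measurable_fun [set: U] (fun w => J x w + J y w)%E by apply: emeasurable_funD; exact: mJ.
apply: (@le_trans _ _ (\int[P]_w ((expR (l * T))%:E * (J x w + J y w)))%E).
  apply: ge0_le_integral_lower => w; first exact: V0.
  rewrite (JE w cx) (JE w cy).
  have mD : measurable (`[0, T]%classic : set R) by exact: measurable_itv.
  have mexp := measurable_exp_decay l.
  have meq z : continuous_paths z -> measurable_fun `[0, T] (fun s => (expR (- (l * s)))%:E * q z (s, w))%E.
    move=> cz; apply: measurable_funS measurableT (@subsetT _ _) _.
    by apply: emeasurable_funM; [exact: mexp|exact: (measurable_fun_pair1 w (mq cz))].
  have eq0 z s : (0 <= (expR (- (l * s)))%:E * q z (s, w))%E by rewrite mule_ge0// lee_fin expR_ge0.
  rewrite -(leb_integralD mD (meq x cx) (fun s _ => eq0 x s) (meq y cy) (fun s _ => eq0 y s)).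
  have msum : measurable_fun `[0, T] (fun s => (expR (- (l * s)))%:E * q x (s, w) + (expR (- (l * s)))%:E * q y (s, w))%E.
    by apply: emeasurable_funD; [exact: meq|exact: meq].
  rewrite -(leb_integralZl mD msum _ ex0); last by move=> s _; rewrite adde_ge0.
  rewrite /V integral_mkcond [leRHS]integral_mkcond; apply: leb_le_integral => s _.
    by rewrite /patch; case: ifP.
  rewrite /patch !mem_setE !in_itv/=.
  have [/andP[s0 st]|_] := boolP (0 <= s <= t); last first.
    case: ifP => _; last exact: lexx.
    by apply: mule_ge0; [rewrite lee_fin|exact: (adde_ge0 (eq0 x s) (eq0 y s))].
  rewrite s0 (le_trans st tT)/= -(ge0_muleDr _ (q0 x (s, w)) (q0 y (s, w))) muleA -EFinM -expRD.
  have r0 : 0 <= xp x s w ^+ 2 + xp y s w ^+ 2 by rewrite addr_ge0 ?sqr_ge0.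
  have r1 : 1 <= expR (l * T - l * s).
    rewrite -expR0 ler_expR subr_ge0; exact: (ler_wpM2l (ltW l0) (le_trans st tT)).
  rewrite lee_fin; exact: (ler_peMl r0 r1).
have JJ0 w : [set: U] w -> (0 <= J x w + J y w)%E by rewrite adde_ge0.
rewrite (ge0_integralZl_EFin P measurableT JJ0 mJJ ex0) [leRHS]EFinM.
apply: lee_wpmul2l; first by rewrite lee_fin.
rewrite (ge0_integralD P measurableT (fun w _ => J0 x w) (mJ x) (fun w _ => J0 y w) (mJ y)) Jxy EFinD.
by apply: leeD; exact: en.
Qed.

End second_moment.

(** * Drifts integrated against mixtures and empirical measures *)

Section measure_functionals.
Variable R : realType.
Notation M := ({measure set R -> \bar R}).

Lemma ge0_integral_mixture (u : {i01 R}) (mu nu : M) (f : R -> \bar R) :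
  measurable_fun [set: R] f -> (forall y, 0 <= f y)%E ->
  (\int[mixture u mu nu]_y f y =
   (u%:num)%:E * \int[mu]_y f y + (1 - u%:num)%:E * \int[nu]_y f y)%E.
Proof.
move=> mf f0; rewrite /mixture ge0_integral_measure_add//.
by congr (_ + _)%E; rewrite ge0_integral_mscale.
Qed.

(** The coefficient 0 is included: it makes the products finite even if a or b is
    infinite. *)
Lemma fine_scaled_sub (c : R) (a b : \bar R) : 0 <= c -> (0 <= a)%E -> (0 <= b)%E ->
  (c%:E * a < +oo)%E -> (c%:E * b < +oo)%E ->
  [/\ (c%:E * a)%E \is a fin_num, (c%:E * b)%E \is a fin_num &
   fine (c%:E * a) - fine (c%:E * b) = c * fine (a - b)].
Proof.
rewrite le_eqVlt => /predU1P[<-|c0] a0 b0 la lb.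
  by rewrite !mul0e/= mul0r subr0.
have fa x : (0 <= x)%E -> (c%:E * x < +oo)%E -> exists r, x = r%:E.
  case: x => [r| |]//; first by exists r.
  by rewrite gt0_muley ?lte_fin.
have [r ->] := fa _ a0 la; have [s ->] := fa _ b0 lb.
by split=> //=; rewrite -mulrBr.
Qed.

Lemma i01_compl_ge0 (u : {i01 R}) : 0 <= 1 - u%:num.
Proof. by rewrite subr_ge0 le1. Qed.

(** When u is 0 or 1, f may fail to be integrable for the measure of weight 0. *)
Lemma Rintegral_mixture (u : {i01 R}) (mu nu : M) (f : R -> R) :
  measurable_fun [set: R] f ->
  (mixture u mu nu).-integrable [set: R] (EFin \o f) ->
  \int[mixture u mu nu]_y f y =
    u%:num * \int[mu]_y f y + (1 - u%:num) * \int[nu]_y f y.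
Proof.
move=> mf /integrableP[_ fi].
have mF : measurable_fun [set: R] (EFin \o f) by exact/measurable_EFinP.
have v0 := i01_compl_ge0 u.
have bnd (h : R -> \bar R) : measurable_fun [set: R] h -> (forall y, 0 <= h y)%E ->
    (forall y, h y <= `|(EFin \o f) y|)%E ->
    ((u%:num)%:E * \int[mu]_y h y < +oo /\ (1 - u%:num)%:E * \int[nu]_y h y < +oo)%E.
  move=> mh h0 hf.
  have : (\int[mixture u mu nu]_y h y < +oo)%E.
    by apply: le_lt_trans fi; exact: ge0_le_integral_lower.
  rewrite ge0_integral_mixture// => lt.
  have p1 : (0 <= (u%:num)%:E * \int[mu]_y h y)%E by rewrite mule_ge0 ?lee_fin ?integral_ge0.
  have p2 : (0 <= (1 - u%:num)%:E * \int[nu]_y h y)%E.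
    by apply: mule_ge0; [rewrite lee_fin | exact: integral_ge0].
  by split; apply: le_lt_trans lt; [exact: leeDl | exact: leeDr].
have mp : measurable_fun [set: R] ((EFin \o f) ^\+)%E by exact: measurable_funepos.
have mn : measurable_fun [set: R] ((EFin \o f) ^\-)%E by exact: measurable_funeneg.
have abE y : (`|(EFin \o f) y| = (EFin \o f)^\+ y + (EFin \o f)^\- y)%E.
  by rewrite -[LHS]/((abse \o (EFin \o f)) y) fune_abse.
have [p1 p2] : ((u%:num)%:E * \int[mu]_y (EFin \o f)^\+ y < +oo /\
    (1 - u%:num)%:E * \int[nu]_y (EFin \o f)^\+ y < +oo)%E.
  apply: bnd => // y; rewrite abE; apply: leeDl; exact: funeneg_ge0.
have [n1 n2] : ((u%:num)%:E * \int[mu]_y (EFin \o f)^\- y < +oo /\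
    (1 - u%:num)%:E * \int[nu]_y (EFin \o f)^\- y < +oo)%E.
  apply: bnd => // y; rewrite abE; apply: leeDr; exact: funepos_ge0.
have i0 (m : M) (h : R -> \bar R) : (forall y, 0 <= h y)%E -> (0 <= \int[m]_y h y)%E.
  by move=> h0; exact: integral_ge0.
have u0 : 0 <= u%:num :> R by [].
have [f1 f2 E1] := fine_scaled_sub u0 (i0 mu _ (@funepos_ge0 _ _ (EFin \o f)))
  (i0 mu _ (@funeneg_ge0 _ _ (EFin \o f))) p1 n1.
have [f3 f4 E2] := fine_scaled_sub v0 (i0 nu _ (@funepos_ge0 _ _ (EFin \o f)))
  (i0 nu _ (@funeneg_ge0 _ _ (EFin \o f))) p2 n2.
have EP := ge0_integral_mixture u mu nu mp (@funepos_ge0 _ _ (EFin \o f)).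
have EN := ge0_integral_mixture u mu nu mn (@funeneg_ge0 _ _ (EFin \o f)).
have RE (m : M) : \int[m]_y f y =
    fine (\int[m]_y (EFin \o f)^\+ y - \int[m]_y (EFin \o f)^\- y)%E.
  by rewrite /Rintegral integralE.
rewrite !RE -E1 -E2 EP EN fineB ?fin_numD ?f1 ?f2 ?f3 ?f4//= fineD// fineD//.
by rewrite opprD addrACA.
Qed.

Lemma integrable_mixture_right (u : {i01 R}) (mu nu : M) (f : R -> R) :
  measurable_fun [set: R] f -> u%:num != 1 :> R ->
  (mixture u mu nu).-integrable [set: R] (EFin \o f) ->
  nu.-integrable [set: R] (EFin \o f).
Proof.
move=> mf u1 /integrableP[_ fi].
have mF : measurable_fun [set: R] (EFin \o f) by exact/measurable_EFinP.
apply/integrableP; split=> //.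
have v0 : 0 < 1 - u%:num :> R.
  by rewrite lt_neqAle i01_compl_ge0 andbT eq_sym subr_eq0 eq_sym.
move: fi; rewrite ge0_integral_mixture//; last exact: measurableT_comp.
move=> lt.
have : ((1 - u%:num)%:E * \int[nu]_y `|(EFin \o f) y| < +oo)%E.
  apply: le_lt_trans lt; apply: leeDr; apply: mule_ge0; first by rewrite lee_fin.
  exact: integral_ge0.
have : (0 <= \int[nu]_y `|(EFin \o f) y|)%E by exact: integral_ge0.
case: (\int[nu]_y `|(EFin \o f) y|)%E => [r _ _| |//]; first exact: ltry.
by rewrite gt0_muley ?lte_fin.
Qed.

Lemma Rintegral_dirac (a : R) (f : R -> R) : measurable_fun [set: R] f ->
  \int[\d_a]_y f y = f a.
Proof.
move=> mf; rewrite /Rintegral integral_dirac//; last exact/measurable_EFinP.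
by rewrite diracT mul1e.
Qed.

Lemma Rintegral_empirical (n : nat) (x : nat -> R) (f : R -> R) :
  measurable_fun [set: R] f ->
  \int[empirical_measure n x]_y f y = n%:R^-1 * \sum_(1 <= j < n.+1) f (x j).
Proof.
move=> mf.
have mF : measurable_fun [set: R] (EFin \o f) by exact/measurable_EFinP.
have ge0E (h : R -> R) : measurable_fun [set: R] h -> (forall y, 0 <= h y) ->
    (\int[empirical_measure n x]_y (h y)%:E = (n%:R^-1 * \sum_(1 <= j < n.+1) h (x j))%:E)%E.
  move=> mh h0.
  have mH : measurable_fun [set: R] (EFin \o h) by exact/measurable_EFinP.
  rewrite ge0_integral_mscale//; last by move=> y _; rewrite lee_fin.
  rewrite ge0_integral_measure_sum//; last by move=> y _; rewrite lee_fin.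
  rewrite EFinM -sumEFin big_add1 big_mkord/=; congr (_ * _)%E.
  by apply: eq_bigr => j _; rewrite integral_dirac// diracT mul1e.
have E1 := ge0E _ (measurable_funrpos mf) (@funrpos_ge0 _ _ f).
have E2 := ge0E _ (measurable_funrneg mf) (@funrneg_ge0 _ _ f).
have -> : \int[empirical_measure n x]_y f y =
    fine (\int[empirical_measure n x]_y (f^\+ y)%:E - \int[empirical_measure n x]_y (f^\- y)%:E)%E.
  rewrite /Rintegral integralE; congr (fine (_ - _))%E.
    by apply: eq_integral => y _; rewrite /= funeposE /funrpos EFin_max.
  by apply: eq_integral => y _; rewrite /= funenegE /funrneg EFin_max.
rewrite E1 E2/= -mulrBr -sumrB; congr (_ * _); apply: eq_bigr => j _.
by rewrite -[in RHS](funrposBneg f).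
Qed.

Lemma integrable_empirical (n : nat) (x : nat -> R) (f : R -> R) :
  measurable_fun [set: R] f ->
  (empirical_measure n x).-integrable [set: R] (EFin \o f).
Proof.
move=> mf; apply/integrableP; split; first exact/measurable_EFinP.
have mH : measurable_fun [set: R] (fun y => `|(EFin \o f) y|)%E.
  by apply: measurableT_comp => //; exact/measurable_EFinP.
rewrite ge0_integral_mscale// ge0_integral_measure_sum//.
rewrite (eq_bigr (fun j : 'I_n => (`|f (x j.+1)|)%:E)); first by rewrite sumEFin -EFinM ltry.
by move=> j _; rewrite integral_dirac// diracT mul1e.
Qed.

End measure_functionals.

(** * The drift of the limiting chain *)

Section transfer.
Context d (U : measurableType d) (R : realType) (P : probability U R).

Lemma EFin_Rintegral_integrable (f : U -> R) : P.-integrable [set: U] (EFin \o f) ->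
  (\int[P]_w f w)%:E = (\int[P]_w (f w)%:E)%E.
Proof. by move=> fi; rewrite /Rintegral fineK// integrable_fin_num. Qed.

Lemma measurable_param_Rintegral d' (S : measurableType d') (f : S * U -> R) :
  measurable_fun [set: S * U] f ->
  measurable_fun [set: S] (fun x => \int[P]_w f (x, w)).
Proof.
move=> mf; have mF : measurable_fun [set: S * U] (EFin \o f) by exact/measurable_EFinP.
have E : (fun x => \int[P]_w f (x, w)) = (fun x =>
    fine (\int[P]_w ((EFin \o f)^\+ (x, w)) - \int[P]_w ((EFin \o f)^\- (x, w)))%E).
  apply/funext => x; rewrite /Rintegral integralE; congr (fine (_ - _))%E.
    by apply: eq_integral => w _; rewrite !funeposE.
  by apply: eq_integral => w _; rewrite !funenegE.
rewrite E; apply: (@measurableT_comp _ _ _ _ _ _ (fine : \bar R -> R)) => //.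
apply: emeasurable_funB.
  exact: (measurable_fun_fubini_tonelli_F (m2 := P) _ (measurable_funepos mF) (@funepos_ge0 _ _ (EFin \o f))).
exact: (measurable_fun_fubini_tonelli_F (m2 := P) _ (measurable_funeneg mF) (@funeneg_ge0 _ _ (EFin \o f))).
Qed.

Lemma Rintegral_distribution (Z : {mfun U >-> R}) (f : R -> R) :
  measurable_fun [set: R] f ->
  \int[distribution P Z]_y f y = \int[P]_w f (Z w).
Proof.
move=> mf; have mF : measurable_fun [set: R] (EFin \o f) by exact/measurable_EFinP.
rewrite /Rintegral integralE [in RHS]integralE; congr (fine (_ - _))%E.
  rewrite [LHS](ge0_integral_distribution (P := P) Z (measurable_funepos mF) (@funepos_ge0 _ _ (EFin \o f))).
  by apply: eq_integral => w _; rewrite /= !funeposE.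
rewrite [LHS](ge0_integral_distribution (P := P) Z (measurable_funeneg mF) (@funeneg_ge0 _ _ (EFin \o f))).
by apply: eq_integral => w _; rewrite /= !funenegE.
Qed.

Lemma same_path_law_marginal (X Y : process U R) t : 0 <= t ->
  same_law (path_law P X) (path_law P Y) ->
  same_law (distribution P (X t)) (distribution P (Y t)).
Proof.
move=> t0 XY A mA.
have := XY [set p : path_space R | A (p t)].
apply; apply: sub_gen_smallest; exists t, A; split=> //.
Qed.

Lemma same_law_Rintegral (Z Y : {mfun U >-> R}) (f : R -> R) :
  same_law (distribution P Z) (distribution P Y) -> measurable_fun [set: R] f ->
  \int[P]_w f (Z w) = \int[P]_w f (Y w).
Proof.
move=> ZY mf; rewrite -!Rintegral_distribution// /Rintegral; congr fine.
by apply: eq_measure_integral => A mA _; exact: ZY.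
Qed.

End transfer.

Section chain_drift.
Context d (U : measurableType d) (R : realType) (P : probability U R).
Local Notation leb := (@lebesgue_measure R).
Variables (u : {i01 R}) (bt : R -> R -> R -> R) (Y : process U R).

(** The integral of the drift against the law of Y at time s. Times are cut off at 0
    in order to have a measurable function on the whole plane. *)
Definition mean_drift (s x : R) : R :=
  \int[P]_w bt (Num.max s 0) x (Y (Num.max s 0) w).

(** As all links of the chain have the law of Y, their drift is this function of the
    time, the link and its neighbour. *)
Definition chain_drift (s x y : R) : R :=
  u%:num * bt (Num.max s 0) x y + (1 - u%:num) * mean_drift s x.

(** The contribution of a particle at y to the difference between the empirical
    part and the mean-field part of the drift at x. *)
Definition drift_fluctuation (s x y : R) : R :=
  (1 - u%:num) * (bt (Num.max s 0) x y - mean_drift s x).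

Hypothesis cY : continuous_paths Y.
Hypothesis bt_meas : measurable_fun
  [set z : R * R * R | 0 <= z.1.1] (fun z : R * R * R => bt z.1.1 z.1.2 z.2).

Lemma measurable_nonneg_time : measurable_fun [set: R * R * R]
  (fun z : R * R * R => bt (Num.max z.1.1 0) z.1.2 z.2).
Proof.
have mD : measurable [set z : R * R * R | 0 <= z.1.1].
  have mf : measurable_fun [set: R * R * R] (fun z : R * R * R => z.1.1).
    by apply: measurableT_comp => //; exact: measurable_fst.
  rewrite [X in measurable X](_ : _ = (fun z : R * R * R => z.1.1) @^-1` `[0, +oo[); last first.
    by apply/seteqP; split=> z /=; rewrite in_itv/= andbT.
  by rewrite -[X in measurable X]setTI; exact: mf.
apply: (measurable_comp mD _ bt_meas (g := fun z : R * R * R => (Num.max z.1.1 0, z.1.2, z.2))).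
  by move=> _ [z _ <-]/=; rewrite le_max lexx orbT.
apply: measurable_fun_pair; last exact: measurable_snd.
apply: measurable_fun_pair; last first.
  exact: (measurableT_comp measurable_snd measurable_fst).
apply: measurable_maxr; last exact: measurable_cst.
exact: (measurableT_comp measurable_fst measurable_fst).
Qed.

Lemma measurable_bt_comp d' (S : measurableType d') (a b c : S -> R) :
  measurable_fun [set: S] a -> measurable_fun [set: S] b -> measurable_fun [set: S] c ->
  measurable_fun [set: S] (fun z => bt (Num.max (a z) 0) (b z) (c z)).
Proof.
move=> ma mb mc.
apply: (@measurableT_comp _ _ _ _ _ _ (fun z : R * R * R => bt (Num.max z.1.1 0) z.1.2 z.2) _
  (fun z => (a z, b z, c z))); first exact: measurable_nonneg_time.
by do 2 (apply: measurable_fun_pair => //).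
Qed.

Lemma measurable_mean_drift :
  measurable_fun [set: R * R] (fun z : R * R => mean_drift z.1 z.2).
Proof.
apply: (measurable_param_Rintegral P (f := fun z : R * R * U =>
  bt (Num.max z.1.1 0) z.1.2 (Y (Num.max z.1.1 0) z.2))).
apply: measurable_bt_comp.
- exact: (measurableT_comp measurable_fst measurable_fst).
- exact: (measurableT_comp measurable_snd measurable_fst).
apply: (@measurableT_comp _ _ _ _ _ _ (fun z : R * U => Y (Num.max z.1 0) z.2) _
  (fun z : R * R * U => (z.1.1, z.2))).
  exact: (measurable_continuous_process (x := fun t w => Y t w) (fun t _ => measurable_funP (Y t)) cY).
apply: measurable_fun_pair; last exact: measurable_snd.
exact: (measurableT_comp measurable_fst measurable_fst).
Qed.

Let measurable_mean_comp : measurable_fun [set: R * R * R] (fun z : R * R * R => mean_drift z.1.1 z.1.2).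
Proof.
apply: (@measurableT_comp _ _ _ _ _ _ (fun z : R * R => mean_drift z.1 z.2) _
  (fun z : R * R * R => z.1)); [exact: measurable_mean_drift|exact: measurable_fst].
Qed.

Lemma measurable_chain_drift :
  measurable_fun [set: R * R * R] (fun z : R * R * R => chain_drift z.1.1 z.1.2 z.2).
Proof.
by apply: measurable_funD; apply: measurable_funM => //; exact: measurable_nonneg_time.
Qed.

Lemma measurable_drift_fluctuation :
  measurable_fun [set: R * R * R] (fun z : R * R * R => drift_fluctuation z.1.1 z.1.2 z.2).
Proof.
apply: measurable_funM => //; apply: measurable_funB => //; exact: measurable_nonneg_time.
Qed.

Variables (C T : R).
Hypothesis C0 : 0 <= C.
Hypothesis bt_lip : forall t x1 x2 y1 y2 : R, 0 <= t <= T ->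
  `|bt t x1 y1 - bt t x2 y2| <= C * (`|x1 - x2| + `|y1 - y2|).
Hypothesis bt_growth : forall s x y : R, 0 <= s <= T -> `|bt s x y| <= C * (1 + `|x| + `|y|).
Hypothesis int_bt : u%:num != 1 :> R -> forall s x, 0 <= s <= T ->
  P.-integrable [set: U] (fun w => (bt s x (Y s w))%:E).

Let u0 : 0 <= u%:num :> R. Proof. by []. Qed.
Let v0 : 0 <= 1 - u%:num. Proof. exact: i01_compl_ge0. Qed.
Let maxs (s : R) : 0 <= s <= T -> Num.max s 0 = s.
Proof. by move=> /andP[s0 _]; apply/max_idPl. Qed.

(** For u = 1 the integral that defines the mean drift may diverge, hence the
    factor 1 - u, which is part of the drift anyway. *)
Lemma mean_drift_lip s x x' : 0 <= s <= T ->
  `|(1 - u%:num) * mean_drift s x - (1 - u%:num) * mean_drift s x'| <= (1 - u%:num) * (C * `|x - x'|).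
Proof.
move=> sT; have [u1|u1] := eqVneq (u%:num : R) 1.
  by rewrite u1 subrr !mul0r subrr normr0.
rewrite -mulrBr normrM ger0_norm// ler_wpM2l//.
rewrite /mean_drift (maxs sT) -RintegralB//; [|exact: int_bt..].
apply: (@le_trans _ _ (\int[P]_w `|bt s x (Y s w) - bt s x' (Y s w)|)).
  by apply: le_normr_Rintegral => //; apply: (@integrableB _ _ _ P _ _ (fun w => (bt s x (Y s w))%:E) (fun w => (bt s x' (Y s w))%:E)) => //; exact: int_bt.
rewrite -lee_fin EFin_Rintegral_integrable; last first.
  apply: (integrable_norm (f := fun w => bt s x (Y s w) - bt s x' (Y s w))).
  by apply: (@integrableB _ _ _ P _ _ (fun w => (bt s x (Y s w))%:E) (fun w => (bt s x' (Y s w))%:E)) => //; exact: int_bt.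
apply: (@le_trans _ _ (\int[P]_w (cst (C * `|x - x'|)%:E w))%E); last first.
  by rewrite integral_cst// -[X in (_ <= X)%E]mule1 lee_wpmul2l// ?lee_fin ?mulr_ge0// probability_le1.
apply: ge0_le_integral_lower => w; rewrite lee_fin//.
have := bt_lip x x' (Y s w) (Y s w) sT.
by rewrite subrr normr0 addr0.
Qed.

Lemma chain_drift_lip s x x' y y' : 0 <= s <= T ->
  `|chain_drift s x y - chain_drift s x' y'| <= C * (`|x - x'| + `|y - y'|).
Proof.
move=> sT; rewrite /chain_drift (maxs sT) opprD addrACA -mulrBr.
apply: le_trans (ler_normD _ _) _; rewrite normrM (ger0_norm u0).
have h1 := mean_drift_lip x x' sT.
have h2 := ler_wpM2l u0 (bt_lip x x' y y' sT).
apply: le_trans (lerD h2 h1) _.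
have := mulr_ge0 v0 (mulr_ge0 C0 (normr_ge0 (y - y'))).
lra.
Qed.

Lemma drift_fluctuation_lip s x x' y y' : 0 <= s <= T ->
  `|drift_fluctuation s x y - drift_fluctuation s x' y'| <= 2 * C * (`|x - x'| + `|y - y'|).
Proof.
move=> sT; rewrite /drift_fluctuation (maxs sT) !mulrBr opprB.
have -> (a b a' b' : R) : a - b + (b' - a') = (a - a') - (b - b') by lra.
apply: le_trans (ler_normB _ _) _; rewrite -mulrBr normrM (ger0_norm v0).
have h1 := mean_drift_lip x x' sT.
have h2 := ler_wpM2l v0 (bt_lip x x' y y' sT).
apply: le_trans (lerD h2 h1) _.
have a1 := mulr_ge0 u0 (mulr_ge0 C0 (normr_ge0 (y - y'))).
have a2 := mulr_ge0 u0 (mulr_ge0 C0 (normr_ge0 (x - x'))).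
have a3 := mulr_ge0 C0 (normr_ge0 (y - y')).
lra.
Qed.

Lemma centred_drift_fluctuation s x (Z : {mfun U >-> R}) : 0 <= s <= T ->
  same_law (distribution P Z) (distribution P (Y s)) ->
  (\int[P]_w (drift_fluctuation s x (Z w))%:E = 0)%E.
Proof.
move=> sT ZY; have [u1|u1] := eqVneq (u%:num : R) 1.
  rewrite /drift_fluctuation u1 subrr; under eq_integral do rewrite mul0r.
  by rewrite integral0.
have mb : measurable_fun [set: R] (fun y => bt s x y).
  have := measurable_bt_comp (measurable_cst s) (measurable_cst x) (@measurable_id _ R setT).
  by rewrite /= (maxs sT).
have intZ : P.-integrable [set: U] (fun w => (bt s x (Z w))%:E).
  have /integrableP[_] := int_bt u1 x sT.
  move=> fin; apply/integrableP; split.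
    by apply/measurable_EFinP; apply: measurableT_comp.
  rewrite (same_law_integral (f := fun y => `|(bt s x y)%:E|%E) ZY)//.
  by apply: measurableT_comp => //; exact/measurable_EFinP.
rewrite /drift_fluctuation (maxs sT) /mean_drift (maxs sT).
rewrite -(same_law_Rintegral ZY mb).
have -> : (fun w => ((1 - u%:num) * (bt s x (Z w) - \int[P]_w0 bt s x (Z w0)))%:E) =
   (fun w => (1 - u%:num)%:E * ((bt s x (Z w))%:E - (\int[P]_w0 bt s x (Z w0))%:E))%E by [].
have ic : P.-integrable [set: U] (fun w => (\int[P]_w0 bt s x (Z w0))%:E).
  by apply: finite_measure_integrable_cst.
rewrite integralZl//; last exact: integrableB.
rewrite integralB// integral_cst//= probability_setT mule1 EFin_Rintegral_integrable//.
rewrite subee ?mule0//; exact: integrable_fin_num.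
Qed.

Variable M : R.
Hypothesis M0 : 0 <= M.
Hypothesis moment : forall s, 0 <= s <= T -> (\int[P]_w (Y s w ^+ 2)%:E <= M%:E)%E.

Lemma mean_drift_growth s x : 0 <= s <= T ->
  `|mean_drift s x| <= C * (2 + M + `|x|).
Proof.
move=> sT; rewrite /mean_drift (maxs sT).
have mb : measurable_fun [set: U] (fun w => bt s x (Y s w)).
  have := measurable_bt_comp (measurable_cst s) (measurable_cst x) (measurable_funP (Y s)).
  by rewrite /= (maxs sT).
have le : (\int[P]_w (`|bt s x (Y s w)|)%:E <= (C * (2 + M + `|x|))%:E)%E.
  apply: le_trans (expectation_le_squares (f := fun w => `|bt s x (Y s w)|)
    (c0 := C * (2 + `|x|)) (c1 := C) (c2 := 0) (c3 := 0) (c4 := 0)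
    (g1 := Y s) (g2 := cst 0) (g3 := cst 0) (g4 := cst 0) (m1 := M) (m2 := 0) (m3 := 0) (m4 := 0)
    (P := P) _ _ _ _ _ _ _ _ _ _ _ _ _ _) _ => //.
  - by rewrite mulr_ge0// addr_ge0.
  - exact: moment.
  - by under eq_integral do rewrite expr0n/=; rewrite integral0.
  - by under eq_integral do rewrite expr0n/=; rewrite integral0.
  - by under eq_integral do rewrite expr0n/=; rewrite integral0.
  - move=> w; rewrite normr_ge0/=; apply: le_trans (bt_growth x (Y s w) sT) _.
    rewrite !mul0r !addr0 -mulrDr ler_wpM2l//.
    have := ler_norm_sqr (Y s w); lra.
  by rewrite lee_fin; lra.
have ib : P.-integrable [set: U] (fun w => (bt s x (Y s w))%:E).
  exact: integrable_le_real mb le.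
apply: (@le_trans _ _ (\int[P]_w `|bt s x (Y s w)|)); first exact: le_normr_Rintegral.
by rewrite -lee_fin EFin_Rintegral_integrable//; exact: (integrable_norm (f := fun w => bt s x (Y s w))).
Qed.

Lemma drift_fluctuation_growth s x y : 0 <= s <= T ->
  `|drift_fluctuation s x y| <= (3 + M) * C * (1 + `|x| + `|y|).
Proof.
move=> sT; rewrite /drift_fluctuation (maxs sT) normrM ger0_norm//.
have h1 := mean_drift_growth x sT.
have h2 := bt_growth x y sT.
have h3 := ler_normB (bt s x y) (mean_drift s x).
apply: (@le_trans _ _ (1 * `|bt s x y - mean_drift s x|)).
  by apply: ler_wpM2r => //; have := u0; lra.
rewrite mul1r; apply: le_trans h3 _; apply: le_trans (lerD h2 h1) _.
have : 0 <= C * M * `|x| by rewrite !mulr_ge0.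
have : 0 <= C * M * `|y| by rewrite !mulr_ge0.
have : 0 <= C * `|x| by rewrite !mulr_ge0.
have : 0 <= C * `|y| by rewrite !mulr_ge0.
lra.
Qed.

End chain_drift.

Section chain_equation.
Context d (U : measurableType d) (R : realType) (P : probability U R).
Local Notation leb := (@lebesgue_measure R).
Variables (u : {i01 R}) (bt : R -> R -> R -> R) (Y : process U R).
Hypothesis cY : continuous_paths Y.
Hypothesis bt_meas : measurable_fun
  [set z : R * R * R | 0 <= z.1.1] (fun z : R * R * R => bt z.1.1 z.1.2 z.2).

Lemma measurable_section s x : 0 <= s -> measurable_fun [set: R] (fun y => bt s x y).
Proof.
move=> s0.
have := measurable_bt_comp bt_meas (measurable_cst s) (measurable_cst x) (@measurable_id _ R setT).
by rewrite /=; move/max_idPl: s0 => ->.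
Qed.

Lemma empirical_driftE s x y n (X : nat -> R) : 0 <= s ->
  drift bt s x (mixture u \d_y (empirical_measure n X)) =
  u%:num * bt s x y + (1 - u%:num) * (n%:R^-1 * \sum_(1 <= j < n.+1) bt s x (X j)).
Proof.
move=> s0; have mb := measurable_section x s0.
rewrite /drift Rintegral_mixture//; last first.
  apply/integrableP; split; first exact/measurable_EFinP.
  have ma : measurable_fun [set: R] (fun y => `|(EFin \o bt s x) y|)%E.
    by apply: measurableT_comp => //; exact/measurable_EFinP.
  rewrite ge0_integral_mixture//.
  have /integrableP[_ e] := integrable_empirical n X mb.
  rewrite integral_dirac// diracT mul1e.
  by apply: lte_add_pinfty; apply: lte_mul_pinfty => //; rewrite ?lee_fin ?i01_compl_ge0// ltry.
by rewrite Rintegral_dirac// Rintegral_empirical.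
Qed.

Lemma chain_driftE s x y (Z : {mfun U >-> R}) : 0 <= s ->
  same_law (distribution P Z) (distribution P (Y s)) ->
  (mixture u \d_y (distribution P Z)).-integrable [set: R] (fun y => (bt s x y)%:E) ->
  drift bt s x (mixture u \d_y (distribution P Z)) = chain_drift P u bt Y s x y.
Proof.
move=> s0 ZY fi; have mb := measurable_section x s0.
rewrite /drift Rintegral_mixture// Rintegral_dirac// Rintegral_distribution//.
by rewrite (same_law_Rintegral ZY mb) /chain_drift /mean_drift (max_idPl s0).
Qed.

Lemma ae_nonempty (Q : U -> Prop) : {ae P, forall w, Q w} -> exists w, Q w.
Proof.
move=> [N [mN PN sub]]; apply: contrapT => /forallNP nQ.
have : P N = 1%E.
  rewrite -(@probability_setT _ _ _ P); congr (P _); apply/seteqP; split=> // w _.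
  by apply: sub; exact: nQ.
by rewrite PN => /eqP; rewrite eq_sym onee_eq0.
Qed.

Lemma chain_sdeE (X Z B : process U R) :
  same_law (path_law P X) (path_law P Y) ->
  solves_chain_sde P bt u X Z B ->
  {ae P, forall w, forall t, 0 <= t ->
    leb.-integrable `[0, t] (EFin \o (fun s => chain_drift P u bt Y s (X s w) (Z s w))) /\
    X t w = X 0 w + \int[leb]_(s in `[0, t]) chain_drift P u bt Y s (X s w) (Z s w) + B t w}.
Proof.
move=> XY; apply: filterS => w H t t0; have [_ fi E] := H t t0.
have dE s : s \in `[0, t] -> drift bt s (X s w) (mixture u \d_(Z s w) (distribution P (X s))) =
    chain_drift P u bt Y s (X s w) (Z s w).
  rewrite in_itv/= => /andP[s0 _]; have [f1 _ _] := H s s0.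
  by apply: chain_driftE => //; exact: same_path_law_marginal.
split.
  apply: eq_integrable fi => //= s; rewrite inE/= => st; congr EFin; exact: dE.
rewrite {}E; congr (_ + _ + _); apply: eq_Rintegral => s; rewrite inE/= => st; exact: dE.
Qed.

Variables (C T : R).
Hypotheses (C0 : 0 <= C) (T0 : 0 < T).
Hypothesis bt_lip : forall t x1 x2 y1 y2 : R, 0 <= t <= T ->
  `|bt t x1 y1 - bt t x2 y2| <= C * (`|x1 - x2| + `|y1 - y2|).
Variables (Z B : process U R).
Hypothesis cZ : continuous_paths Z.
Hypothesis YZ : same_law (path_law P Y) (path_law P Z).
Hypothesis sde : solves_chain_sde P bt u Y Z B.

(** The equation contains the integrability of b(s, X_s(w), .) along the path of a
    single w. By the Lipschitz bound it holds at every point. *)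
Lemma chain_integrable_section : u%:num != 1 :> R -> forall s x, 0 <= s <= T ->
  P.-integrable [set: U] (fun w => (bt s x (Y s w))%:E).
Proof.
move=> u1 s x sT; have /andP[s0 _] := sT.
have [w H] := ae_nonempty sde; have [fi _ _] := H s s0.
have mb x' := measurable_section x' s0.
have /integrableP[_ fin] := integrable_mixture_right (mb (Y s w)) u1 fi.
have mbY x' : measurable_fun [set: U] (fun w => bt s x' (Y s w)).
  exact: (measurableT_comp (mb x') (measurable_funP (Y s))).
have iP : P.-integrable [set: U] (fun w' => (bt s (Y s w) (Y s w'))%:E).
  apply/integrableP; split; first exact/measurable_EFinP.
  move: fin; rewrite (ge0_integral_distribution (P := P) (Y s))//.
  by apply: measurableT_comp => //; exact/measurable_EFinP.
apply: (@le_integrable _ _ _ P _ measurableT _ (fun w' => (`|bt s (Y s w) (Y s w')| + C * `|x - Y s w|)%:E)).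
- exact/measurable_EFinP.
- move=> w' _; rewrite /= lee_fin.
  have := bt_lip x (Y s w) (Y s w') (Y s w') sT; rewrite subrr normr0 addr0 => h.
  rewrite [leRHS]ger0_norm ?addr_ge0 ?mulr_ge0//.
  by rewrite addrC -lerBlDr; apply: le_trans h; exact: lerB_dist.
- apply: (@integrableD _ _ _ P _ _ (fun w' => (`|bt s (Y s w) (Y s w')|)%:E) (fun w' => (C * `|x - Y s w|)%:E)) => //.
    exact: (integrable_norm (f := fun w' => bt s (Y s w) (Y s w'))).
  exact: finite_measure_integrable_cst.
Qed.

Hypothesis bm : brownian_motion P B.
Hypothesis init : exists A : R, (\int[P]_w (Y 0 w ^+ 2)%:E <= A%:E)%E.

(** To apply [uniform_second_moment], one needs that the drift at the origin has a
    finite time integral. This is true because the drift is integrable along one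
    continuous path, and differs from the drift at the origin by at most a multiple
    of the size of that path. *)
Lemma chain_second_moment : exists M : R, 0 <= M /\
  forall t, 0 <= t <= T -> (\int[P]_w (Y t w ^+ 2)%:E <= M%:E)%E.
Proof.
have sde' := chain_sdeE (fun A _ => erefl) sde.
have lip := chain_drift_lip C0 bt_lip chain_integrable_section.
have T00 : 0 <= T by exact: ltW.
have int_path (X : process U R) w t : continuous_paths X ->
    leb.-integrable `[0, t] (EFin \o (fun s => X s w)).
  move=> cX; apply: (continuous_compact_integrable (@segment_compact _ 0 t)).
  by apply: continuous_subspaceW (cX w) => s; rewrite /= !in_itv/= => /andP[-> _//].
have [c0 c0P] : exists c0 : R, (\int[leb]_(s in `[0%R, T]) (`|chain_drift P u bt Y s 0 0|)%:E <= (`|c0|)%:E)%E.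
  have [w H] := ae_nonempty sde'; have [fi _] := H T T00.
  pose h s := `|chain_drift P u bt Y s (Y s w) (Z s w)| + C * (`|Y s w| + `|Z s w|).
  have ih : leb.-integrable `[0, T] (EFin \o h).
    apply: (@integrableD _ _ _ leb _ _ (fun s => (`|chain_drift P u bt Y s (Y s w) (Z s w)|)%:E)
      (fun s => (C * (`|Y s w| + `|Z s w|))%:E)) => //.
      exact: (integrable_norm fi).
    apply: (@integrableZl _ _ _ leb _ _ C (fun s => (`|Y s w| + `|Z s w|)%:E)) => //.
    apply: (@integrableD _ _ _ leb _ _ (fun s => (`|Y s w|)%:E) (fun s => (`|Z s w|)%:E)) => //.
      exact: (integrable_norm (int_path _ w T cY)).
    exact: (integrable_norm (int_path _ w T cZ)).
  exists (\int[leb]_(s in `[0, T]) h s).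
  have h0 s : 0 <= h s by rewrite addr_ge0// mulr_ge0// addr_ge0.
  rewrite ger0_norm; last by apply: Rintegral_ge0 => s _; exact: h0.
  rewrite /Rintegral fineK; last exact: (integrable_fin_num _ ih).
  apply: leb_le_integral => s; first by rewrite lee_fin.
  rewrite /= in_itv/= => sT; rewrite lee_fin.
  have := lip s 0 (Y s w) 0 (Z s w) sT; rewrite !sub0r !normrN => l.
  rewrite /h addrC -lerBlDr; apply: le_trans l; exact: lerB_dist.
have [A0 A0P] := init.
pose A := Num.max A0 (8 * T).
have mB : measurable_fun [set: R * U] (fun z : R * U => B (Num.max z.1 0) z.2).
  have [_ cB _ _] := bm.
  exact: (measurable_continuous_process (x := fun t w => B t w) (fun t _ => measurable_funP (B t)) cB).
apply: (@uniform_second_moment _ _ _ P Y Z (fun t w => B (Num.max t 0) w) (Y 0) C T c0 A) => //.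
- by apply: le_trans A0P _; rewrite lee_fin le_max lexx.
- move=> t /andP[t0 tT]; rewrite (max_idPl t0).
  apply: le_trans (brownian_second_moment bm t0) _.
  by rewrite lee_fin le_max ler_wpM2l ?orbT.
apply: filterS sde' => w H t tT; have /andP[t0 tT'] := tT.
have [fi ->] := H t t0; rewrite (max_idPl t0).
pose I := \int[leb]_(s in `[0, t]) chain_drift P u bt Y s (Y s w) (Z s w).
rewrite -/I.
have : `|Y 0 w + I + B t w| <= `|Y 0 w| + `|B t w| + `|I|.
  by apply: le_trans (ler_normD _ _) _; rewrite addrAC lerD2r ler_normD.
rewrite -lee_fin => /le_trans; apply.
rewrite EFinD [(_ + `|c0|)%:E]EFinD -addeA leeD2l//.
rewrite EFin_normr_Rintegral//.
apply: le_trans (le_abse_integral _ _ _) _ => //; first by case/integrableP: fi.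
apply: (@le_trans _ _ (\int[leb]_(s in `[0%R, t]) ((`|chain_drift P u bt Y s 0 0|)%:E + (C * (`|Y s w| + `|Z s w|))%:E))%E).
  apply: leb_le_integral => s; first by rewrite abse_ge0.
  rewrite /= in_itv/= => /andP[s0 st]; rewrite -EFinD lee_fin.
  have sT : 0 <= s <= T by rewrite s0 (le_trans st).
  have := lip s (Y s w) 0 (Z s w) 0 sT; rewrite !subr0 => l.
  rewrite addrC -lerBlDr; apply: le_trans l; exact: lerB_dist.
have mD (a : R) : measurable `[0, a] by [].
have mI (X : process U R) : continuous_paths X -> measurable_fun `[0, t] (fun s => X s w).
  by move=> cX; have /measurable_int/measurable_EFinP := int_path _ w t cX.
have mg : measurable_fun [set: R] (fun s => (`|chain_drift P u bt Y s 0 0|)%:E).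
  apply/measurable_EFinP/measurableT_comp => //.
  apply: (@measurableT_comp _ _ _ _ _ _ (fun z : R * R * R => chain_drift P u bt Y z.1.1 z.1.2 z.2) _
    (fun s => (s, 0, 0))); first exact: measurable_chain_drift.
  by do 2 (apply: measurable_fun_pair => //).
have mg' a : measurable_fun (`[0, a] : set (measurableTypeR R)) (fun s => (`|chain_drift P u bt Y s 0 0|)%:E).
  exact: measurable_funTS.
rewrite (leb_integralD (mD t) (mg' t)).
- apply: leeD => //; apply: le_trans c0P.
  apply: (@ge0_subset_integral _ _ _ leb _ _ (mD t) (mD T) _ (mg' T)).
    by move=> s _; rewrite lee_fin.
  by move=> s; rewrite /= !in_itv/= => /andP[-> /le_trans]; apply.
- by move=> s _; rewrite lee_fin.
- apply/measurable_EFinP; apply: measurable_funM => //.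
  by apply: measurable_funD; apply: measurableT_comp => //; exact: mI.
- by move=> s _; rewrite lee_fin mulr_ge0// addr_ge0.
Qed.
End chain_equation.

(** * Gronwall's lemma and the gap between the two drifts *)

Section gronwall.
Variable R : realType.
Local Notation leb := (@lebesgue_measure R).

(** With the weight l = 2 k + 1, [weighted_time_integral] absorbs the term k D into
    the left-hand side, which is finite by assumption. *)
Lemma gronwall_integral (k T : R) (D r : R -> \bar R) : 0 <= k -> 0 <= T ->
  measurable_fun [set: R] D -> (forall s, 0 <= D s)%E ->
  measurable_fun [set: R] r -> (forall s, 0 <= r s)%E ->
  (\int[leb]_(s in `[0%R, T]) D s < +oo)%E ->
  (forall t, (0 <= t <= T)%R -> D t <= \int[leb]_(s in `[0%R, t]) (k%:E * D s + r s))%E ->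
  (\int[leb]_(s in `[0%R, T]) (k%:E * D s + r s) <=
   (2 * k * expR ((2 * k + 1) * T) + 1)%:E * \int[leb]_(s in `[0%R, T]) r s)%E.
Proof.
move=> k0 T0 mD D0 mr r0 Dfin DH; set l := 2 * k + 1.
have l0 : 0 < l by rewrite /l ltr_wpDl// mulr_ge0.
have mI : measurable (`[0%R, T]%classic : set R) by [].
have mS (f : R -> \bar R) : measurable_fun [set: R] f ->
    measurable_fun (`[0%R, T] : set (measurableTypeR R)) f by move=> mf; exact: measurable_funTS.
pose e s : \bar R := (expR (- (l * s)))%:E.
have e0 s : (0 <= e s)%E by rewrite lee_fin expR_ge0.
have me : measurable_fun [set: R] e := measurable_exp_decay l.
have e1 s : 0 <= s -> (e s <= 1)%E.
  by move=> s0; rewrite lee_fin -expR0 ler_expR oppr_le0 mulr_ge0// ltW.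
have kD0 s : (0 <= k%:E * D s)%E by rewrite mule_ge0 ?lee_fin.
have mkD : measurable_fun [set: R] (fun s => k%:E * D s)%E by exact: measurable_funeM.
have f0 s : (0 <= k%:E * D s + r s)%E by rewrite adde_ge0.
have mf : measurable_fun [set: R] (fun s => k%:E * D s + r s)%E by exact: emeasurable_funD.
have mw (f : R -> \bar R) : measurable_fun [set: R] f -> measurable_fun [set: R] (fun s => e s * f s)%E.
  by move=> mf'; exact: emeasurable_funM.
pose J := (\int[leb]_(s in `[0%R, T]) (e s * D s))%E.
pose r1 := (\int[leb]_(s in `[0%R, T]) r s)%E.
have J0 : (0 <= J)%E by apply: integral_ge0 => s _; rewrite mule_ge0.
have r10 : (0 <= r1)%E by apply: integral_ge0 => s _; exact: r0.
have Jfin : (J < +oo)%E.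
  apply: le_lt_trans Dfin; apply: leb_le_integral => s; first by rewrite mule_ge0.
  by rewrite /= in_itv/= => /andP[s0 _]; rewrite -[leRHS]mul1e lee_wpmul2r// e1.
have JH : (J <= l^-1%:E * (k%:E * J + r1))%E.
  apply: (@le_trans _ _ (\int[leb]_(t in `[0%R, T]) (e t * \int[leb]_(s in `[0%R, t]) (k%:E * D s + r s)))%E).
    apply: leb_le_integral => t; first by rewrite mule_ge0.
    by rewrite /= in_itv/= => tT; rewrite lee_wpmul2l// DH.
  apply: le_trans (weighted_time_integral T l0 mf f0) _.
  rewrite lee_wpmul2l ?lee_fin ?invr_ge0 ?(ltW l0)//.
  rewrite -[(k%:E * J)%E](leb_integralZl mI (mS _ (mw _ mD)) _ k0); last by move=> s _; rewrite mule_ge0.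
  have mkJ : measurable_fun [set: R] (fun s => k%:E * (e s * D s))%E.
    by apply: measurable_funeM; exact: mw.
  have kJ0 s : (`[0%R, T]%classic s -> 0 <= k%:E * (e s * D s))%E.
    by move=> _; rewrite mule_ge0 ?lee_fin// mule_ge0.
  rewrite -(leb_integralD mI (mS _ mkJ) kJ0 (mS _ mr) (fun s _ => r0 s)).
  apply: leb_le_integral => s; first by rewrite mule_ge0.
  rewrite /= in_itv/= => /andP[s0 _]; rewrite ge0_muleDr//.
  by rewrite muleCA leeD2l// -[leRHS]mul1e lee_wpmul2r// e1.
have J2 : (J <= 2%:E * r1)%E.
  move: J0 r10 Jfin JH; case: J => [j| |]//; case: r1 => [q| |]//; last first.
    by move=> _ _ _ _; rewrite gt0_muley ?leey ?lte_fin ?ltr0n.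
  rewrite -EFinM !lee_fin => j0 q0 _ h'.
  have h : j <= l^-1 * (k * j + q) by rewrite -lee_fin.
  have {}h : l * j <= k * j + q by rewrite mulrC -ler_pdivlMr// mulrC.
  have : 0 <= k * j by rewrite mulr_ge0.
  by move: h; rewrite /l; lra.
have DJ : (\int[leb]_(s in `[0%R, T]) D s <= (expR (l * T))%:E * J)%E.
  rewrite -(leb_integralZl mI (mS _ (mw _ mD)) _ (expR_ge0 _)); last by move=> s _; rewrite mule_ge0.
  apply: leb_le_integral => s //.
  rewrite /= in_itv/= => /andP[s0 sT]; rewrite muleA -[leLHS]mul1e lee_wpmul2r//.
  rewrite -EFinM lee_fin -expRD -mulrBr -[leLHS]expR0 ler_expR mulr_ge0 ?(ltW l0)// subr_ge0//.
rewrite (leb_integralD mI (mS _ mkD) (fun s _ => kD0 s) (mS _ mr) (fun s _ => r0 s)).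
rewrite (leb_integralZl mI (mS _ mD) (fun s _ => D0 s) k0).
rewrite EFinD ge0_muleDl ?lee_fin ?mulr_ge0 ?expR_ge0// mul1e leeD2r//.
apply: (@le_trans _ _ (k%:E * ((expR (l * T))%:E * (2%:E * r1)))%E).
  rewrite lee_wpmul2l ?lee_fin//; apply: le_trans DJ _.
  by rewrite lee_wpmul2l ?lee_fin ?expR_ge0.
by rewrite !muleA -!EFinM (mulrC 2) [k * 2 * _]mulrAC.
Qed.

End gronwall.

Definition empirical_mean (R : realType) (n : nat) (f : nat -> R) : R :=
  n%:R^-1 * \sum_(1 <= j < n.+1) f j.

Section empirical_mean.
Variables (R : realType) (n : nat).
Implicit Types f g : nat -> R.

Lemma empirical_meanD f g :
  empirical_mean n (fun j => f j + g j) = empirical_mean n f + empirical_mean n g.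
Proof. by rewrite /empirical_mean big_split/= mulrDr. Qed.

Lemma empirical_meanB f g :
  empirical_mean n (fun j => f j - g j) = empirical_mean n f - empirical_mean n g.
Proof. by rewrite /empirical_mean -mulrBr sumrB. Qed.

Lemma empirical_meanZ (a : R) f :
  empirical_mean n (fun j => a * f j) = a * empirical_mean n f.
Proof. by rewrite /empirical_mean -mulr_sumr mulrCA. Qed.

Lemma empirical_mean_cst (a : R) : (1 <= n)%N -> empirical_mean n (fun=> a) = a.
Proof.
move=> n1; rewrite /empirical_mean sumr_const_nat subSS subn0 -[a *+ n]mulr_natl mulrA.
by rewrite mulVf ?mul1r// pnatr_eq0 -lt0n.
Qed.

Lemma ler_norm_empirical_mean f : `|empirical_mean n f| <= empirical_mean n (fun j => `|f j|).
Proof.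
rewrite /empirical_mean normrM ger0_norm ?invr_ge0// ler_wpM2l ?invr_ge0//.
exact: ler_norm_sum.
Qed.

Lemma le_empirical_mean f g : (forall j, f j <= g j) -> empirical_mean n f <= empirical_mean n g.
Proof.
by move=> fg; rewrite /empirical_mean ler_wpM2l ?invr_ge0//; apply: ler_sum => j _.
Qed.

End empirical_mean.

Section drift_gap.
Context d (U : measurableType d) (R : realType) (P : probability U R).
Variables (u : {i01 R}) (bt : R -> R -> R -> R) (Y : process U R).
Variables (C T : R).
Hypothesis C0 : 0 <= C.
Hypothesis bt_lip : forall t x1 x2 y1 y2 : R, 0 <= t <= T ->
  `|bt t x1 y1 - bt t x2 y2| <= C * (`|x1 - x2| + `|y1 - y2|).
Variables (n : nat) (s : R) (X x : nat -> R).
Hypothesis n1 : (1 <= n)%N.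
Local Notation mean := (empirical_mean n).
Local Notation dist i := (`|X i - x i|).
Local Notation noise i := (mean (fun j => drift_fluctuation P u bt Y s (x i) (x j))).

(** The law of x_i is replaced by the empirical measure of the chain at the price of
    the noise term. The two empirical drifts are then compared by the Lipschitz
    bound. *)
Lemma drift_gap i : 0 <= s <= T ->
  `|(u%:num * bt s (X i) (X i.+1) + (1 - u%:num) * mean (fun j => bt s (X i) (X j)))
    - chain_drift P u bt Y s (x i) (x i.+1)| <=
  C * (2 * dist i + dist i.+1 + mean (fun j => dist j)) + `|noise i|.
Proof.
move=> sT; have u0 : 0 <= u%:num :> R by [].
have v0 := i01_compl_ge0 u.
have s0 : Num.max s 0 = s by apply/max_idPl; case/andP: sT.
set v := 1 - u%:num in v0 *.
have nE : noise i = v * mean (fun j => bt s (x i) (x j)) - v * mean_drift P bt Y s (x i).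
  by rewrite /drift_fluctuation s0 -/v empirical_meanZ empirical_meanB empirical_mean_cst// mulrBr.
have gE : (u%:num * bt s (X i) (X i.+1) + v * mean (fun j => bt s (X i) (X j)))
    - chain_drift P u bt Y s (x i) (x i.+1) =
    u%:num * (bt s (X i) (X i.+1) - bt s (x i) (x i.+1)) +
    v * (mean (fun j => bt s (X i) (X j)) - mean (fun j => bt s (x i) (x j))) + noise i.
  rewrite nE /chain_drift s0 -/v; set a := bt s _ _; set b := mean _.
  set a' := bt s _ _; set b' := mean _; lra.
rewrite gE; apply: le_trans (ler_normD _ _) _; rewrite lerD2r.
apply: le_trans (ler_normD _ _) _; rewrite 2!normrM (ger0_norm u0) (ger0_norm v0).
have h1 : `|bt s (X i) (X i.+1) - bt s (x i) (x i.+1)| <= C * (dist i + dist i.+1).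
  exact: bt_lip.
have h2 : `|mean (fun j => bt s (X i) (X j)) - mean (fun j => bt s (x i) (x j))| <=
    C * (dist i + mean (fun j => dist j)).
  rewrite -empirical_meanB; apply: le_trans (ler_norm_empirical_mean _ _) _.
  apply: (@le_trans _ _ (mean (fun j => C * (dist i + dist j)))).
    by apply: le_empirical_mean => j; exact: bt_lip.
  by rewrite empirical_meanZ empirical_meanD empirical_mean_cst.
have v1 : v <= 1 by rewrite /v; lra.
have u1 : u%:num <= 1 by have := v0; rewrite /v; lra.
have k1 : u%:num * `|bt s (X i) (X i.+1) - bt s (x i) (x i.+1)| <= 1 * (C * (dist i + dist i.+1)).
  by apply: ler_pM.
have k2 : v * `|mean (fun j => bt s (X i) (X j)) - mean (fun j => bt s (x i) (x j))| <=
    1 * (C * (dist i + mean (fun j => dist j))).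
  by apply: ler_pM.
apply: le_trans (lerD k1 k2) _; lra.
Qed.

(** The neighbour of the last particle is the first one, whereas x_(n+1) is a new
    variable, so |X_(n+1) - x_(n+1)| is only bounded by |X_1 - x_1| up to the sizes
    of x_1 and x_(n+1). *)
Lemma sum_drift_gap : X n.+1 = X 1%N ->
  \sum_(1 <= i < n.+1) (C * (2 * dist i + dist i.+1 + mean (fun j => dist j)) + `|noise i|) <=
  4 * C * (\sum_(1 <= i < n.+1) dist i) +
  (C * (`|x 1%N| + `|x n.+1|) + \sum_(1 <= i < n.+1) `|noise i|).
Proof.
move=> XX; set D := \sum_(1 <= i < n.+1) dist i.
rewrite big_split/= addrA lerD2r -mulr_sumr !big_split/= -mulr_sumr -/D.
have -> : \sum_(1 <= i < n.+1) mean (fun j => dist j) = D.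
  rewrite sumr_const_nat subSS subn0 /empirical_mean -/D -[(_ * D) *+ n]mulr_natl mulrA.
  by rewrite mulfV ?mul1r// pnatr_eq0 -lt0n.
have -> : \sum_(1 <= i < n.+1) dist i.+1 = D - dist 1%N + dist n.+1.
  rewrite /D [in RHS]big_ltn// [dist 1%N + _]addrC addrK -big_nat_recr//=.
  by rewrite [RHS]big_add1.
have : dist n.+1 <= dist 1%N + (`|x 1%N| + `|x n.+1|).
  rewrite XX; have -> : X 1%N - x n.+1 = (X 1%N - x 1%N) + (x 1%N - x n.+1) by lra.
  by apply: le_trans (ler_normD _ _) _; rewrite lerD2l ler_normB.
move=> h1; have := ler_wpM2l C0 h1; lra.
Qed.

End drift_gap.

(** The supremum of an unbounded set is 0 by convention. *)
Lemma sup_ge0 (R : realType) (A : set R) : (forall a, A a -> 0 <= a) -> 0 <= sup A.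
Proof.
move=> A0; have [[[a Aa] ub]|nA] := pselect (has_sup A); last by rewrite sup_out.
exact: le_trans (A0 _ Aa) (ub_le_sup ub Aa).
Qed.

(** * Fluctuations of the empirical drift along the chain *)

Section particle_comparison.
Context d (U : measurableType d) (R : realType) (P : probability U R).
Local Notation leb := (@lebesgue_measure R).
Variables (u : {i01 R}) (bt : R -> R -> R -> R) (Y : process U R).
Hypothesis cY : continuous_paths Y.
Hypothesis bt_meas : measurable_fun
  [set z : R * R * R | 0 <= z.1.1] (fun z : R * R * R => bt z.1.1 z.1.2 z.2).
Variables (C T M : R).
Hypotheses (C0 : 0 <= C) (T0 : 0 < T) (M0 : 0 <= M).
Hypothesis bt_lip : forall t x1 x2 y1 y2 : R, 0 <= t <= T ->
  `|bt t x1 y1 - bt t x2 y2| <= C * (`|x1 - x2| + `|y1 - y2|).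
Hypothesis bt_growth : forall s x y : R, 0 <= s <= T -> `|bt s x y| <= C * (1 + `|x| + `|y|).
Hypothesis int_bt : u%:num != 1 :> R -> forall s x, 0 <= s <= T ->
  P.-integrable [set: U] (fun w => (bt s x (Y s w))%:E).
Hypothesis moment : forall s, 0 <= s <= T -> (\int[P]_w (Y s w ^+ 2)%:E <= M%:E)%E.
Variables (n : nat) (W x X : nat -> process U R).
Local Notation xi := (fun l => X l 0).
Hypothesis W_cont : forall i, (1 <= i)%N -> continuous_paths (W i).
Hypothesis X_indep : mutually_independent P [set i | (1 <= i <= n)%N]
  (fun i => sigma_rv [set X i 0]).
Hypothesis W_indep : mutually_independent P [set i | (1 <= i)%N]
  (fun i => sigma_process (W i)).
Hypothesis X_W_indep : independent P (sigma_rv [set X i 0 | i in [set i | (1 <= i <= n)%N]])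
  (sigma_rv [set Y | exists i (t : R), [/\ (1 <= i)%N, 0 <= t & Y = W i t]]).
Hypothesis x_cont : forall i, (1 <= i <= n.+1)%N -> continuous_paths (x i).
Hypothesis x_law : forall i, (1 <= i <= n.+1)%N -> same_law (path_law P (x i)) (path_law P Y).
Hypothesis x_sde : forall i, (1 <= i <= n)%N -> solves_chain_sde P bt u (x i) (x i.+1) (W i).
Hypothesis init : forall i, (1 <= i <= n)%N -> {ae P, forall w, X i 0 w = x i 0 w}.

(* Processes are extended to negative times, and W to the index 0, in order to be
   jointly measurable everywhere. *)
Let Wt (l : nat) (t : R) (w : U) : R := W (maxn l 1) (Num.max t 0) w.
Let xt (i : nat) (t : R) (w : U) : R := x i (Num.max t 0) w.
Let g := chain_drift P u bt Y.
Let Z K i s := picard g (fun l => X l 0 : U -> R) Wt K i s.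

(** The measurability of the Picard iterates holds over any space on which the
    drivers are measurable, in particular for the sigma-algebra of a block. *)
Lemma measurable_block_picard (A : set nat) K i s : (1 <= i)%N ->
  (forall l, (i <= l < i + K)%N -> A l) ->
  @measurable_fun _ _ (g_sigma_algebraType (block_events xi W A)) R setT (Z K i s).
Proof.
move=> i1 iA; pose V := g_sigma_algebraType (block_events xi W A).
have gen (Q : {mfun U >-> R}) : block_rv xi W A Q -> @measurable_fun _ _ V R setT Q.
  by move=> AQ _ B mB; rewrite setTI; apply: sub_gen_smallest; exists Q, B.
have mV : @measurable_fun _ _ (R * V)%type R setT (fun z : R * V => Z K i z.1 z.2).
  apply: (@measurable_picard _ V R g (fun l => xi l : V -> R) Wt).
  - exact: measurable_chain_drift.
  - by move=> l il; apply: gen; left; exists l => //; exact: iA.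
  move=> l il; have l1 : (1 <= l)%N by apply: leq_trans i1 _; case/andP: il.
  rewrite /Wt (maxn_idPl l1).
  apply: (@measurable_continuous_process _ _ V (fun t w => W l t w)).
    by move=> t t0; apply: gen; right; exists l, t; split=> //; exact: iA.
  by move=> w; exact: W_cont.
exact: (measurableT_comp mV (measurable_pair1 s)).
Qed.

Let mZ K i s : measurable_fun [set: U] (Z K i s).
Proof.
have m : measurable_fun [set: R * U] (fun z : R * U => Z K i z.1 z.2).
  apply: measurable_picard.
  - exact: measurable_chain_drift.
  - by move=> l _; exact: measurable_funP.
  move=> l _; apply: (measurable_continuous_process (x := fun t w => W (maxn l 1) t w)).
    by move=> t _; exact: measurable_funP.
  by apply: W_cont; rewrite leq_maxr.
exact: (measurableT_comp m (measurable_pair1 s)).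
Qed.

(** The block of j is disjoint from those of i and k, which are both contained in
    its complement. *)
Lemma independent_picard K i j k s :
  (1 <= i)%N -> (1 <= j)%N -> (1 <= k)%N ->
  (i + K <= n.+1)%N -> (j + K <= n.+1)%N -> (k + K <= n.+1)%N ->
  (K <= index_dist i j)%N -> (K <= index_dist j k)%N ->
  forall (A : set (R * R)) (B : set R), measurable A -> measurable B ->
  P ((fun w => (Z K i s w, Z K k s w)) @^-1` A `&` Z K j s @^-1` B) =
  (P ((fun w => (Z K i s w, Z K k s w)) @^-1` A) * P (Z K j s @^-1` B))%E.
Proof.
rewrite /index_dist => i1 j1 k1 iK jK kK ij jk A B mA mB.
pose J := [set l | (j <= l < j + K)%N].
pose I := [set l | (1 <= l <= n)%N && ~~ (j <= l < j + K)%N].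
have mj := measurable_block_picard s (A := J) j1 (fun l h => h).
have mi : @measurable_fun _ _ (g_sigma_algebraType (block_events xi W I)) R setT (Z K i s).
  by apply: measurable_block_picard => // l; rewrite /I /=; lia.
have mk : @measurable_fun _ _ (g_sigma_algebraType (block_events xi W I)) R setT (Z K k s).
  by apply: measurable_block_picard => // l; rewrite /I /=; lia.
apply: (@independent_blocks _ _ _ P n xi W X_indep W_indep X_W_indep I J).
- by move=> l; rewrite /I /= => /andP[].
- by move=> l; rewrite /J /=; lia.
- by apply/seteqP; split=> l //=; rewrite /I /J /= => -[/andP[_ /negP]].
- have := measurable_fun_pair mi mk measurableT mA.
  by rewrite setTI.
by have := mj measurableT _ mB; rewrite setTI.
Qed.

Lemma chain_moment i t : (1 <= i <= n.+1)%N -> 0 <= t <= T ->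
  (\int[P]_w (x i t w ^+ 2)%:E <= M%:E)%E.
Proof.
move=> iN tT; have /andP[t0 _] := tT.
by rewrite (same_path_law_moment t0 (x_law iN)); exact: moment.
Qed.

Lemma chain_picard_error K i s : (1 <= i)%N -> (i + K <= n.+1)%N -> 0 <= s <= T ->
  (\int[P]_w ((x i s w - Z K i s w) ^+ 2)%:E <=
   (M * expR ((16 * T * C ^+ 2 + 1) * T) * (2^-1 ^+ K) ^+ 2)%:E)%E.
Proof.
move=> i1 iK sT; have /andP[s0 _] := sT.
have xE l t : 0 <= t -> xt l t = x l t :> (U -> R) by move=> t0; rewrite /xt (max_idPl t0).
rewrite (_ : (x i s : U -> R) = xt i s); last by rewrite xE.
apply: (@picard_error _ _ _ P g C T M n (fun l => X l 0 : U -> R) Wt xt) => //.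
- exact: measurable_chain_drift.
- by move=> t x1 x2 y1 y2 tT; exact: (chain_drift_lip C0 bt_lip int_bt _ _ _ _ tT).
- move=> l; apply: (measurable_continuous_process (x := fun t w => W (maxn l 1) t w)).
    by move=> t _; exact: measurable_funP.
  by apply: W_cont; rewrite leq_maxr.
- move=> l lN; apply: (measurable_continuous_process (x := fun t w => x l t w)).
    by move=> t _; exact: measurable_funP.
  exact: x_cont.
- by move=> l t lN tT; rewrite xE; [exact: chain_moment | case/andP: tT].
move=> l lN; have lN' : (1 <= l <= n.+1)%N by lia.
have := chain_sdeE bt_meas (x_law lN') (x_sde lN).
apply: filterS2 (init lN) => w e0 H t /andP[t0 tT].
have [fi E] := H t t0.
have gE r : r \in `[0, t]%classic -> g r (xt l r w) (xt l.+1 r w) = g r (x l r w) (x l.+1 r w).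
  by rewrite inE/= in_itv/= => /andP[r0 _]; rewrite !xE.
split; first by apply: eq_integrable fi => // r rt; congr EFin; symmetry; exact: gE.
have l1 : (1 <= l)%N by case/andP: lN.
have -> : xt l t w = x l t w by rewrite xE.
have -> : Wt l t w = W l t w by rewrite /Wt (max_idPl t0) (maxn_idPl l1).
have -> : \int[leb]_(r in `[0, t]) g r (xt l r w) (xt l.+1 r w) =
    \int[leb]_(r in `[0, t]) g r (x l r w) (x l.+1 r w) by apply: eq_Rintegral => r /gE.
by rewrite E -e0.
Qed.

Definition fluctuation_rate : R :=
  7 * (40 * (Num.max 1 ((3 + M) * C)) ^+ 3 * (1 + M * expR ((16 * T * C ^+ 2 + 1) * T)) ^+ 2) + 1.

(** The Picard iterates of depth K have a mean square error of order 4^-K and depend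
    on blocks of length K: this is the input of [decorrelated_means]. *)
Lemma fluctuation_means s : 0 <= s <= T ->
  (\sum_(1 <= i < n.+1) \int[P]_w
     (`|n%:R^-1 * \sum_(1 <= j < n.+1) drift_fluctuation P u bt Y s (x i s w) (x j s w)|)%:E
   <= (fluctuation_rate * Num.sqrt n%:R)%:E)%E.
Proof.
move=> sT; have /andP[s0 _] := sT.
set C' := Num.max 1 ((3 + M) * C); pose M' := M * expR ((16 * T * C ^+ 2 + 1) * T).
have CC' : (3 + M) * C <= C' by rewrite le_max lexx orbT.
have MM' : M <= M'.
  by rewrite ler_peMr// -expR0 ler_expR mulr_ge0 ?(ltW T0)// addr_ge0// mulr_ge0 ?sqr_ge0// mulr_ge0// ltW.
have M'0 : 0 <= M' by exact: le_trans MM'.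
apply: (@decorrelated_means _ _ _ P C' M' (drift_fluctuation P u bt Y s) n (fun i => x i s) (fun K i => Z K i s)) => //.
- by rewrite le_max lexx.
- apply: (@measurableT_comp _ _ _ _ _ _
    (fun z : R * R * R => drift_fluctuation P u bt Y z.1.1 z.1.2 z.2) _ (fun z : R * R => (s, z.1, z.2))).
    exact: measurable_drift_fluctuation.
  apply: measurable_fun_pair; last exact: measurable_snd.
  by apply: measurable_fun_pair => //; exact: measurable_fst.
- move=> a b a' b'; apply: le_trans (drift_fluctuation_lip C0 bt_lip int_bt _ _ _ _ sT) _.
  apply: ler_wpM2r; first by rewrite addr_ge0.
  by apply: le_trans CC'; apply: ler_wpM2r => //; rewrite -[leLHS]addr0 lerD// ler_nat.
- move=> a b; apply: le_trans (drift_fluctuation_growth u bt_meas C0 bt_growth M0 moment _ _ sT) _.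
  by apply: ler_wpM2r => //; rewrite !addr_ge0.
- move=> i a iN; have iN' : (1 <= i <= n.+1)%N by lia.
  exact: (centred_drift_fluctuation bt_meas int_bt a sT (same_path_law_marginal s0 (x_law iN'))).
- by move=> i iN; apply: le_trans (chain_moment _ sT) _; [lia | rewrite lee_fin].
- by move=> K i /andP[i1 _] iK; exact: chain_picard_error.
by move=> *; exact: independent_picard.
Qed.

(** * Comparison of the two systems *)

Hypothesis n1 : (1 <= n)%N.
Hypothesis X_cont : forall i, (1 <= i <= n)%N -> continuous_paths (X i).
Hypothesis X_cyclic : X n.+1 = X 1%N.
Hypothesis X_sde : forall i, (1 <= i <= n)%N -> solves_sde P bt (X i) (W i)
  (fun t w => mixture u \d_(X i.+1 t w) (empirical_measure n (fun j => X j t w))).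

Let Xt (i : nat) (t : R) (w : U) : R := X i (Num.max t 0) w.
Let dist (i : nat) (z : R * U) : R := `|Xt i z.1 z.2 - xt i z.1 z.2|.
Let noise (i : nat) (z : R * U) : R :=
  empirical_mean n (fun j => drift_fluctuation P u bt Y z.1 (xt i z.1 z.2) (xt j z.1 z.2)).
Let gap (i : nat) (z : R * U) : R :=
  C * (2 * dist i z + dist i.+1 z + empirical_mean n (fun j => dist j z)) + `|noise i z|.
Let total (z : R * U) : R := \sum_(1 <= i < n.+1) dist i z.
Let forcing (z : R * U) : R :=
  C * (`|xt 1 z.1 z.2| + `|xt n.+1 z.1 z.2|) + \sum_(1 <= i < n.+1) `|noise i z|.

Let X_cont' i : (1 <= i <= n.+1)%N -> continuous_paths (X i).
Proof.
move=> /andP[i1]; rewrite leq_eqVlt => /predU1P[->|iN]; last by apply: X_cont; rewrite i1.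
by rewrite X_cyclic; apply: X_cont; rewrite n1.
Qed.

Let measurable_nonneg_part (Q : process U R) : continuous_paths Q ->
  measurable_fun [set: R * U] (fun z : R * U => Q (Num.max z.1 0) z.2).
Proof.
move=> cQ.
exact: (measurable_continuous_process (x := fun t w => Q t w) (fun t _ => measurable_funP (Q t)) cQ).
Qed.

Let mXt i : (1 <= i <= n.+1)%N -> measurable_fun [set: R * U] (fun z : R * U => Xt i z.1 z.2).
Proof. by move=> iN; apply: measurable_nonneg_part; exact: X_cont'. Qed.

Let mxt i : (1 <= i <= n.+1)%N -> measurable_fun [set: R * U] (fun z : R * U => xt i z.1 z.2).
Proof. by move=> iN; apply: measurable_nonneg_part; exact: x_cont. Qed.

Let mdist i : (1 <= i <= n.+1)%N -> measurable_fun [set: R * U] (dist i).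
Proof.
move=> iN; apply: measurableT_comp => //; apply: measurable_funB; [exact: mXt|exact: mxt].
Qed.

Let mnoise i : (1 <= i <= n)%N -> measurable_fun [set: R * U] (noise i).
Proof.
move=> /andP[i1 iN]; have iN' : (1 <= i <= n.+1)%N by rewrite i1 leqW.
apply: measurable_funM => //; apply: measurable_sum_range => j /andP[j1 jN].
have jN' : (1 <= j <= n.+1)%N by rewrite j1 leqW.
apply: (@measurableT_comp _ _ _ _ _ _
  (fun z : R * R * R => drift_fluctuation P u bt Y z.1.1 z.1.2 z.2) _
  (fun z : R * U => (z.1, xt i z.1 z.2, xt j z.1 z.2))).
  exact: measurable_drift_fluctuation.
by apply: measurable_fun_pair; [apply: measurable_fun_pair => //; exact: mxt | exact: mxt].
Qed.

Let mgap i : (1 <= i <= n)%N -> measurable_fun [set: R * U] (gap i).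
Proof.
move=> /andP[i1 iN]; apply: measurable_funD; last first.
  by apply: measurableT_comp => //; apply: mnoise; rewrite i1.
apply: measurable_funM => //; apply: measurable_funD.
  apply: measurable_funD; last by apply: mdist; lia.
  by apply: measurable_funM => //; apply: mdist; rewrite i1 leqW.
apply: measurable_funM => //; apply: measurable_sum_range => j /andP[j1 jN].
by apply: mdist; rewrite j1 leqW.
Qed.

Let mtotal : measurable_fun [set: R * U] total.
Proof. by apply: measurable_sum_range => i /andP[i1 iN]; apply: mdist; rewrite i1 leqW. Qed.

Let mforcing : measurable_fun [set: R * U] forcing.
Proof.
apply: measurable_funD.
  apply: measurable_funM => //; apply: measurable_funD; apply: measurableT_comp => //.
  exact: mxt.
  by apply: mxt; rewrite /= leqnn.
by apply: measurable_sum_range => i iN; apply: measurableT_comp => //; exact: mnoise.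
Qed.

Let dist0 i z : 0 <= dist i z. Proof. exact: normr_ge0. Qed.

Let gap0 i z : 0 <= gap i z.
Proof.
rewrite addr_ge0// mulr_ge0// addr_ge0//; first by rewrite addr_ge0// mulr_ge0.
by rewrite mulr_ge0 ?invr_ge0// sumr_ge0.
Qed.

Let total0 z : 0 <= total z. Proof. exact: sumr_ge0. Qed.

Let forcing0 z : 0 <= forcing z.
Proof. by rewrite addr_ge0 ?sumr_ge0// mulr_ge0// addr_ge0. Qed.

Let sum_gap z : \sum_(1 <= i < n.+1) gap i z <= 4 * C * total z + forcing z.
Proof.
apply: (@sum_drift_gap _ _ _ P u bt Y C C0 n z.1 (fun i => Xt i z.1 z.2) (fun i => xt i z.1 z.2)) => //.
by rewrite /Xt X_cyclic.
Qed.

Let pathwise_gap i : (1 <= i <= n)%N -> {ae P, forall w, forall t, 0 <= t <= T ->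
  ((dist i (t, w))%:E <= \int[leb]_(s in `[0%R, t]) (gap i (s, w))%:E)%E}.
Proof.
move=> iN; have iN' : (1 <= i <= n.+1)%N by lia.
have iN1 : (1 <= i.+1 <= n.+1)%N by lia.
have := chain_sdeE bt_meas (x_law iN') (x_sde iN).
apply: filterS3 (init iN) (X_sde iN) => w e0 HX Hx t /andP[t0 tT].
have [gi gE] := Hx t t0; have [_ fi fE] := HX t t0.
rewrite /dist /Xt /xt/= (max_idPl t0) fE gE e0.
set a := \int[leb]_(s in _) _; set b := \int[leb]_(s in _) _.
have -> : x i 0 w + a + W i t w - (x i 0 w + b + W i t w) = a - b by lra.
apply: le_trans (leb_dist_Rintegral_le _ fi _) _ => //.
  by have /measurable_int/measurable_EFinP := gi.
apply: leb_le_integral => s; first by rewrite lee_fin.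
rewrite /= in_itv/= => /andP[s0 st]; have sT : 0 <= s <= T by rewrite s0 (le_trans st).
rewrite lee_fin empirical_driftE//.
have := drift_gap P u Y bt_lip (fun i => X i s w) (fun i => x i s w) n1 i sT.
by rewrite /gap /dist /noise /Xt /xt/= (max_idPl s0).
Qed.

Let gronwall_constant : R := 2 * (4 * C) * expR ((2 * (4 * C) + 1) * T) + 1.

Let mEFin (f : R * U -> R) : measurable_fun [set: R * U] f ->
  measurable_fun [set: R * U] (EFin \o f).
Proof. by move=> mf; exact/measurable_EFinP. Qed.

Let msection (f : R * U -> R) w : measurable_fun [set: R * U] f ->
  measurable_fun [set: R] (fun s => (f (s, w))%:E).
Proof.
move=> mf; apply/measurable_EFinP.
exact: (measurableT_comp mf (measurable_pair2 w)).
Qed.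

(* Gronwall's lemma needs the finiteness of one path at a time, which is given by
   continuity. *)
Let total_integrable w : (\int[leb]_(s in `[0%R, T]) (total (s, w))%:E < +oo)%E.
Proof.
have cont (Q : process U R) : continuous_paths Q ->
    leb.-integrable `[0, T] (EFin \o (fun s => Q (Num.max s 0) w)).
  move=> cQ; have : leb.-integrable `[0, T] (EFin \o (fun s => Q s w)).
    apply: (continuous_compact_integrable (@segment_compact _ 0 T)).
    by apply: continuous_subspaceW (cQ w) => s; rewrite /= !in_itv/= => /andP[-> _//].
  apply: eq_integrable => //= s; rewrite inE/= in_itv/= => /andP[s0 _].
  by rewrite (max_idPl s0).
have int_dist i : (1 <= i <= n)%N -> (\int[leb]_(s in `[0%R, T]) (dist i (s, w))%:E < +oo)%E.
  move=> iN; have iN' : (1 <= i <= n.+1)%N by lia.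
  have := integrableB _ (cont _ (X_cont iN)) (cont _ (x_cont iN')).
  by move=> /(_ (measurable_itv _)) /integrableP[_].
rewrite /total; under eq_integral do rewrite -sumEFin.
have mI : measurable (`[0%R, T]%classic : set R) by [].
rewrite (ge0_integral_sum_range leb (F := fun i s => (dist i (s, w))%:E) mI)//.
- rewrite big_nat_cond; apply: lte_sum_pinfty => i; rewrite andbT ltnS => iN; exact: int_dist.
- by move=> i iN; apply: measurable_funTS; apply: msection; apply: mdist; lia.
- by move=> i z; rewrite lee_fin.
Qed.

Let pathwise_total : {ae P, forall w,
  (\sum_(1 <= i < n.+1) \int[leb]_(s in `[0%R, T]) (gap i (s, w))%:E <=
   gronwall_constant%:E * \int[leb]_(s in `[0%R, T]) (forcing (s, w))%:E)%E}.
Proof.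
have all : {ae P, forall w, forall i, (1 <= i <= n)%N -> forall t, 0 <= t <= T ->
  ((dist i (t, w))%:E <= \int[leb]_(s in `[0%R, t]) (gap i (s, w))%:E)%E}.
  apply: ae_foralln => i; have [iN|iN] := boolP (1 <= i <= n)%N.
    by apply: filterS (pathwise_gap iN) => w H _.
  exact: aeW.
apply: filterS all => w H.
have sumE t : (\sum_(1 <= i < n.+1) \int[leb]_(s in `[0%R, t]) (gap i (s, w))%:E <=
    \int[leb]_(s in `[0%R, t]) ((4 * C)%:E * (total (s, w))%:E + (forcing (s, w))%:E))%E.
  have mI : measurable (`[0%R, t]%classic : set R) by [].
  rewrite -(ge0_integral_sum_range leb (F := fun i s => (gap i (s, w))%:E) mI)//.
    apply: leb_le_integral => s; first by move=> _; apply: sume_ge0 => i _; rewrite lee_fin.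
    by move=> _; rewrite sumEFin -EFinM -EFinD lee_fin.
    by move=> i iN; apply: measurable_funTS; apply: msection; exact: mgap.
  by move=> i z; rewrite lee_fin.
apply: le_trans (sumE T) _.
apply: gronwall_integral => //.
- by rewrite mulr_ge0.
- exact: ltW.
- exact: msection.
- by move=> s; rewrite lee_fin.
- exact: msection.
- by move=> s; rewrite lee_fin.
move=> t tT; apply: le_trans (sumE t); rewrite /total -sumEFin.
rewrite [leLHS]big_nat_cond [leRHS]big_nat_cond; apply: lee_sum => i; rewrite andbT ltnS => iN.
exact: H.
Qed.

Definition comparison_rate : R :=
  (2 * (4 * C) * expR ((2 * (4 * C) + 1) * T) + 1) *
  (T * (2 * C * (1 + M) + fluctuation_rate)).

Let mean_forcing s : 0 <= s <= T ->
  (\int[P]_w (forcing (s, w))%:E <=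
   ((2 * C * (1 + M) + fluctuation_rate) * Num.sqrt n%:R)%:E)%E.
Proof.
move=> sT; have /andP[s0 _] := sT.
have xE i : xt i s = x i s by rewrite /xt (max_idPl s0).
have noise_le := fluctuation_means sT.
have ends : (\int[P]_w (C * (`|x 1%N s w| + `|x n.+1 s w|))%:E <= (2 * C * (1 + M))%:E)%E.
  apply: le_trans (expectation_le_squares (f := fun w => C * (`|x 1%N s w| + `|x n.+1 s w|))
    (c0 := 2 * C) (c1 := C) (c2 := C) (c3 := 0) (c4 := 0)
    (g1 := x 1%N s) (g2 := x n.+1 s) (g3 := cst 0) (g4 := cst 0) (m1 := M) (m2 := M) (m3 := 0) (m4 := 0)
    (P := P) _ _ _ _ _ _ _ _ _ _ _ _ _ _) _ => //.
  - by rewrite mulr_ge0.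
  - exact: chain_moment.
  - by apply: chain_moment => //; rewrite /= leqnn.
  - by under eq_integral do rewrite expr0n/=; rewrite integral0.
  - by under eq_integral do rewrite expr0n/=; rewrite integral0.
  - move=> w; rewrite mulr_ge0 ?addr_ge0//=.
    rewrite !mul0r !addr0; have := ler_wpM2l C0 (lerD (ler_norm_sqr (x 1%N s w)) (ler_norm_sqr (x n.+1 s w))); lra.
  by rewrite lee_fin; lra.
have sqrt1 : 1 <= Num.sqrt n%:R :> R by rewrite -[leLHS]sqrtr1 ler_wsqrtr// ler1n.
rewrite mulrDl EFinD /forcing/=; under eq_integral do rewrite EFinD -sumEFin.
have mx i : (1 <= i <= n.+1)%N -> measurable_fun [set: U] (fun w => `|xt i s w|).
  by move=> iN; apply: measurableT_comp => //; rewrite xE; exact: measurable_funP.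
have iN1 : (1 <= 1 <= n.+1)%N by [].
have iNn : (1 <= n.+1 <= n.+1)%N by rewrite leqnn.
have mno i : (1 <= i <= n)%N -> measurable_fun [set: U] (fun w => (`|noise i (s, w)|)%:E).
  move=> iN; apply/measurable_EFinP; apply: measurableT_comp => //.
  exact: (measurableT_comp (mnoise iN) (measurable_pair1 s)).
rewrite ge0_integralD//; last 4 first.
- by move=> w _; rewrite lee_fin mulr_ge0// addr_ge0.
- apply/measurable_EFinP; apply: measurable_funM => //.
  by apply: measurable_funD; [exact: (mx _ iN1) | exact: (mx _ iNn)].
- by move=> w _; apply: sume_ge0 => i _.
- under eq_fun do rewrite sumEFin.
  by apply/measurable_EFinP; apply: measurable_sum_range => i iN; apply/measurable_EFinP; exact: mno.
apply: leeD.
  rewrite !xE; apply: le_trans ends _; rewrite lee_fin ler_peMr//.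
  by rewrite mulr_ge0// ?mulr_ge0// addr_ge0.
have noiseE i w : (`|noise i (s, w)|)%:E =
    (`|n%:R^-1 * \sum_(1 <= j < n.+1) drift_fluctuation P u bt Y s (x i s w) (x j s w)|)%:E.
  rewrite /noise /= /empirical_mean xE; congr ((`|_ * _|)%:E).
  by apply: eq_bigr => j _; rewrite xE.
have no0 i w : (0 <= (`|noise i (s, w)|)%:E)%E by rewrite lee_fin.
rewrite (ge0_integral_sum_range P measurableT mno no0).
apply: le_trans noise_le; rewrite le_eqVlt; apply/orP; left; apply/eqP.
by apply: eq_bigr => i _; apply: eq_integral => w _; exact: noiseE.
Qed.

(** On [0, t], each distance is below the integral of [gap] over [0, T], which does
    not depend on the time at which it is taken; so is its supremum. The sum of these
    integrals is bounded by [forcing] path by path, and the mean of [forcing] by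
    [fluctuation_means] and the second moments. *)
Lemma mean_sup_distance t : 0 <= t <= T ->
  (\sum_(1 <= i < n.+1)
     \int[P]_w (sup [set `|X i s w - x i s w| | s in `[0%R, t]])%:E <=
   (comparison_rate * Num.sqrt n%:R)%:E)%E.
Proof.
move=> /andP[t0 tT]; set S := fun i w => sup [set `|X i s w - x i s w| | s in `[0, t]].
have gapE0 i z : (0 <= (gap i z)%:E)%E by rewrite lee_fin.
have S_le i : (1 <= i <= n)%N ->
    (\int[P]_w (S i w)%:E <= \int[P]_w \int[leb]_(s in `[0%R, T]) (gap i (s, w))%:E)%E.
  move=> iN; apply: ae_ge0_le_integral_lower.
  - by move=> w; rewrite lee_fin; apply: sup_ge0 => _ [s _ <-].
  - by move=> w; apply: integral_ge0 => s _; exact: gapE0.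
  - exact: (measurable_time_integral T (mEFin (mgap iN)) (gapE0 i)).
  apply: filterS (pathwise_gap iN) => w H.
  have I0 : (0 <= \int[leb]_(s in `[0%R, T]) (gap i (s, w))%:E)%E.
    by apply: integral_ge0 => s _; exact: gapE0.
  have le_I s : 0 <= s <= t ->
      ((`|X i s w - x i s w|)%:E <= \int[leb]_(s in `[0%R, T]) (gap i (s, w))%:E)%E.
    move=> /andP[s0 st]; have sT : 0 <= s <= T by rewrite s0 (le_trans st).
    have := H s sT; rewrite /dist /Xt /xt/= (max_idPl s0) => /le_trans; apply.
    apply: (@ge0_subset_integral _ _ _ leb) => //.
    - by apply: measurable_funTS; apply: msection; exact: mgap.
    by move=> r; rewrite /= !in_itv/= => /andP[-> /le_trans]; apply; case/andP: sT.
  move: I0 le_I; case: (\int[leb]_(s in _) _)%E => [I| |] // I0 le_I; last by rewrite leey.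
  rewrite lee_fin; apply: ge_sup.
    by exists `|X i 0 w - x i 0 w|, 0 => //; rewrite /= in_itv/= lexx.
  by move=> _ [s + <-]; rewrite /= in_itv/= -lee_fin => /le_I.
apply: (@le_trans _ _ (\sum_(1 <= i < n.+1) \int[P]_w \int[leb]_(s in `[0%R, T]) (gap i (s, w))%:E)%E).
  rewrite [leLHS]big_nat_cond [leRHS]big_nat_cond; apply: lee_sum => i.
  by rewrite andbT ltnS; exact: S_le.
rewrite -(ge0_integral_sum_range P
  (F := fun i w => \int[leb]_(s in `[0%R, T]) (gap i (s, w))%:E)%E)//; last 2 first.
- by move=> i iN; exact: (measurable_time_integral T (mEFin (mgap iN)) (gapE0 i)).
- by move=> i w; apply: integral_ge0 => s _; exact: gapE0.
have forcingE0 z : (0 <= (forcing z)%:E)%E by rewrite lee_fin.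
have mI := measurable_time_integral T (mEFin mforcing) forcingE0.
have K0 : 0 <= gronwall_constant.
  by rewrite addr_ge0// !mulr_ge0 ?expR_ge0.
have I0 w : (0 <= \int[leb]_(s in `[0%R, T]) (forcing (s, w))%:E)%E.
  by apply: integral_ge0 => s _; exact: forcingE0.
apply: (@le_trans _ _ (\int[P]_w (gronwall_constant%:E * \int[leb]_(s in `[0%R, T]) (forcing (s, w))%:E))%E).
  apply: ae_ge0_le_integral_lower pathwise_total.
  - by move=> w; apply: sume_ge0 => i _; apply: integral_ge0 => s _; exact: gapE0.
  - by move=> w; rewrite mule_ge0 ?lee_fin.
  - by apply: measurable_funeM; exact: mI.
rewrite (ge0_integralZl P measurableT mI (fun w _ => I0 w)) ?lee_fin//.
rewrite (tonelli_time P T (mEFin mforcing) forcingE0).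
rewrite /comparison_rate -mulrA EFinM; apply: lee_wpmul2l; first by rewrite lee_fin.
set q := (2 * C * (1 + M) + fluctuation_rate) * Num.sqrt n%:R.
have q0 : (0 <= q%:E)%E.
  apply: le_trans (mean_forcing (s := 0) _); last by rewrite lexx ltW.
  by apply: integral_ge0 => w _; exact: forcingE0.
apply: (@le_trans _ _ (\int[leb]_(s in `[0%R, T]) (cst q%:E s))%E).
  apply: leb_le_integral => s; first by move=> _; apply: integral_ge0 => w _; exact: forcingE0.
  by rewrite /= in_itv/=; exact: mean_forcing.
have mI0 : measurable (`[0%R, T]%classic : set R) by [].
have qE : ((T * (2 * C * (1 + M) + fluctuation_rate) * Num.sqrt n%:R)%:E = q%:E * T%:E)%E.
  by rewrite -EFinM /q mulrC !mulrA mulrC !mulrA.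
rewrite qE integral_cst//; apply: lee_wpmul2l => //.
exact: lebesgue_measure_0t (ltW T0).
Qed.

End particle_comparison.

Lemma limiting_chain_equations d (U : measurableType d) (R : realType) (P : probability U R)
  (bt : R -> R -> R -> R) (u : {i01 R}) (m0 : probability R R) (W : nat -> process U R)
  (n : nat) (x : nat -> process U R) : (1 <= n)%N ->
  limiting_chain P bt u m0 W n x ->
  (forall i, (1 <= i <= n.+1)%N -> continuous_paths (x i)) /\
  (forall i, (1 <= i <= n)%N -> solves_chain_sde P bt u (x i) (x i.+1) (W i)).
Proof.
move=> n1 [[_ [cn cn1] sn _ _] chain]; split=> i /andP[i1].
  rewrite leq_eqVlt => /predU1P[->//|]; rewrite ltnS leq_eqVlt => /predU1P[->//|iN].
  by have [] := chain i; first by rewrite i1.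
rewrite leq_eqVlt => /predU1P[->//|iN].
by have [] := chain i; first by rewrite i1.
Qed.

Lemma initial_second_moment d (U : measurableType d) (R : realType) (P : probability U R)
  (m0 : probability R R) (Z Y : {mfun U >-> R}) :
  (\int[m0]_y (`|y| ^+ 2)%:E < +oo)%E ->
  same_law (distribution P Z) m0 -> {ae P, forall w, Z w = Y w} ->
  exists A : R, (\int[P]_w (Y w ^+ 2)%:E <= A%:E)%E.
Proof.
move=> fin law ZY; have msq : measurable_fun [set: R] (fun y : R => (y ^+ 2)%:E).
  by apply/measurable_EFinP; exact: measurable_funX.
have E : (\int[P]_w (Y w ^+ 2)%:E = \int[m0]_y (`|y| ^+ 2)%:E)%E.
  transitivity (\int[P]_w (Z w ^+ 2)%:E)%E.
    apply: ae_eq_integral => //.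
    - by apply/measurable_EFinP; apply: measurable_funX; exact: measurable_funP.
    - by apply/measurable_EFinP; apply: measurable_funX; exact: measurable_funP.
    by apply: filterS ZY => w ->.
  rewrite -[LHS](ge0_integral_distribution (P := P) Z msq (fun y => sqr_ge0 y)).
  transitivity (\int[m0]_y (y ^+ 2)%:E)%E.
    by apply: eq_measure_integral => A mA _; exact: law.
  by apply: eq_integral => y _; rewrite real_normK ?num_real.
exists (fine (\int[m0]_y (`|y| ^+ 2)%:E)%E); rewrite E fineK//.
by rewrite ge0_fin_numE// integral_ge0// => y _; rewrite lee_fin sqr_ge0.
Qed.

Theorem proposition3p3 (d : measure_display) (Omega : measurableType d)
  (R : realType) (P : probability Omega R)
  (u : {i01 R}) (T : R) (T_gt0 : 0 < T)
  (bt : R -> R -> R -> R)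
  (bt_meas : measurable_fun
     [set z : R * R * R | 0 <= z.1.1] (fun z : R * R * R => bt z.1.1 z.1.2 z.2))
  (bt_lip_growth : forall T' : R, 0 < T' -> exists C : R,
     [/\ 0 < C,
         forall t x1 x2 y1 y2 : R, 0 <= t <= T' ->
           `|bt t x1 y1 - bt t x2 y2| <= C * (`|x1 - x2| + `|y1 - y2|) &
         forall s x y : R, 0 <= s <= T' -> `|bt s x y| <= C * (1 + `|x| + `|y|)])
  (m0 : probability R R)
  (m0_moment2 : (\int[m0]_y (`|y| ^+ 2)%:E < +oo)%E)
  (W : nat -> process Omega R)
  (W_bm : forall i, (1 <= i)%N -> brownian_motion P (W i))
  (W_indep : mutually_independent P [set i | (1 <= i)%N]
     (fun i => sigma_process (W i)))
  (X : nat -> nat -> process Omega R)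
  (X_sol : forall n, (1 <= n)%N -> finite_particle_system P bt u m0 W n (X n))
  (Xbar : nat -> nat -> process Omega R)
  (Xbar_sol : forall n, (1 <= n)%N -> limiting_chain P bt u m0 W n (Xbar n))
  (X_Xbar_init : forall n i, (1 <= i <= n)%N ->
     {ae P, forall w, X n i 0 w = Xbar n i 0 w})
  (mstar : probability (path_space R) R)
  (Xbar_law : forall n i, (1 <= n)%N -> (1 <= i <= n.+1)%N ->
     same_law (path_law P (Xbar n i)) mstar)
  (m : R -> R -> R)
  (m_density : forall t : R, 0 <= t <= T ->
     [/\ measurable_fun [set: R] (m t),
         forall y : R, 0 < m t y &
         forall A : set R, measurable A ->
           marginal mstar t A = (\int[lebesgue_measure]_(y in A) (m t y)%:E)%E])
  (m_ratio : exists CT : R,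
     (forall t x1 x2 y1 y2 : R, 0 <= t <= T ->
        `|bt t x1 y1 * (m t x1 / m t y1) - bt t x2 y2 * (m t x2 / m t y2)|
          <= CT * (`|x1 - x2| + `|y1 - y2|)) /\
     (forall t x y : R, 0 <= t <= T ->
        `|bt t x y * (m t x / m t y)| <= CT * (1 + `|x| + `|y|))) :
  forall t : R, 0 <= t <= T ->
    (ereal_sup [set ((Num.sqrt n%:R)^-1)%:E *
        \sum_(1 <= i < n.+1)
          'E_P[fun w =>
            (sup [set `|X n i s w - Xbar n i s w| | s in `[0, t]])%R]
      | n in [set n : nat | (1 <= n)%N]] < +oo)%E.
Proof.
move=> t tT; have [C [C_gt0 bt_lip bt_growth]] := bt_lip_growth T T_gt0.
have C0 := ltW C_gt0.
pose Y := Xbar 1%N 1%N.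
have [[_ [cY cZ] sdeY [lawYZ _] _] _] := Xbar_sol 1%N isT.
have int_bt := chain_integrable_section bt_meas C0 bt_lip sdeY.
have init : exists A : R, (\int[P]_w (Y 0%R w ^+ 2)%:E <= A%:E)%E.
  have [_ _ [_ law0 _] _] := X_sol 1%N isT.
  exact: initial_second_moment m0_moment2 (law0 1%N isT) (X_Xbar_init 1%N 1%N isT).
have [M [M0 moment]] := chain_second_moment cY bt_meas C0 T_gt0 bt_lip cZ lawYZ sdeY
  (W_bm 1%N isT) init.
apply: (@le_lt_trans _ _ (comparison_rate C T M)%:E); last exact: ltry.
apply: ge_ereal_sup => _ [n n1 <-].
have [cx sdex] := limiting_chain_equations n1 (Xbar_sol n n1).
have [cyc cX [X_indep _ X_W_indep] sdeX] := X_sol n n1.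
have lawx i : (1 <= i <= n.+1)%N -> same_law (path_law P (Xbar n i)) (path_law P Y).
  by move=> iN A mA; rewrite (Xbar_law n i n1 iN A mA) (Xbar_law 1%N 1%N isT isT A mA).
have W_cont i : (1 <= i)%N -> continuous_paths (W i) by move=> /W_bm[].
have expectationE (f : Omega -> R) : 'E_P[f]%E = (\int[P]_w (f w)%:E)%E by rewrite unlock.
have := mean_sup_distance cY bt_meas C0 T_gt0 M0 bt_lip bt_growth int_bt moment
  W_cont X_indep W_indep X_W_indep cx lawx sdex (X_Xbar_init n) n1 cX cyc sdeX tT.
have sqrt_gt0 : 0 < Num.sqrt n%:R :> R by rewrite sqrtr_gt0 ltr0n.
under eq_bigr do rewrite -expectationE.
move=> le; apply: le_trans (lee_wpmul2l _ le) _; first by rewrite lee_fin invr_ge0 ltW.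
by rewrite -EFinM lee_fin mulrCA mulVf ?mulr1// gt_eqF.
Qed.
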